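(* Let $K,M,N$ be integers with $K>M\ge 2$ and $N\ge 3$, and let $\Omega\subset\mathbb{C}^3$ be a pseudoconvex domain with $0\in b\Omega$ which is defined near $0$ by the defining function $$ r(z)=\mathrm{Re}(z_3)+|z_1^M|^2+|z_2^N+z_2z_1^K|^2 .$$ Then the order of the root taken in the radical required in the second step of Kohn's algorithm for subelliptic multipliers (the passage from $J_1$ to $I_1=\mathrm{rad}(J_1)$; see the context) is at least $K$. That is, if $s$ is a positive integer such that $f^s\in J_1$ for every $f\in I_1$, then $s\ge K$. Hence this order is independent of the type $\mathbf{T}(b\Omega,0)$ of $b\Omega$ at $0$ (it cannot be bounded in terms of the type). In particular, Kohn's procedure gives no positive lower bound, in terms of the type at $0$, for the value of $\epsilon$ in a subelliptic estimate at $0$.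
   Context: Type: for a real hypersurface $S$ with defining function $r$ near $p$, $\mathbf{T}(S,p)=\sup_z \nu(z^*r)/\nu(z)$, where the supremum is over nonconstant germs of parametrized holomorphic curves $z$ with $z(0)=p$, and $\nu$ denotes order of vanishing at $0$ (of $z^*r=r\circ z$ and of $z-p$ respectively). For the domains in question $\mathbf{T}(b\Omega,0)=2\max(M,N)$. Subelliptic estimate: a subelliptic estimate of order $\epsilon>0$ holds on $(0,1)$ forms at $p\in b\Omega$ if there are a neighborhood $U$ of $p$ and $C>0$ with $\|\phi\|_\epsilon^2\le C\,Q(\phi,\phi)$, where $Q(\phi,\phi)=\|\overline\partial\phi\|^2+\|\overline\partial^*\phi\|^2+\|\phi\|^2$, for all $(0,1)$ forms $\phi$ compactly supported in $U$ and in the domain of $\overline\partial^*$; $\|\cdot\|$ is the $L^2$ norm and $\|\cdot\|_\epsilon$ the Sobolev $\epsilon$ norm. A germ $f$ of a smooth function at $p$ is a subelliptic multiplier if $\|f\phi\|_\epsilon^2\le C\,Q(\phi,\phi)$ for some $\epsilon,C>0$ and all such $\phi$ supported in some neighborhood of $p$. Kohn's algorithm for these domains reduces to the following algorithm in the ring $\mathcal{O}$ of germs at $0$ of holomorphic functions of two variables $(z,w)=(z_1,z_2)$, applied to $h_1=z^M$, $h_2=w^N+wz^K$. Write a $1$-form $a\,dz+b\,dw$ as the row $(a,b)$. Let $\mathcal{M}_0$ be the collection of allowable rows spanned by $dh_1,dh_2$, let $J_0$ be the ideal generated by the $2\times 2$ determinants of rows in $\mathcal{M}_0$, and let $I_0=\mathrm{rad}(J_0)$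 (first step). For $k\ge 0$, let $\mathcal{M}_{k+1}$ be spanned by $\mathcal{M}_k$ together with all $df$, $f\in I_k$; let $J_{k+1}$ be the ideal generated by $I_k$ and all $2\times 2$ determinants of rows in $\mathcal{M}_{k+1}$; and let $I_{k+1}=\mathrm{rad}(J_{k+1})$. The ''order of the root taken'' in passing from $J_k$ to $I_k$ is the least positive integer $s$ such that $f^s\in J_k$ for all $f\in I_k$. All elements of the $I_k$ are subelliptic multipliers, and when some $I_k=(1)$ a subelliptic estimate follows. The value of $\epsilon$ obtained from the procedure depends on the number of steps and on the orders of the roots taken: the determinant of the Levi form is a multiplier with $\epsilon=\tfrac12$, passing from a multiplier to its differential as an allowable row halves $\epsilon$, and taking a root of order $s$ divides the known $\epsilon$ by $s$. *)

(* Defs.v *)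
(* Stdlib real numbers, with Coquelicot's complex numbers and extended reals. *)
From Stdlib Require Import Reals.
From Coquelicot Require Import Coquelicot.

Open Scope R_scope.

(** * Germs at the origin of holomorphic functions of two variables *)

(* A germ is represented by a function on C^2 of which only the values near the
   origin matter; [germ_eq] is equality of germs, and every collection of germs
   built below by [ideal_generated] or [rows_spanned] is closed under it. *)
Definition germ : Type := C -> C -> C.

Definition germ_eq (f g : germ) : Prop :=
  exists rho : R, 0 < rho /\
    forall z w : C, Cmod z < rho -> Cmod w < rho -> f z w = g z w.

(* f is near 0 the sum of an absolutely convergent power series
   sum_(i, j) c_ij z^i w^j, summed by total degree. *)
Definition holomorphic (f : germ) : Prop :=
  exists (c : nat -> nat -> C) (rho : R), 0 < rho /\
    forall z w : C, Cmod z < rho -> Cmod w < rho ->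
      ex_series (fun n : nat =>
        sum_n (fun i : nat => Cmod (c i (n - i)%nat * z ^ i * w ^ (n - i))%C) n) /\
      is_series (K := C_AbsRing) (V := C_NormedModule)
        (fun n : nat =>
          sum_n (G := C_AbelianMonoid)
            (fun i : nat => (c i (n - i)%nat * z ^ i * w ^ (n - i))%C) n)
        (f z w).

Definition germ_zero : germ := fun _ _ => RtoC 0.
Definition germ_one : germ := fun _ _ => RtoC 1.
Definition germ_add (f g : germ) : germ := fun z w => (f z w + g z w)%C.
Definition germ_mul (f g : germ) : germ := fun z w => (f z w * g z w)%C.
Definition germ_pow (f : germ) (s : nat) : germ := fun z w => (f z w ^ s)%C.

Inductive ideal_generated (S : germ -> Prop) : germ -> Prop :=
| ideal_zero (f : germ) :
    germ_eq f germ_zero -> ideal_generated S f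
| ideal_add (a g h f : germ) :
    holomorphic a -> S g -> ideal_generated S h ->
    germ_eq f (germ_add (germ_mul a g) h) -> ideal_generated S f.

Definition rad (J : germ -> Prop) (f : germ) : Prop :=
  holomorphic f /\ exists s : nat, (0 < s)%nat /\ J (germ_pow f s).

(** * Rows, i.e. the 1-forms a dz + b dw *)

Definition row : Type := (germ * germ)%type.

Definition d (f : germ) : row :=
  (fun z w => C_derive (fun x => f x w) z,
   fun z w => C_derive (fun y => f z y) w).

Definition row_det (u v : row) : germ :=
  fun z w => (fst u z w * snd v z w - snd u z w * fst v z w)%C.

Inductive rows_spanned (S : row -> Prop) : row -> Prop :=
| rows_zero (u : row) :
    germ_eq (fst u) germ_zero -> germ_eq (snd u) germ_zero -> rows_spanned S u
| rows_add (a : germ) (v t u : row) :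
    holomorphic a -> S v -> rows_spanned S t ->
    germ_eq (fst u) (germ_add (germ_mul a (fst v)) (fst t)) ->
    germ_eq (snd u) (germ_add (germ_mul a (snd v)) (snd t)) ->
    rows_spanned S u.

Definition is_det_of (A : row -> Prop) (f : germ) : Prop :=
  exists u v : row, A u /\ A v /\ f = row_det u v.

(** * Kohn's algorithm *)

Record stage : Type := Stage {
  stage_rows : row -> Prop;
  stage_J : germ -> Prop
}.

Definition stage_I (T : stage) : germ -> Prop := rad (stage_J T).

Fixpoint kohn (h1 h2 : germ) (k : nat) : stage :=
  match k with
  | O =>
      let rows := rows_spanned (fun u => u = d h1 \/ u = d h2) in
      Stage rows (ideal_generated (is_det_of rows))
  | S k' =>
      let T := kohn h1 h2 k' in
      let rows := rows_spanned (fun u =>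
        stage_rows T u \/ exists f : germ, stage_I T f /\ u = d f) in
      Stage rows (ideal_generated (fun f => stage_I T f \/ is_det_of rows f))
  end.

Definition kohn_J (h1 h2 : germ) (k : nat) : germ -> Prop :=
  stage_J (kohn h1 h2 k).
Definition kohn_I (h1 h2 : germ) (k : nat) : germ -> Prop :=
  stage_I (kohn h1 h2 k).

Definition root_exponent (J I : germ -> Prop) (s : nat) : Prop :=
  (0 < s)%nat /\ forall f : germ, I f -> J (germ_pow f s).

Definition root_order (J I : germ -> Prop) (s : nat) : Prop :=
  root_exponent J I s /\ forall t : nat, root_exponent J I t -> (s <= t)%nat.

(* The epsilon known for the elements of I_k when the root taken from J_j to
   I_j has order s j: it is 1/2 on J_0, is halved by each passage from
   multipliers to their differentials, and is divided by the order of each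
   root. *)
Fixpoint epsilon_after (s : nat -> nat) (k : nat) : R :=
  match k with
  | O => / 2 / INR (s O)
  | S k' => epsilon_after s k' / 2 / INR (s k)
  end.

(* The procedure stops at the first k with I_k = (1). *)
Definition kohn_epsilon (h1 h2 : germ) (eps : R) : Prop :=
  exists (k : nat) (s : nat -> nat),
    (forall j : nat, (j <= k)%nat ->
       root_order (kohn_J h1 h2 j) (kohn_I h1 h2 j) (s j)) /\
    kohn_I h1 h2 k germ_one /\
    (forall j : nat, (j < k)%nat -> ~ kohn_I h1 h2 j germ_one) /\
    eps = epsilon_after s k.

(** * Type of a real hypersurface in C^3 *)

Definition C3 : Type := (C * C * C)%type.

Definition c1 (x : C3) : C := fst (fst x).
Definition c2 (x : C3) : C := snd (fst x).
Definition c3 (x : C3) : C := snd x.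

Definition origin : C3 := (RtoC 0, RtoC 0, RtoC 0).

Definition dist3 (x y : C3) : R :=
  sqrt (Cmod (c1 x - c1 y) ^ 2 + Cmod (c2 x - c2 y) ^ 2 + Cmod (c3 x - c3 y) ^ 2).

Definition holomorphic1 (g : C -> C) : Prop :=
  exists (a : nat -> C) (rho : R), 0 < rho /\
    forall t : C, Cmod t < rho ->
      is_series (K := C_AbsRing) (V := C_NormedModule)
        (fun n : nat => (a n * t ^ n)%C) (g t).

(* The largest m with u(t) = O(|t|^m) at t = 0, or p_infty if there is no
   largest one.  A map into C^3 is measured through its Euclidean length. *)
Definition vanishing_order (u : C -> R) : Rbar :=
  Rbar_lub (fun x : Rbar => exists m : nat, x = Finite (INR m) /\
    exists A rho : R, 0 < rho /\
      forall t : C, Cmod t < rho -> Rabs (u t) <= A * Cmod t ^ m).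

Definition curve_germ (p : C3) (zeta : C -> C3) : Prop :=
  holomorphic1 (fun t => c1 (zeta t)) /\
  holomorphic1 (fun t => c2 (zeta t)) /\
  holomorphic1 (fun t => c3 (zeta t)) /\
  zeta (RtoC 0) = p /\
  ~ (exists rho : R, 0 < rho /\ forall t : C, Cmod t < rho -> zeta t = p).

(* T(S, p), for S with defining function r near p. *)
Definition hypersurface_type (r : C3 -> R) (p : C3) : Rbar :=
  Rbar_lub (fun x : Rbar => exists zeta : C -> C3, curve_germ p zeta /\
    x = Rbar_div (vanishing_order (fun t => r (zeta t)))
                 (vanishing_order (fun t => dist3 (zeta t) p))).

(** * Pseudoconvex domains in C^3 *)

Definition line_point (x v : C3) (t : C) : C3 :=
  ((c1 x + t * c1 v)%C, (c2 x + t * c2 v)%C, (c3 x + t * c3 v)%C).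

Definition expi (theta : R) : C := (cos theta, sin theta).

Definition open3 (A : C3 -> Prop) : Prop := open (A : C * C * C -> Prop).

Definition near3 (p : C3) (P : C3 -> Prop) : Prop :=
  locally (p : C * C * C) (P : C * C * C -> Prop).

Definition connected3 (A : C3 -> Prop) : Prop :=
  forall U V : C3 -> Prop, open3 U -> open3 V ->
    (forall x, A x -> U x \/ V x) ->
    (forall x, ~ (A x /\ U x /\ V x)) ->
    (forall x, A x -> U x) \/ (forall x, A x -> V x).

Definition boundary3 (A : C3 -> Prop) (p : C3) : Prop :=
  forall P : C3 -> Prop, near3 p P ->
    (exists x, P x /\ A x) /\ (exists x, P x /\ ~ A x).

Definition continuous_on3 (A : C3 -> Prop) (u : C3 -> R) : Prop :=
  forall x, A x -> continuous (u : C * C * C -> R) (x : C * C * C).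

(* Plurisubharmonicity of a continuous function on an open set: the sub-mean
   value inequality on the boundary of every closed disc, contained in the set,
   of a complex line. *)
Definition plurisubharmonic (A : C3 -> Prop) (u : C3 -> R) : Prop :=
  forall x v : C3,
    (forall t : C, Cmod t <= 1 -> A (line_point x v t)) ->
    u x <= / (2 * PI) *
           RInt (fun theta => u (line_point x v (expi theta))) 0 (2 * PI).

Definition compact3 (A : C3 -> Prop) : Prop :=
  open3 (fun x => ~ A x) /\
  exists B : R, forall x, A x -> dist3 x origin <= B.

(* Pseudoconvex: there is a continuous plurisubharmonic exhaustion function. *)
Definition pseudoconvex (A : C3 -> Prop) : Prop :=
  exists u : C3 -> R,
    continuous_on3 A u /\ plurisubharmonic A u /\
    forall b : R, compact3 (fun x => A x /\ u x <= b).

(** * The domains in question *)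

Definition h1 (M : nat) : germ := fun z w => (z ^ M)%C.
Definition h2 (K N : nat) : germ := fun z w => (w ^ N + w * z ^ K)%C.

Definition r_def (K M N : nat) (x : C3) : R :=
  Re (c3 x) + Cmod (h1 M (c1 x) (c2 x)) ^ 2 + Cmod (h2 K N (c1 x) (c2 x)) ^ 2.

Definition is_domain (K M N : nat) (Omega : C3 -> Prop) : Prop :=
  open3 Omega /\ connected3 Omega /\ pseudoconvex Omega /\
  boundary3 Omega origin /\
  near3 origin (fun x => Omega x <-> r_def K M N x < 0).

(* Main.v *)
(* Put g = N w^(N-1) + z^K.  Since det(dh_1, dh_2) = M z^(M-1) g and g has no
   multiple factor, I_0 = (z g), and J_1 = (z g, z^M w^(N-2), w^(2N-2)).  On the
   line w = 0 every element of J_1 is O(z^K), because the dw-component of every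
   row in M_1 is; as z lies in I_1 = (z, w), a root exponent s satisfies
   z^s = O(z^K), so s >= K.

   The equality I_0 = (z g) uses division by g: a germ vanishing on g = 0 leaves
   a remainder of degree < N - 1 in w which vanishes at the N - 1 roots w of
   g(z, .), so the remainder is zero.

   The type does not see K once K >= N.  Along a curve t^m (k_1, k_2, k_3) with
   some k_i(0) <> 0, averaging over roots of unity removes Re zeta_3, and what
   remains is of order at most 2 max(M, N) m.  For the domain one takes {r < 0}
   itself, with exhaustion function |x|^2 - 1/r. *)

(* The bound on dw-components rests on [N >= 3]. For [f = z g q] the dw-component of [d f] is
   [z (g_w q + g q_w)], and on [w = 0] the derivative [g_w = N (N-1) w^(N-2)] vanishes while
   [g = z^K]. Every product in a determinant contains exactly one dw-component, so the bound passes
   to [J_1]. Membership in a radical reveals only a power of a germ. [I_0] is therefore approached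
   through zero sets: elements of [J_0], hence of [I_0], vanish on [z g = 0]. That the order of a
   root exists as a number needs some finite exponent. Explicit combinations supply it: [z^(K+M)]
   and [w^(2N-2)] lie in [J_1]. The third step reaches 1 through [dz] and [dw] with a root of order
   1, so [eps = 1 / (8 s_0 s_1)] with [s_1 >= K]. On the analytic side, holomorphy is handled as
   geometric growth of coefficients, and derivatives of arbitrary germs are never computed, only
   bounded through difference quotients. *)
Require Import Defs.
From Stdlib Require Import Reals Lra Lia List Wf_nat ClassicalEpsilon.
From Coquelicot Require Import Coquelicot.
(* Reals has its own c1. *)
Import Defs.
Open Scope R_scope.

(** * Complex series *)

Notation Csum := (sum_n (G := C_AbelianMonoid)).
Notation Cseries := (is_series (K := C_AbsRing) (V := C_NormedModule)).

(** Coquelicot's sums state equations in the carrier of an algebraic structure; the [change] returns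
    them to [C], where [ring] recognises them. *)
Ltac Cring := match goal with |- ?x = ?y => change (@eq C x y) end; ring.

Lemma Csum_S (a : nat -> C) (n : nat) : Csum a (S n) = (Csum a n + a (S n))%C.
Proof. apply (sum_Sn a n). Qed.

Lemma Csum_O (a : nat -> C) : Csum a 0 = a 0%nat.
Proof. apply (sum_O a). Qed.

Lemma Csum_ext (a b : nat -> C) (n : nat) :
  (forall k, (k <= n)%nat -> a k = b k) -> Csum a n = Csum b n.
Proof. intros H. now apply sum_n_ext_loc. Qed.

Lemma Csum_plus (a b : nat -> C) (n : nat) :
  Csum (fun k => (a k + b k)%C) n = (Csum a n + Csum b n)%C.
Proof.
  induction n as [|n IH]; rewrite ?Csum_O, ?Csum_S; [reflexivity|].
  rewrite IH. Cring.
Qed.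

Lemma Csum_scal (u : C) (a : nat -> C) (n : nat) :
  Csum (fun k => (u * a k)%C) n = (u * Csum a n)%C.
Proof.
  induction n as [|n IH]; rewrite ?Csum_O, ?Csum_S; [reflexivity|].
  rewrite IH. Cring.
Qed.

Lemma Csum_zero (n : nat) : Csum (fun _ => RtoC 0) n = RtoC 0.
Proof.
  induction n as [|n IH]; rewrite ?Csum_O, ?Csum_S; [reflexivity|].
  rewrite IH. Cring.
Qed.

Lemma Csum_eq_0 (a : nat -> C) (n : nat) :
  (forall k, (k <= n)%nat -> a k = RtoC 0) -> Csum a n = RtoC 0.
Proof. intros H. rewrite (Csum_ext _ _ n H). apply Csum_zero. Qed.

Lemma Csum_shift (a : nat -> C) (n : nat) :
  Csum a (S n) = (a 0%nat + Csum (fun k => a (S k)) n)%C.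
Proof.
  induction n as [|n IH]; [now rewrite Csum_S, !Csum_O|].
  rewrite Csum_S, IH, Csum_S. Cring.
Qed.

Lemma Rsum_S (a : nat -> R) (n : nat) : sum_n a (S n) = sum_n a n + a (S n).
Proof. apply (sum_Sn a n). Qed.

Lemma Rsum_O (a : nat -> R) : sum_n a 0 = a 0%nat.
Proof. apply (sum_O a). Qed.

Lemma Rsum_le (a b : nat -> R) (n : nat) :
  (forall k, (k <= n)%nat -> a k <= b k) -> sum_n a n <= sum_n b n.
Proof.
  intros H. induction n as [|n IH]; rewrite ?Rsum_O, ?Rsum_S; [now apply H|].
  apply Rplus_le_compat; [apply IH; intros; apply H|apply H]; lia.
Qed.

Lemma Rsum_const (u : R) (n : nat) : sum_n (fun _ => u) n = (INR n + 1) * u.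
Proof.
  induction n as [|n IH]; rewrite ?Rsum_O, ?Rsum_S, ?S_INR, ?IH; simpl; ring.
Qed.

Lemma Rsum_term_le (a : nat -> R) (n k : nat) :
  (forall i, 0 <= a i) -> (k <= n)%nat -> a k <= sum_n a n.
Proof.
  intros H Hk. induction n as [|n IH].
  - replace k with 0%nat by lia. rewrite Rsum_O. lra.
  - rewrite Rsum_S. destruct (Nat.eq_dec k (S n)) as [->|Hne].
    + assert (0 <= sum_n a n); [|lra].
      clear IH Hk. induction n as [|n IH]; rewrite ?Rsum_O, ?Rsum_S; [apply H|].
      specialize (H (S n)); lra.
    + specialize (IH ltac:(lia)). specialize (H (S n)). lra.
Qed.

Lemma Cmod_Csum (a : nat -> C) (n : nat) :
  Cmod (Csum a n) <= sum_n (fun k => Cmod (a k)) n.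
Proof.
  induction n as [|n IH]; rewrite ?Csum_O, ?Rsum_O, ?Csum_S, ?Rsum_S; [lra|].
  eapply Rle_trans; [apply Cmod_triangle|]. lra.
Qed.

Lemma Re_Csum (a : nat -> C) (n : nat) : Re (Csum a n) = sum_n (fun k => Re (a k)) n.
Proof.
  induction n as [|n IH]; rewrite ?Csum_O, ?Rsum_O, ?Csum_S, ?Rsum_S; [reflexivity|].
  rewrite <- IH. reflexivity.
Qed.

Lemma Im_Csum (a : nat -> C) (n : nat) : Im (Csum a n) = sum_n (fun k => Im (a k)) n.
Proof.
  induction n as [|n IH]; rewrite ?Csum_O, ?Rsum_O, ?Csum_S, ?Rsum_S; [reflexivity|].
  rewrite <- IH. reflexivity.
Qed.

Lemma im_le_Cmod (z : C) : Rabs (Im z) <= Cmod z.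
Proof. eapply Rle_trans; [apply Rmax_r|apply Rmax_Cmod]. Qed.

(** The uniform structure on [C] is that of a product of two real lines, so limits split into
    components. Uniqueness, absolute convergence, bounds and products of complex series are
    inherited from real series this way. *)
Lemma Cseries_Re_Im (a : nat -> C) (l : C) :
  Cseries a l <->
  is_series (fun n => Re (a n)) (Re l) /\ is_series (fun n => Im (a n)) (Im l).
Proof.
  change (filterlim (Csum a) eventually (locally (l : C_UniformSpace)) <->
    filterlim (sum_n (fun n => Re (a n))) eventually (locally (Re l : R_UniformSpace)) /\
    filterlim (sum_n (fun n => Im (a n))) eventually (locally (Im l : R_UniformSpace))).
  rewrite (filterlim_locally (F := eventually) (U := C_UniformSpace) (Csum a) l).
  rewrite (filterlim_locally (F := eventually) (U := R_UniformSpace) _ (Re l)).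
  rewrite (filterlim_locally (F := eventually) (U := R_UniformSpace) _ (Im l)).
  split.
  - intros H. split; intros eps; specialize (H eps); revert H; apply filter_imp;
      intros n [H1 H2]; [rewrite <- Re_Csum|rewrite <- Im_Csum]; assumption.
  - intros [H1 H2] eps. specialize (H1 eps). specialize (H2 eps).
    generalize (filter_and _ _ H1 H2). apply filter_imp.
    intros n [K1 K2]. rewrite <- Re_Csum in K1. rewrite <- Im_Csum in K2.
    split; assumption.
Qed.

Lemma Cseries_ext (a b : nat -> C) (l : C) :
  (forall n, a n = b n) -> Cseries a l -> Cseries b l.
Proof. intros H. now apply is_series_ext. Qed.

Lemma Cseries_plus (a b : nat -> C) (l m : C) :
  Cseries a l -> Cseries b m -> Cseries (fun n => (a n + b n)%C) (l + m)%C.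
Proof. intros H1 H2. exact (is_series_plus _ _ _ _ H1 H2). Qed.

Lemma Cseries_scal (u : C) (a : nat -> C) (l : C) :
  Cseries a l -> Cseries (fun n => (u * a n)%C) (u * l)%C.
Proof. intros H. exact (is_series_scal u a l H). Qed.

Lemma Cseries_zero : Cseries (fun _ => RtoC 0) (RtoC 0).
Proof.
  apply Cseries_Re_Im. simpl. unfold is_series.
  split; apply (filterlim_ext (fun _ => 0)); try apply filterlim_const;
    intros n; rewrite Rsum_const; ring.
Qed.

Lemma Cseries_unique (a : nat -> C) (l m : C) : Cseries a l -> Cseries a m -> l = m.
Proof.
  rewrite !Cseries_Re_Im. intros [H1 H2] [H3 H4].
  apply is_series_unique in H1. apply is_series_unique in H2.
  apply is_series_unique in H3. apply is_series_unique in H4.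
  destruct l as [l1 l2], m as [m1 m2]. simpl in *. congruence.
Qed.

Lemma Cseries_shift (a : nat -> C) (l : C) :
  Cseries a l -> Cseries (fun n => match n with O => RtoC 0 | S n' => a n' end) l.
Proof.
  intros H. apply (is_series_decr_1 (fun n => match n with O => RtoC 0 | S n' => a n' end)).
  match goal with |- is_series _ ?x => replace x with l; [exact H|] end.
  change (l = (l + - RtoC 0)%C). ring.
Qed.

Lemma Cseries_head (u : C) :
  Cseries (fun n => match n with O => u | S _ => RtoC 0 end) u.
Proof.
  apply (is_series_decr_1 (fun n => match n with O => u | S _ => RtoC 0 end)).
  match goal with |- is_series _ ?x => replace x with (RtoC 0); [exact Cseries_zero|] end.
  change (RtoC 0 = (u + - u)%C). ring.
Qed.

Lemma Rseries_le (a b : nat -> R) :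
  (forall n, Rabs (a n) <= b n) -> ex_series b -> ex_series a.
Proof.
  exact (ex_series_le (K := R_AbsRing) (V := R_CompleteNormedModule) a b).
Qed.

Lemma Cseries_abs (a : nat -> C) :
  ex_series (fun n => Cmod (a n)) -> exists l : C, Cseries a l.
Proof.
  intros H.
  assert (H1 : ex_series (fun n => Re (a n))).
  { apply (Rseries_le _ (fun n => Cmod (a n))); [|exact H].
    intros n. apply re_le_Cmod. }
  assert (H2 : ex_series (fun n => Im (a n))).
  { apply (Rseries_le _ (fun n => Cmod (a n))); [|exact H].
    intros n. apply im_le_Cmod. }
  destruct H1 as [x Hx], H2 as [y Hy]. exists (x, y).
  apply Cseries_Re_Im. now split.
Qed.

(** Each component of the sum is at most [A]; the constant 2 rounds up the factor sqrt 2 that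
    recombining the components costs. *)
Lemma Cseries_bound (a : nat -> C) (l : C) (A : R) :
  Cseries a l -> (forall n, sum_n (fun k => Cmod (a k)) n <= A) -> Cmod l <= 2 * A.
Proof.
  intros H HA. apply Cseries_Re_Im in H. destruct H as [H1 H2].
  assert (K : forall b : nat -> R, (forall n, Rabs (b n) <= Cmod (a n)) ->
    forall x : R, is_series b x -> Rabs x <= A).
  { intros b Hb x Hx.
    assert (L : is_lim_seq (fun n => Rabs (sum_n b n)) (Rabs x))
      by (apply (is_lim_seq_abs _ x); exact Hx).
    refine (is_lim_seq_le (fun n => Rabs (sum_n b n)) (fun _ => A)
      (Finite (Rabs x)) (Finite A) _ L (is_lim_seq_const A)).
    intros n. eapply Rle_trans; [|apply (HA n)].
    eapply Rle_trans; [|apply Rsum_le; intros k _; apply Hb].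
    apply (norm_sum_n_m (K := R_AbsRing) (V := R_NormedModule) b 0 n). }
  assert (Hr := K _ (fun n => re_le_Cmod (a n)) _ H1).
  assert (Hi := K _ (fun n => im_le_Cmod (a n)) _ H2).
  eapply Rle_trans; [apply (Cmod_2Rmax l)|].
  assert (0 <= A) by (pose proof (Rabs_pos (Re l)); lra).
  apply Rmult_le_compat; [apply sqrt_pos| |
    | apply Rmax_lub; [exact Hr|exact Hi]].
  - eapply Rle_trans; [apply Rabs_pos|apply Rmax_l].
  - pose proof (sqrt_pos 2). pose proof (sqrt_sqrt 2). nra.
Qed.

Lemma Cseries_mult (a b : nat -> C) (l m : C) :
  Cseries a l -> Cseries b m ->
  ex_series (fun n => Cmod (a n)) -> ex_series (fun n => Cmod (b n)) ->
  Cseries (fun n => Csum (fun k => (a k * b (n - k)%nat)%C) n) (l * m)%C.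
Proof.
  intros Ha Hb Aa Ab. rewrite Cseries_Re_Im in *.
  destruct Ha as [Ha1 Ha2], Hb as [Hb1 Hb2].
  assert (D : forall (f : C -> R) (x : nat -> C), (forall z, Rabs (f z) <= Cmod z) ->
    ex_series (fun n => Cmod (x n)) -> ex_series (fun n => Rabs (f (x n)))).
  { intros f x Hf Hx. apply (Rseries_le _ (fun n => Cmod (x n))); [|exact Hx].
    intros n. rewrite Rabs_Rabsolu. apply Hf. }
  pose proof (D _ _ re_le_Cmod Aa) as A1. pose proof (D _ _ im_le_Cmod Aa) as A2.
  pose proof (D _ _ re_le_Cmod Ab) as B1. pose proof (D _ _ im_le_Cmod Ab) as B2.
  pose proof (is_series_mult _ _ _ _ Ha1 Hb1 A1 B1) as M11.
  pose proof (is_series_mult _ _ _ _ Ha2 Hb2 A2 B2) as M22.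
  pose proof (is_series_mult _ _ _ _ Ha1 Hb2 A1 B2) as M12.
  pose proof (is_series_mult _ _ _ _ Ha2 Hb1 A2 B1) as M21.
  split.
  - generalize (is_series_minus _ _ _ _ M11 M22). apply is_series_ext.
    intros n. rewrite Re_Csum. rewrite <- !sum_n_Reals.
    change (sum_n (fun k => Re (a k) * Re (b (n - k)%nat)) n
      - sum_n (fun k => Im (a k) * Im (b (n - k)%nat)) n
      = sum_n (fun k => Re (a k * b (n - k)%nat)%C) n).
    (* Separates the summation bound from the [n] inside [n - k], so that induction on the bound
       becomes possible. *)
    generalize n at 2 4 6. intros p.
    induction p as [|p IH]; rewrite ?Rsum_O, ?Rsum_S; [reflexivity|].
    rewrite <- IH. simpl. unfold Re, Im. ring.
  - generalize (is_series_plus _ _ _ _ M12 M21). apply is_series_ext.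
    intros n. rewrite Im_Csum. rewrite <- !sum_n_Reals.
    change (sum_n (fun k => Re (a k) * Im (b (n - k)%nat)) n
      + sum_n (fun k => Im (a k) * Re (b (n - k)%nat)) n
      = sum_n (fun k => Im (a k * b (n - k)%nat)%C) n).
    generalize n at 2 4 6. intros p.
    induction p as [|p IH]; rewrite ?Rsum_O, ?Rsum_S; [reflexivity|].
    rewrite <- IH. simpl. unfold Re, Im. ring.
Qed.

Lemma Rseries_terms_bounded (a : nat -> R) :
  ex_series a -> exists A, forall n, Rabs (a n) <= A.
Proof.
  intros H. apply ex_series_lim_0 in H.
  destruct (filterlim_bounded (K := R_AbsRing) (V := R_NormedModule) a
    (ex_intro (fun x : R => filterlim _ eventually (locally x)) 0 H)) as [A HA].
  exists A. exact HA.
Qed.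

Lemma Cseries_terms_bounded (a : nat -> C) (l : C) :
  Cseries a l -> exists A, forall n, Cmod (a n) <= A.
Proof.
  intros H. apply Cseries_Re_Im in H. destruct H as [H1 H2].
  destruct (Rseries_terms_bounded _ (ex_intro _ _ H1)) as [A HA].
  destruct (Rseries_terms_bounded _ (ex_intro _ _ H2)) as [B HB].
  exists (sqrt 2 * Rmax A B). intros n. eapply Rle_trans; [apply Cmod_2Rmax|].
  apply Rmult_le_compat_l; [apply sqrt_pos|].
  apply Rmax_lub; [eapply Rle_trans; [apply HA|apply Rmax_l]
    |eapply Rle_trans; [apply HB|apply Rmax_r]].
Qed.

(** * Power series in two variables *)

(** Statements in one variable are also put in this form, with the second variable ignored, so that
    all local statements combine by [near_and]. *)
Definition near (P : C -> C -> Prop) : Prop :=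
  exists rho : R, 0 < rho /\ forall z w : C, Cmod z < rho -> Cmod w < rho -> P z w.

Lemma near_all (P : C -> C -> Prop) : (forall z w, P z w) -> near P.
Proof. intros H. exists 1. split; [lra|auto]. Qed.

Lemma near_imp (P Q : C -> C -> Prop) :
  near P -> (forall z w, P z w -> Q z w) -> near Q.
Proof. intros [r [Hr H]] HI. exists r. auto. Qed.

Lemma near_and (P Q : C -> C -> Prop) :
  near P -> near Q -> near (fun z w => P z w /\ Q z w).
Proof.
  intros [r [Hr H]] [s [Hs K]]. exists (Rmin r s).
  split; [now apply Rmin_pos|].
  intros z w Hz Hw. pose proof (Rmin_l r s). pose proof (Rmin_r r s).
  split; [apply H|apply K]; lra.
Qed.

Lemma near_imp2 (P Q T : C -> C -> Prop) :
  near P -> near Q -> (forall z w, P z w -> Q z w -> T z w) -> near T.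
Proof.
  intros H1 H2 HI. apply (near_imp _ _ (near_and _ _ H1 H2)).
  intros z w [K1 K2]. auto.
Qed.

Lemma near_ball (r : R) : 0 < r -> near (fun z w => Cmod z < r /\ Cmod w < r).
Proof. intros Hr. exists r. auto. Qed.

Lemma near_0_r (P : C -> C -> Prop) : near P -> near (fun z _ => P z (RtoC 0)).
Proof.
  intros [r [Hr H]]. exists r. split; [exact Hr|].
  intros z w Hz _. apply H; [exact Hz|now rewrite Cmod_0].
Qed.

Lemma near_0_l (P : C -> C -> Prop) : near P -> near (fun _ w => P (RtoC 0) w).
Proof.
  intros [r [Hr H]]. exists r. split; [exact Hr|].
  intros z w _ Hw. apply H; [now rewrite Cmod_0|exact Hw].
Qed.

Lemma near_origin (P : C -> C -> Prop) : near P -> P (RtoC 0) (RtoC 0).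
Proof. intros [r [Hr H]]. apply H; now rewrite Cmod_0. Qed.

Lemma germ_eq_refl (f : germ) : germ_eq f f.
Proof. now apply near_all. Qed.

Lemma germ_eq_sym (f g : germ) : germ_eq f g -> germ_eq g f.
Proof. intros H. apply (near_imp _ _ H). auto. Qed.

Lemma germ_eq_trans (f g h : germ) : germ_eq f g -> germ_eq g h -> germ_eq f h.
Proof. intros H K. apply (near_imp2 _ _ _ H K). intros; congruence. Qed.

Definition hom (c : nat -> nat -> C) (n : nat) : germ := fun z w =>
  Csum (fun i => (c i (n - i)%nat * z ^ i * w ^ (n - i))%C) n.

(** Geometric growth amounts to absolute convergence on some bidisc, but is preserved by shifts,
    reindexing and recursions through plain inequalities. The convention [1 <= R] allows exponents
    to be enlarged freely. *)
Definition tame (c : nat -> nat -> C) : Prop :=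
  exists A R : R, 1 <= R /\ forall i j, Cmod (c i j) <= A * R ^ (i + j).

Definition expands (c : nat -> nat -> C) (f : germ) : Prop :=
  near (fun z w => Cseries (fun n => hom c n z w) (f z w)).

Lemma INR_succ_le_pow2 (n : nat) : INR n + 1 <= 2 ^ n.
Proof.
  induction n as [|n IH]; [simpl; lra|].
  rewrite S_INR. simpl. pose proof (pos_INR n). lra.
Qed.

(** On the bidisc of radius [/ (4 * R)] each of the n + 1 terms of degree n is at most [A / 4^n],
    and [n + 1 <= 2^n] leaves [A / 2^n]. *)
Lemma tame_hom_bound (c : nat -> nat -> C) : tame c ->
  exists A : R, 0 <= A /\ near (fun z w => forall n,
    sum_n (fun i => Cmod (c i (n - i)%nat * z ^ i * w ^ (n - i))%C) n <= A * (/ 2) ^ n).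
Proof.
  intros [A [R [HR H]]]. exists A.
  assert (HA : 0 <= A).
  { specialize (H 0%nat 0%nat). simpl in H. pose proof (Cmod_ge_0 (c 0%nat 0%nat)). lra. }
  split; [exact HA|].
  exists (/ (4 * R)). split; [apply Rinv_0_lt_compat; lra|].
  intros z w Hz Hw n.
  apply Rle_trans with (sum_n (fun _ => A * (/ 4) ^ n) n).
  - apply Rsum_le. intros i Hi. rewrite !Cmod_mult, !Cmod_pow.
    apply Rle_trans with (A * R ^ (i + (n - i)) * (/ (4 * R)) ^ i * (/ (4 * R)) ^ (n - i)).
    + repeat apply Rmult_le_compat; try apply Rmult_le_pos; try apply Cmod_ge_0;
        try (apply pow_le; apply Cmod_ge_0); try apply H;
        apply pow_incr; split; try apply Cmod_ge_0; lra.
    + rewrite Rmult_assoc, <- pow_add. replace (i + (n - i))%nat with n by lia.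
      rewrite Rmult_assoc, <- Rpow_mult_distr. right. f_equal. f_equal. field. lra.
  - rewrite Rsum_const. replace (/ 4) with (/ 2 * / 2) by field.
    rewrite Rpow_mult_distr.
    assert (E : 2 ^ n * (/ 2) ^ n = 1).
    { rewrite <- Rpow_mult_distr. replace (2 * / 2) with 1 by field. apply pow1. }
    pose proof (INR_succ_le_pow2 n). assert (0 <= (/ 2) ^ n) by (apply pow_le; lra).
    apply Rle_trans with (2 ^ n * (A * ((/ 2) ^ n * (/ 2) ^ n))).
    + apply Rmult_le_compat_r; [|lra]. repeat apply Rmult_le_pos; lra.
    + right. transitivity ((2 ^ n * (/ 2) ^ n) * (A * (/ 2) ^ n)); [ring|].
      rewrite E. ring.
Qed.

Lemma half_series (A : R) : ex_series (fun n => A * (/ 2) ^ n).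
Proof.
  apply (ex_series_scal (K := R_AbsRing) (V := R_NormedModule)).
  apply ex_series_geom. rewrite Rabs_right; lra.
Qed.

Lemma half_sum (A : R) (n : nat) : 0 <= A -> sum_n (fun k => A * (/ 2) ^ k) n <= 2 * A.
Proof.
  intros HA. assert (E : sum_n (fun k => A * (/ 2) ^ k) n = A * (2 - (/ 2) ^ n)).
  { induction n as [|n IH]; rewrite ?Rsum_O, ?Rsum_S; [simpl; ring|].
    rewrite IH. simpl. field. }
  rewrite E. assert (0 <= (/ 2) ^ n) by (apply pow_le; lra). nra.
Qed.

Lemma tame_hom (c : nat -> nat -> C) : tame c ->
  exists A : R, 0 <= A /\
    near (fun z w => forall n, Cmod (hom c n z w) <= A * (/ 2) ^ n).
Proof.
  intros H. destruct (tame_hom_bound c H) as [A [HA K]]. exists A. split; [exact HA|].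
  apply (near_imp _ _ K). intros z w L n. eapply Rle_trans; [|apply L]. apply Cmod_Csum.
Qed.

Lemma hom_abs_series (a : nat -> C) (A : R) :
  (forall n, Cmod (a n) <= A * (/ 2) ^ n) -> ex_series (fun n => Cmod (a n)).
Proof.
  intros H. apply (Rseries_le _ (fun n => A * (/ 2) ^ n)); [|apply half_series].
  intros n. rewrite Rabs_right; [apply H|]. apply Rle_ge, Cmod_ge_0.
Qed.

(** The sum is picked by [epsilon], so its values off the region of convergence are arbitrary; a
    germ does not see them. *)
Lemma expands_exists (c : nat -> nat -> C) : tame c -> exists f, expands c f.
Proof.
  intros H. exists (fun z w => epsilon (inhabits (RtoC 0)) (Cseries (fun n => hom c n z w))).
  destruct (tame_hom c H) as [A [_ K]]. apply (near_imp _ _ K).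
  intros z w L. apply epsilon_spec. apply Cseries_abs.
  now apply (hom_abs_series _ A).
Qed.

Lemma expands_unique (c : nat -> nat -> C) (f g : germ) :
  expands c f -> expands c g -> germ_eq f g.
Proof.
  intros H K. apply (near_imp2 _ _ _ H K). intros z w. apply Cseries_unique.
Qed.

Lemma expands_germ_eq (c : nat -> nat -> C) (f g : germ) :
  germ_eq f g -> expands c f -> expands c g.
Proof. intros H K. apply (near_imp2 _ _ _ H K). intros z w ->. auto. Qed.

(** From left to right one point suffices: at [(rho/2, rho/2)] the series of absolute values
    converges, so its terms are bounded, which bounds [|c_ij| (rho/2)^(i+j)]. *)
Lemma holomorphic_tame (f : germ) :
  holomorphic f <-> exists c, tame c /\ expands c f.
Proof.
  split.
  - intros [c [rho [Hr H]]]. exists c. split.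
    + destruct (H (RtoC (rho / 2)) (RtoC (rho / 2))) as [K _];
        [rewrite Cmod_R, Rabs_right; lra..|].
      destruct (Rseries_terms_bounded _ K) as [A HA].
      exists A, (Rmax 1 (/ (rho / 2))). split; [apply Rmax_l|].
      intros i j. specialize (HA (i + j)%nat).
      set (a := fun i0 => Cmod (c i0 (i + j - i0)%nat * RtoC (rho / 2) ^ i0
                             * RtoC (rho / 2) ^ (i + j - i0))%C) in HA.
      assert (L : a i <= A).
      { eapply Rle_trans; [|exact HA]. eapply Rle_trans; [|apply Rle_abs].
        apply Rsum_term_le; [intros k; apply Cmod_ge_0|lia]. }
      unfold a in L. rewrite !Cmod_mult, !Cmod_pow, !Cmod_R, Rabs_right in L by lra.
      replace (i + j - i)%nat with j in L by lia.
      rewrite Rmult_assoc, <- pow_add in L.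
      apply Rle_trans with (A * (/ (rho / 2)) ^ (i + j)).
      * rewrite pow_inv. apply Rle_div_r; [apply pow_lt; lra|exact L].
      * assert (0 <= A).
        { eapply Rle_trans; [|exact L]. apply Rmult_le_pos; [apply Cmod_ge_0|].
          apply pow_le; lra. }
        apply Rmult_le_compat_l; [assumption|]. apply pow_incr. split; [|apply Rmax_r].
        left. apply Rinv_0_lt_compat. lra.
    + exists rho. split; [exact Hr|]. intros z w Hz Hw. apply (H z w Hz Hw).
  - intros [c [H K]]. destruct (tame_hom_bound c H) as [A [HA L]].
    destruct (near_and _ _ K L) as [rho [Hr M]]. exists c, rho.
    split; [exact Hr|]. intros z w Hz Hw. destruct (M z w Hz Hw) as [M1 M2].
    split; [|exact M1].
    apply (Rseries_le _ (fun n => A * (/ 2) ^ n)); [|apply half_series].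
    intros n. rewrite Rabs_right; [apply M2|]. apply Rle_ge.
    rewrite <- (Rmult_0_r (INR n + 1)), <- Rsum_const.
    apply Rsum_le. intros. apply Cmod_ge_0.
Qed.

Lemma holomorphic_germ_eq (f g : germ) : germ_eq f g -> holomorphic f -> holomorphic g.
Proof.
  rewrite !holomorphic_tame. intros H [c [K L]]. exists c. split; [exact K|].
  now apply (expands_germ_eq c f).
Qed.

Lemma tame_plus (c e : nat -> nat -> C) :
  tame c -> tame e -> tame (fun i j => (c i j + e i j)%C).
Proof.
  intros [A [R [HR H]]] [B [T [HT K]]]. exists (A + B), (Rmax R T).
  split; [eapply Rle_trans; [apply HR|apply Rmax_l]|].
  intros i j. eapply Rle_trans; [apply Cmod_triangle|].
  rewrite Rmult_plus_distr_r.
  assert (0 <= A).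
  { specialize (H 0%nat 0%nat). simpl in H. pose proof (Cmod_ge_0 (c 0%nat 0%nat)). lra. }
  assert (0 <= B).
  { specialize (K 0%nat 0%nat). simpl in K. pose proof (Cmod_ge_0 (e 0%nat 0%nat)). lra. }
  apply Rplus_le_compat; [eapply Rle_trans; [apply H|]|eapply Rle_trans; [apply K|]];
    (apply Rmult_le_compat_l; [assumption|]); apply pow_incr; split; try lra;
    [apply Rmax_l|apply Rmax_r].
Qed.

Lemma tame_scal (u : C) (c : nat -> nat -> C) : tame c -> tame (fun i j => (u * c i j)%C).
Proof.
  intros [A [R [HR H]]]. exists (Cmod u * A), R. split; [exact HR|].
  intros i j. rewrite Cmod_mult, Rmult_assoc.
  apply Rmult_le_compat_l; [apply Cmod_ge_0|apply H].
Qed.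

(** Covers shifts, truncations and restrictions to an axis at once: an entry of [e] is zero or an
    entry of [c] whose total degree is at most [k] higher, which costs the factor [R^k]. *)
Lemma tame_reindex (c : nat -> nat -> C) (p q : nat -> nat -> nat) (k : nat)
    (e : nat -> nat -> C) :
  (forall i j, (p i j + q i j <= i + j + k)%nat) ->
  (forall i j, e i j = c (p i j) (q i j) \/ e i j = RtoC 0) -> tame c -> tame e.
Proof.
  intros Hpq He [A [R [HR H]]]. exists (A * R ^ k), R. split; [exact HR|].
  intros i j.
  assert (0 <= A).
  { specialize (H 0%nat 0%nat). simpl in H. pose proof (Cmod_ge_0 (c 0%nat 0%nat)). lra. }
  assert (A * R ^ (p i j + q i j) <= A * R ^ k * R ^ (i + j)).
  { rewrite Rmult_assoc, <- pow_add. apply Rmult_le_compat_l; [assumption|].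
    apply Rle_pow; [exact HR|]. specialize (Hpq i j). lia. }
  destruct (He i j) as [-> | ->].
  - eapply Rle_trans; [apply H|assumption].
  - rewrite Cmod_0. eapply Rle_trans; [|eassumption].
    apply Rmult_le_pos; [assumption|apply pow_le; lra].
Qed.

Lemma expands_plus (c e : nat -> nat -> C) (f g : germ) :
  expands c f -> expands e g -> expands (fun i j => (c i j + e i j)%C) (germ_add f g).
Proof.
  intros H K. apply (near_imp2 _ _ _ H K). intros z w H1 H2.
  generalize (Cseries_plus _ _ _ _ H1 H2). apply Cseries_ext. intros n.
  unfold hom. rewrite <- Csum_plus. apply Csum_ext. intros. ring.
Qed.

Lemma expands_scal (u : C) (c : nat -> nat -> C) (f : germ) :
  expands c f -> expands (fun i j => (u * c i j)%C) (fun z w => (u * f z w)%C).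
Proof.
  intros H. apply (near_imp _ _ H). intros z w H1.
  generalize (Cseries_scal u _ _ H1). apply Cseries_ext. intros n.
  unfold hom. rewrite <- Csum_scal. apply Csum_ext. intros. ring.
Qed.

Lemma expands_ext (c e : nat -> nat -> C) (f : germ) :
  (forall i j, c i j = e i j) -> expands c f -> expands e f.
Proof.
  intros H K. apply (near_imp _ _ K). intros z w. apply Cseries_ext. intros n.
  unfold hom. apply Csum_ext. intros. now rewrite H.
Qed.

(** Multiplication by z on the level of coefficients; [shw] does the same for w. *)
Definition shz (c : nat -> nat -> C) : nat -> nat -> C :=
  fun i j => match i with O => RtoC 0 | S i' => c i' j end.

Definition shw (c : nat -> nat -> C) : nat -> nat -> C :=
  fun i j => match j with O => RtoC 0 | S j' => c i j' end.

Lemma tame_shz (c : nat -> nat -> C) : tame c -> tame (shz c).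
Proof.
  apply (tame_reindex c (fun i _ => pred i) (fun _ j => j) 0); [intros; lia|].
  intros [|i] j; simpl; auto.
Qed.

Lemma tame_shw (c : nat -> nat -> C) : tame c -> tame (shw c).
Proof.
  apply (tame_reindex c (fun i _ => i) (fun _ j => pred j) 0); [intros; lia|].
  intros i [|j]; simpl; auto.
Qed.

Lemma expands_shz (c : nat -> nat -> C) (f : germ) :
  expands c f -> expands (shz c) (fun z w => (z * f z w)%C).
Proof.
  intros H. apply (near_imp _ _ H). intros z w H1.
  generalize (Cseries_shift _ _ (Cseries_scal z _ _ H1)). apply Cseries_ext.
  intros [|n]; unfold hom; [rewrite Csum_O; simpl; ring|].
  rewrite Csum_shift, <- Csum_scal. simpl shz.
  rewrite !Cmult_0_l, Cplus_0_l. apply Csum_ext. intros. simpl. ring.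
Qed.

Lemma expands_shw (c : nat -> nat -> C) (f : germ) :
  expands c f -> expands (shw c) (fun z w => (w * f z w)%C).
Proof.
  intros H. apply (near_imp _ _ H). intros z w H1.
  generalize (Cseries_shift _ _ (Cseries_scal w _ _ H1)). apply Cseries_ext.
  intros [|n]; unfold hom; [rewrite Csum_O; simpl; ring|].
  rewrite Csum_S, <- Csum_scal. rewrite Nat.sub_diag. simpl (shw c (S n) 0%nat).
  rewrite !Cmult_0_l, Cplus_0_r. apply Csum_ext. intros k Hk.
  replace (S n - k)%nat with (S (n - k)) by lia. simpl. ring.
Qed.

Lemma expands_zpow (k : nat) (c : nat -> nat -> C) (f : germ) :
  expands c f -> expands (Nat.iter k shz c) (fun z w => (z ^ k * f z w)%C).
Proof.
  intros H. induction k as [|k IH]; simpl.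
  - revert H. apply expands_germ_eq. apply near_all. intros. ring.
  - apply expands_shz in IH. revert IH. apply expands_germ_eq, near_all. intros. ring.
Qed.

Lemma expands_wpow (k : nat) (c : nat -> nat -> C) (f : germ) :
  expands c f -> expands (Nat.iter k shw c) (fun z w => (w ^ k * f z w)%C).
Proof.
  intros H. induction k as [|k IH]; simpl.
  - revert H. apply expands_germ_eq. apply near_all. intros. ring.
  - apply expands_shw in IH. revert IH. apply expands_germ_eq, near_all. intros. ring.
Qed.

Lemma iter_shz (k : nat) (c : nat -> nat -> C) (i j : nat) :
  Nat.iter k shz c i j = if (k <=? i)%nat then c (i - k)%nat j else RtoC 0.
Proof.
  revert i. induction k as [|k IH]; intros i; simpl; [now rewrite Nat.sub_0_r|].
  destruct i as [|i]; simpl; [reflexivity|]. apply IH.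
Qed.

Lemma iter_shw (k : nat) (c : nat -> nat -> C) (i j : nat) :
  Nat.iter k shw c i j = if (k <=? j)%nat then c i (j - k)%nat else RtoC 0.
Proof.
  revert j. induction k as [|k IH]; intros j; simpl; [now rewrite Nat.sub_0_r|].
  destruct j as [|j]; simpl; [reflexivity|]. apply IH.
Qed.

(** A series in one variable seen as one in two variables, so that curves and restrictions to an
    axis need no theory of their own. *)
Definition zpart (a : nat -> C) : nat -> nat -> C :=
  fun i j => match j with O => a i | S _ => RtoC 0 end.

Definition wpart (a : nat -> C) : nat -> nat -> C :=
  fun i j => match i with O => a j | S _ => RtoC 0 end.

Lemma hom_zpart (a : nat -> C) (n : nat) (z w : C) :
  hom (zpart a) n z w = (a n * z ^ n)%C.
Proof.
  unfold hom. destruct n as [|n]; [rewrite Csum_O; simpl; ring|].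
  rewrite Csum_S, Nat.sub_diag. change (zpart a (S n) 0%nat) with (a (S n)).
  rewrite Csum_eq_0; [simpl; ring|]. intros k Hk.
  replace (S n - k)%nat with (S (n - k)) by lia. simpl. ring.
Qed.

Lemma hom_wpart (a : nat -> C) (n : nat) (z w : C) :
  hom (wpart a) n z w = (a n * w ^ n)%C.
Proof.
  unfold hom. destruct n as [|n]; [rewrite Csum_O; simpl; ring|].
  rewrite Csum_shift, Nat.sub_0_r.
  rewrite Csum_eq_0; [simpl; ring|]. intros k Hk. simpl. ring.
Qed.

Lemma hom_w0 (c : nat -> nat -> C) (n : nat) (z : C) :
  hom c n z (RtoC 0) = (c n 0%nat * z ^ n)%C.
Proof.
  rewrite <- (hom_zpart (fun i => c i 0%nat) n z (RtoC 0)). unfold hom.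
  apply Csum_ext. intros k Hk. destruct (n - k)%nat as [|p]; simpl; ring.
Qed.

Lemma hom_z0 (c : nat -> nat -> C) (n : nat) (w : C) :
  hom c n (RtoC 0) w = (c 0%nat n * w ^ n)%C.
Proof.
  rewrite <- (hom_wpart (fun j => c 0%nat j) n (RtoC 0) w). unfold hom.
  apply Csum_ext. intros [|k] Hk; [rewrite Nat.sub_0_r|]; simpl; ring.
Qed.

Lemma tame_zpart (c : nat -> nat -> C) (p : nat -> nat) (q : nat -> nat) :
  (forall i, (p i + q i <= i)%nat) -> tame c -> tame (zpart (fun i => c (p i) (q i))).
Proof.
  intros Hpq. apply (tame_reindex c (fun i _ => p i) (fun i _ => q i) 0).
  - intros i j. specialize (Hpq i). lia.
  - intros i [|j]; simpl; auto.
Qed.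

Lemma tame_wpart (c : nat -> nat -> C) (p : nat -> nat) (q : nat -> nat) :
  (forall i, (p i + q i <= i)%nat) -> tame c -> tame (wpart (fun i => c (p i) (q i))).
Proof.
  intros Hpq. apply (tame_reindex c (fun _ j => p j) (fun _ j => q j) 0).
  - intros i j. specialize (Hpq j). lia.
  - intros [|i] j; simpl; auto.
Qed.

Lemma expands_zpart (c : nat -> nat -> C) (f : germ) :
  expands c f -> expands (zpart (fun i => c i 0%nat)) (fun z _ => f z (RtoC 0)).
Proof.
  intros H. apply (near_imp _ _ (near_0_r _ H)). intros z w.
  apply Cseries_ext. intros n. now rewrite hom_w0, hom_zpart.
Qed.

Lemma expands_wpart (c : nat -> nat -> C) (f : germ) :
  expands c f -> expands (wpart (fun j => c 0%nat j)) (fun _ w => f (RtoC 0) w).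
Proof.
  intros H. apply (near_imp _ _ (near_0_l _ H)). intros z w.
  apply Cseries_ext. intros n. now rewrite hom_z0, hom_wpart.
Qed.

Lemma holomorphic_0_l (f : germ) : holomorphic f -> holomorphic (fun _ w => f (RtoC 0) w).
Proof.
  rewrite !holomorphic_tame. intros [c [H K]].
  exists (wpart (fun i => c 0%nat i)). split.
  - apply (tame_wpart c (fun _ => 0%nat) (fun j => j)); [intros; lia|exact H].
  - now apply expands_wpart.
Qed.

(** Setting the terms free of z apart and lowering [i] in the others gives the quotient by z
    explicitly as a series. *)
Lemma holomorphic_split_z (f : germ) : holomorphic f ->
  exists f', holomorphic f' /\ near (fun z w => f z w = (z * f' z w + f (RtoC 0) w)%C).
Proof.
  rewrite holomorphic_tame. intros [c [H K]].
  assert (T : tame (fun i j => c (S i) j)).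
  { apply (tame_reindex c (fun i _ => S i) (fun _ j => j) 1); auto. intros; lia. }
  destruct (expands_exists _ T) as [f' Hf']. exists f'. split.
  - rewrite holomorphic_tame. eauto.
  - apply (expands_unique c); [exact K|].
    generalize (expands_plus _ _ _ _ (expands_shz _ _ Hf') (expands_wpart _ _ K)).
    apply expands_ext. intros [|i] j; simpl; ring.
Qed.

Lemma expands_split_w (c : nat -> nat -> C) (f : germ) : tame c -> expands c f ->
  exists f', expands (fun i j => c i (S j)) f' /\
    near (fun z w => f z w = (w * f' z w + f z (RtoC 0))%C).
Proof.
  intros H K.
  assert (T : tame (fun i j => c i (S j))).
  { apply (tame_reindex c (fun i _ => i) (fun _ j => S j) 1); auto. intros; lia. }
  destruct (expands_exists _ T) as [f' Hf']. exists f'. split; [exact Hf'|].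
  apply (expands_unique c); [exact K|].
  generalize (expands_plus _ _ _ _ (expands_shw _ _ Hf') (expands_zpart _ _ K)).
  apply expands_ext. intros i [|j]; simpl; ring.
Qed.

Lemma holomorphic_split_w (f : germ) : holomorphic f ->
  exists f', holomorphic f' /\ near (fun z w => f z w = (w * f' z w + f z (RtoC 0))%C).
Proof.
  rewrite holomorphic_tame. intros [c [H K]].
  destruct (expands_split_w c f H K) as [f' [Hf' E]]. exists f'. split; [|exact E].
  rewrite holomorphic_tame. exists (fun i j => c i (S j)). split; [|exact Hf'].
  apply (tame_reindex c (fun i _ => i) (fun _ j => S j) 1); auto. intros; lia.
Qed.

(* If a_n are the coefficients of f(., 0), then k has coefficients a_(p+q+1). *)
Lemma holomorphic_difference (f : germ) : holomorphic f ->
  exists k, holomorphic k /\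
    near (fun x y => f x (RtoC 0) - f y (RtoC 0) = (x - y) * k x y)%C.
Proof.
  rewrite holomorphic_tame. intros [c [H K]].
  assert (T : tame (fun i j => c (S (i + j)) 0%nat)).
  { apply (tame_reindex c (fun i j => S (i + j)) (fun _ j => 0)%nat 1); auto.
    intros; lia. }
  destruct (expands_exists _ T) as [k Hk]. exists k. split.
  - rewrite holomorphic_tame. eauto.
  - assert (Ez := expands_zpart _ _ K).
    assert (Ew : expands (wpart (fun j => c j 0%nat)) (fun _ y => f y (RtoC 0))).
    { destruct K as [r [Hr K]]. exists r. split; [exact Hr|]. intros z w _ Hw.
      generalize (K w (RtoC 0) Hw ltac:(now rewrite Cmod_0)).
      apply Cseries_ext. intros n. now rewrite hom_w0, hom_wpart. }
    assert (E1 := expands_plus _ _ _ _ Ez (expands_scal (- (1)) _ _ Ew)).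
    assert (E2 := expands_plus _ _ _ _ (expands_shz _ _ Hk)
      (expands_scal (- (1)) _ _ (expands_shw _ _ Hk))).
    assert (E3 : germ_eq (germ_add (fun z _ => f z (RtoC 0)) (fun _ w => (- (1) * f w (RtoC 0))%C))
      (germ_add (fun z w => (z * k z w)%C) (fun z w => (- (1) * (w * k z w))%C))).
    { apply (expands_unique _ _ _ E1). revert E2. apply expands_ext.
      intros [|i] [|j]; simpl; rewrite ?Nat.add_0_r; try ring.
      replace (i + S j)%nat with (S (i + j)) by lia. ring. }
    apply (near_imp _ _ E3). unfold germ_add. intros z w E.
    transitivity (f z (RtoC 0) + - (1) * f w (RtoC 0))%C; [ring|].
    rewrite E. ring.
Qed.

Lemma holomorphic_bounded (f : germ) : holomorphic f ->
  exists A : R, 0 < A /\ near (fun z w => Cmod (f z w) <= A).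
Proof.
  rewrite holomorphic_tame. intros [c [H K]].
  destruct (tame_hom c H) as [A [HA L]]. exists (2 * (2 * A) + 1). split; [lra|].
  apply (near_imp2 _ _ _ K L). intros z w M1 M2.
  apply Rle_trans with (2 * (2 * A)); [|lra].
  apply (Cseries_bound _ _ _ M1). intros n. eapply Rle_trans; [|apply half_sum, HA].
  apply Rsum_le. intros; apply M2.
Qed.

Lemma holomorphic_add (f g : germ) :
  holomorphic f -> holomorphic g -> holomorphic (germ_add f g).
Proof.
  rewrite !holomorphic_tame. intros [c [H K]] [e [L M]].
  exists (fun i j => (c i j + e i j)%C).
  split; [now apply tame_plus|now apply expands_plus].
Qed.

Lemma holomorphic_const (u : C) : holomorphic (fun _ _ => u).
Proof.
  rewrite holomorphic_tame.
  exists (zpart (fun i => match i with O => u | S _ => RtoC 0 end)). split.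
  - exists (Cmod u), 1. split; [lra|]. intros i j. rewrite pow1, Rmult_1_r.
    destruct i, j; simpl; rewrite ?Cmod_0; try apply Cmod_ge_0; lra.
  - apply near_all. intros z w. generalize (Cseries_head u). apply Cseries_ext.
    intros [|n]; rewrite hom_zpart; simpl; ring.
Qed.

Lemma expands_origin (c : nat -> nat -> C) (f : germ) :
  expands c f -> f (RtoC 0) (RtoC 0) = c 0%nat 0%nat.
Proof.
  intros H. apply near_origin in H. apply (Cseries_unique _ _ _ H).
  generalize (Cseries_head (c 0%nat 0%nat)). apply Cseries_ext.
  intros [|n]; rewrite hom_w0; simpl; ring.
Qed.

(** * Products, and averages over roots of unity *)

(** A homogeneous polynomial of degree n whose coefficients have absolute sum at most B. This norm
    is submultiplicative, and existential coefficients spare the double-index formula for the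
    coefficients of a product. *)
Definition form (n : nat) (B : R) (F : germ) : Prop :=
  exists c : nat -> C, sum_n (fun i => Cmod (c i)) n <= B /\
    forall z w, F z w = Csum (fun i => (c i * z ^ i * w ^ (n - i))%C) n.

Lemma form_ext (n : nat) (B B' : R) (F G : germ) :
  B <= B' -> (forall z w, F z w = G z w) -> form n B F -> form n B' G.
Proof.
  intros HB H [c [K L]]. exists c. split; [lra|]. intros z w. now rewrite <- H.
Qed.

Lemma form_add (n : nat) (B D : R) (F G : germ) :
  form n B F -> form n D G -> form n (B + D) (germ_add F G).
Proof.
  intros [c [Hc K]] [e [He L]]. exists (fun i => (c i + e i)%C). split.
  - apply Rle_trans with (sum_n (fun i => Cmod (c i) + Cmod (e i)) n).
    + apply Rsum_le. intros. apply Cmod_triangle.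
    + rewrite (sum_n_plus (G := R_AbelianMonoid) (fun i => Cmod (c i)) (fun i => Cmod (e i))).
      change plus with Rplus. lra.
  - intros z w. unfold germ_add. rewrite K, L, <- Csum_plus.
    apply Csum_ext. intros. ring.
Qed.

Lemma form_scal (n : nat) (u : C) (B : R) (F : germ) :
  form n B F -> form n (Cmod u * B) (fun z w => (u * F z w)%C).
Proof.
  intros [c [Hc K]]. exists (fun i => (u * c i)%C). split.
  - apply Rle_trans with (Cmod u * sum_n (fun i => Cmod (c i)) n).
    + right. clear. induction n as [|n IH]; rewrite ?Rsum_O, ?Rsum_S, ?IH, Cmod_mult; ring.
    + apply Rmult_le_compat_l; [apply Cmod_ge_0|exact Hc].
  - intros z w. rewrite K, <- Csum_scal. apply Csum_ext. intros. ring.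
Qed.

Lemma form_mulz (n : nat) (B : R) (F : germ) :
  form n B F -> form (S n) B (fun z w => (z * F z w)%C).
Proof.
  intros [c [Hc K]]. exists (fun i => match i with O => RtoC 0 | S i' => c i' end). split.
  - eapply Rle_trans; [|exact Hc]. right. clear.
    induction n as [|n IH]; rewrite ?Rsum_S, ?Rsum_O in *; [rewrite Cmod_0; ring|].
    rewrite <- IH. ring.
  - intros z w. rewrite K, Csum_shift, <- Csum_scal, !Cmult_0_l, Cplus_0_l.
    apply Csum_ext. intros. simpl. ring.
Qed.

Lemma form_mulw (n : nat) (B : R) (F : germ) :
  form n B F -> form (S n) B (fun z w => (w * F z w)%C).
Proof.
  intros [c [Hc K]]. exists (fun i => if (i <=? n)%nat then c i else RtoC 0).
  assert (E : (S n <=? n)%nat = false) by (apply Nat.leb_gt; lia). split.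
  - rewrite Rsum_S, E, Cmod_0, Rplus_0_r. eapply Rle_trans; [|exact Hc].
    apply Rsum_le. intros k Hk. apply Nat.leb_le in Hk. rewrite Hk. lra.
  - intros z w. rewrite K, Csum_S, E, <- Csum_scal, !Cmult_0_l, Cplus_0_r.
    apply Csum_ext. intros k Hk. replace (S n - k)%nat with (S (n - k)) by lia.
    apply Nat.leb_le in Hk. rewrite Hk. simpl. ring.
Qed.

Lemma form_mul_monomial (n i j : nat) (B : R) (F : germ) :
  form n B F -> form (n + (i + j)) B (fun z w => (z ^ i * w ^ j * F z w)%C).
Proof.
  intros H. induction i as [|i IH]; simpl.
  - induction j as [|j IH]; simpl.
    + rewrite Nat.add_0_r. revert H. apply form_ext; [lra|]. intros. ring.
    + rewrite Nat.add_succ_r. apply form_mulw in IH. revert IH.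
      apply form_ext; [lra|]. intros. simpl. ring.
  - rewrite Nat.add_succ_r. apply form_mulz in IH. revert IH.
    apply form_ext; [lra|]. intros. simpl. ring.
Qed.

Lemma form_nonneg (n : nat) (B : R) (F : germ) : form n B F -> 0 <= B.
Proof.
  intros [c [Hc _]]. eapply Rle_trans; [|exact Hc].
  rewrite <- (Rmult_0_r (INR n + 1)), <- Rsum_const.
  apply Rsum_le. intros. apply Cmod_ge_0.
Qed.

Lemma form_sum (m n : nat) (B : nat -> R) (F : nat -> germ) :
  (forall k, (k <= n)%nat -> form m (B k) (F k)) ->
  form m (sum_n B n) (fun z w => Csum (fun k => F k z w) n).
Proof.
  intros H. induction n as [|n IH].
  - generalize (H 0%nat (Nat.le_refl _)). apply form_ext; [rewrite Rsum_O; lra|].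
    intros. now rewrite Csum_O.
  - assert (H1 := form_add _ _ _ _ _ (IH ltac:(intros; apply H; lia)) (H (S n) ltac:(lia))).
    revert H1. apply form_ext; [rewrite Rsum_S; lra|].
    intros. now rewrite Csum_S.
Qed.

(** G is expanded into monomials, each of which shifts the coefficients of F without changing their
    absolute sum. *)
Lemma form_mul (n m : nat) (B D : R) (F G : germ) :
  form n B F -> form m D G -> form (n + m) (B * D) (germ_mul F G).
Proof.
  intros HF [e [He L]]. pose proof (form_nonneg _ _ _ HF) as HB.
  assert (H := form_sum (n + m) m (fun j => Cmod (e j) * B)
    (fun j z w => (e j * (z ^ j * w ^ (m - j) * F z w))%C)).
  eapply form_ext; [| |apply H].
  - apply Rle_trans with (B * sum_n (fun i => Cmod (e i)) m).
    + right. clear. induction m as [|m IH]; rewrite ?Rsum_O, ?Rsum_S, ?IH; ring.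
    + apply Rmult_le_compat_l; assumption.
  - intros z w. unfold germ_mul. rewrite L, <- Csum_scal. apply Csum_ext. intros. ring.
  - intros k Hk. apply form_scal.
    replace (n + m)%nat with (n + (k + (m - k)))%nat by lia. now apply form_mul_monomial.
Qed.

Lemma tame_form (c : nat -> nat -> C) : tame c ->
  exists A R, 0 <= A /\ 1 <= R /\ forall n, form n (A * R ^ n) (hom c n).
Proof.
  intros [A [R [HR H]]].
  assert (HA : 0 <= A).
  { specialize (H 0%nat 0%nat). simpl in H. pose proof (Cmod_ge_0 (c 0%nat 0%nat)). lra. }
  exists A, (2 * R). split; [exact HA|]. split; [lra|]. intros n.
  exists (fun i => c i (n - i)%nat). split; [|reflexivity].
  apply Rle_trans with (sum_n (fun _ => A * R ^ n) n).
  - apply Rsum_le. intros i Hi. eapply Rle_trans; [apply H|].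
    replace (i + (n - i))%nat with n by lia. lra.
  - rewrite Rsum_const, Rpow_mult_distr. pose proof (INR_succ_le_pow2 n).
    assert (0 <= R ^ n) by (apply pow_le; lra).
    apply Rle_trans with (2 ^ n * (A * R ^ n)); [|right; ring].
    apply Rmult_le_compat_r; [now apply Rmult_le_pos|assumption].
Qed.

Lemma forms_tame (P : nat -> germ) (A R : R) : 1 <= R ->
  (forall n, form n (A * R ^ n) (P n)) ->
  exists c, tame c /\ forall n z w, hom c n z w = P n z w.
Proof.
  intros HR H.
  pose (e := fun n => proj1_sig (constructive_indefinite_description _ (H n))).
  assert (He : forall n, sum_n (fun i => Cmod (e n i)) n <= A * R ^ n /\
    forall z w, P n z w = Csum (fun i => (e n i * z ^ i * w ^ (n - i))%C) n).
  { intros n. apply (proj2_sig (constructive_indefinite_description _ (H n))). }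
  exists (fun i j => e (i + j)%nat i). split.
  - exists A, R. split; [exact HR|]. intros i j.
    eapply Rle_trans; [|apply He].
    apply (Rsum_term_le (fun k => Cmod (e (i + j)%nat k))); [intros; apply Cmod_ge_0|lia].
  - intros n z w. destruct (He n) as [_ ->]. apply Csum_ext. intros k Hk.
    now replace (k + (n - k))%nat with n by lia.
Qed.

Lemma holomorphic_mul (f g : germ) :
  holomorphic f -> holomorphic g -> holomorphic (germ_mul f g).
Proof.
  rewrite !holomorphic_tame. intros [c [Hc Kc]] [e [He Ke]].
  destruct (tame_form c Hc) as [A [R [HA [HR FR]]]].
  destruct (tame_form e He) as [B [T [HB [HT FT]]]].
  (* The part of degree n is a Cauchy sum of n + 1 products of forms, each of norm at most
     [A B (R T)^n]; the 2 in the base absorbs the n + 1. *)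
  destruct (forms_tame (fun n z w => Csum (fun k => (hom c k z w * hom e (n - k) z w)%C) n)
    (A * B) (2 * (R * T))) as [x [Hx Ex]]; [nra| |].
  - intros n. apply (form_ext n (sum_n (fun _ => A * B * (R * T) ^ n) n) _
      (fun z w => Csum (fun k => (hom c k z w * hom e (n - k) z w)%C) n)).
    + rewrite Rsum_const, (Rpow_mult_distr 2). pose proof (INR_succ_le_pow2 n).
      assert (0 <= A * B) by now apply Rmult_le_pos.
      assert (0 <= (R * T) ^ n) by (apply pow_le; nra).
      apply Rle_trans with (2 ^ n * (A * B * (R * T) ^ n)); [|right; ring].
      apply Rmult_le_compat_r; [now apply Rmult_le_pos|assumption].
    + reflexivity.
    + apply form_sum. intros k Hk.
      assert (M := form_mul _ _ _ _ _ _ (FR k) (FT (n - k)%nat)).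
      replace (k + (n - k))%nat with n in M by lia. revert M.
      apply form_ext; [|reflexivity]. rewrite Rpow_mult_distr.
      assert (R ^ k <= R ^ n) by (apply Rle_pow; lia || lra).
      assert (T ^ (n - k) <= T ^ n) by (apply Rle_pow; lia || lra).
      assert (0 <= R ^ k) by (apply pow_le; lra).
      assert (0 <= T ^ (n - k)) by (apply pow_le; lra).
      assert (R ^ k * T ^ (n - k) <= R ^ n * T ^ n) by now apply Rmult_le_compat.
      assert (0 <= A * B) by now apply Rmult_le_pos.
      replace (A * R ^ k * (B * T ^ (n - k))) with (A * B * (R ^ k * T ^ (n - k))) by ring.
      apply Rmult_le_compat_l; assumption.
  - exists x. split; [exact Hx|].
    destruct (tame_hom c Hc) as [A' [_ Lc]]. destruct (tame_hom e He) as [B' [_ Le]].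
    apply (near_imp2 _ _ _ (near_and _ _ Kc Ke) (near_and _ _ Lc Le)).
    intros z w [K1 K2] [L1 L2].
    assert (M := Cseries_mult _ _ _ _ K1 K2 (hom_abs_series _ _ L1) (hom_abs_series _ _ L2)).
    revert M. apply Cseries_ext. intros n. now rewrite Ex.
Qed.

Lemma holomorphic_z : holomorphic (fun z _ => z).
Proof.
  destruct (proj1 (holomorphic_tame _) (holomorphic_const 1)) as [c [H K]].
  apply holomorphic_tame. exists (shz c). split; [now apply tame_shz|].
  apply expands_shz in K. revert K. apply expands_germ_eq, near_all. intros. ring.
Qed.

Lemma holomorphic_w : holomorphic (fun _ w => w).
Proof.
  destruct (proj1 (holomorphic_tame _) (holomorphic_const 1)) as [c [H K]].
  apply holomorphic_tame. exists (shw c). split; [now apply tame_shw|].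
  apply expands_shw in K. revert K. apply expands_germ_eq, near_all. intros. ring.
Qed.

Lemma holomorphic_pow (f : germ) (n : nat) : holomorphic f -> holomorphic (germ_pow f n).
Proof.
  intros H. induction n as [|n IH].
  - apply (holomorphic_const 1).
  - exact (holomorphic_mul _ _ H IH).
Qed.

(** * Polynomials at roots of unity, and roots of complex numbers *)

Lemma Cmult_integral (x y : C) : (x * y)%C = RtoC 0 -> x = RtoC 0 \/ y = RtoC 0.
Proof.
  intros H. apply (f_equal Cmod) in H. rewrite Cmod_mult, Cmod_0 in H.
  apply Rmult_integral in H. destruct H; [left|right]; now apply Cmod_eq_0.
Qed.

Lemma Cpow_integral (x : C) (n : nat) : (x ^ n)%C = RtoC 0 -> x = RtoC 0.
Proof.
  intros H. destruct (Ceq_dec x 0) as [E|E]; [exact E|].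
  exfalso. exact (Cpow_nz x n E H).
Qed.

Fixpoint peval (l : list C) (t : C) : C :=
  match l with
  | nil => RtoC 0
  | cons a l' => (a + t * peval l' t)%C
  end.

Lemma expi_add (a b : R) : expi (a + b) = (expi a * expi b)%C.
Proof. unfold expi, Cmult. simpl. rewrite cos_plus, sin_plus. f_equal; ring. Qed.

Lemma expi_pow (a : R) (n : nat) : (expi a ^ n)%C = expi (INR n * a).
Proof.
  induction n as [|n IH].
  - simpl. rewrite Rmult_0_l. unfold expi. now rewrite cos_0, sin_0.
  - rewrite S_INR. simpl (expi a ^ S n)%C. rewrite IH, <- expi_add. f_equal. ring.
Qed.

Lemma Cmod_expi (a : R) : Cmod (expi a) = 1.
Proof.
  unfold Cmod, expi. simpl. rewrite !Rmult_1_r. pose proof (sin2_cos2 a).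
  unfold Rsqr in *. rewrite Rplus_comm, H. apply sqrt_1.
Qed.

Lemma expi_neq_1 (a : R) : 0 < a < 2 * PI -> expi a <> RtoC 1.
Proof.
  intros Ha E. injection E as E _.
  pose proof (cos_2a_sin (a / 2)). replace (2 * (a / 2)) with a in H by field.
  assert (0 < sin (a / 2)) by (apply sin_gt_0; lra). nra.
Qed.

(* A primitive root of unity of order p + 1, not p. *)
Definition omega (p : nat) : C := expi (2 * PI / INR (S p)).

Lemma omega_pow_neq_1 (p k : nat) : (0 < k < S p)%nat -> (omega p ^ k)%C <> RtoC 1.
Proof.
  intros Hk. unfold omega. rewrite expi_pow. apply expi_neq_1.
  pose proof PI_RGT_0. assert (0 < INR (S p)) by (apply lt_0_INR; lia).
  assert (0 < INR k) by (apply lt_0_INR; lia).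
  assert (INR k < INR (S p)) by (apply lt_INR; lia).
  replace (INR k * (2 * PI / INR (S p))) with (2 * PI * (INR k / INR (S p))) by (field; lra).
  assert (0 < INR k / INR (S p)) by (apply Rdiv_lt_0_compat; lra).
  assert (INR k / INR (S p) < 1) by (apply Rlt_div_l; lra).
  split; nra.
Qed.

Lemma omega_pow_order (p : nat) : (omega p ^ S p)%C = RtoC 1.
Proof.
  unfold omega. rewrite expi_pow.
  replace (INR (S p) * (2 * PI / INR (S p))) with (2 * PI)
    by (field; apply not_0_INR; lia).
  unfold expi. now rewrite cos_2PI, sin_2PI.
Qed.

Lemma Cmod_omega_pow (p k : nat) : Cmod (omega p ^ k)%C = 1.
Proof. unfold omega. now rewrite expi_pow, Cmod_expi. Qed.

Lemma geometric_sum (x : C) (p : nat) :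
  ((1 - x) * Csum (fun k => x ^ k)%C p = 1 - x ^ S p)%C.
Proof.
  induction p as [|p IH]; rewrite ?Csum_O, ?Csum_S; [simpl; ring|].
  rewrite Cmult_plus_distr_l, IH. simpl. ring.
Qed.

Lemma omega_sum (p e : nat) : (0 < e < S p)%nat ->
  Csum (fun k => (omega p ^ k) ^ e)%C p = RtoC 0.
Proof.
  intros He. pose proof (omega_pow_neq_1 p e He) as Hne.
  assert (H := geometric_sum (omega p ^ e) p).
  assert (E : ((omega p ^ e) ^ S p)%C = RtoC 1).
  { rewrite <- Cpow_mult_r, Nat.mul_comm, Cpow_mult_r, omega_pow_order. apply Cpow_1_l. }
  rewrite E in H.
  rewrite (Csum_ext _ (fun k => (omega p ^ e) ^ k)%C).
  - assert (H' : ((1 - omega p ^ e) * Csum (fun k => (omega p ^ e) ^ k) p = 0)%C)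
      by (rewrite H; ring).
    destruct (Ceq_dec (1 - omega p ^ e)%C 0) as [D|D].
    + exfalso. apply Hne. transitivity (1 - (1 - omega p ^ e))%C; [ring|]. rewrite D. ring.
    + apply Cmult_integral in H'. tauto.
  - intros k _. rewrite <- !Cpow_mult_r. f_equal. lia.
Qed.

(** The exponent [e] serves the induction: removing the constant coefficient moves one factor
    [omega p ^ k] out of the argument. All powers that occur stay strictly between 0 and p + 1,
    where the sum over the roots of unity vanishes. *)
Lemma peval_average_aux (l : list C) (p : nat) (t : C) (e : nat) :
  (0 < e)%nat -> (e + length l <= S p)%nat ->
  Csum (fun k => (omega p ^ k) ^ e * peval l (omega p ^ k * t))%C p = RtoC 0.
Proof.
  revert e. induction l as [|a l IH]; intros e He Hl; simpl in *.
  - apply Csum_eq_0. intros. ring.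
  - rewrite (Csum_ext _ (fun k => a * (omega p ^ k) ^ e
      + t * ((omega p ^ k) ^ S e * peval l (omega p ^ k * t)))%C).
    + rewrite Csum_plus, !Csum_scal, IH, omega_sum by lia. ring.
    + intros k _. rewrite Cpow_S. simpl peval. generalize (omega p ^ k)%C. intros x. simpl. ring.
Qed.

Lemma peval_average (l : list C) (p : nat) (t : C) : (length l <= S p)%nat ->
  Csum (fun k => peval l (omega p ^ k * t))%C p = (INR (S p) * hd (RtoC 0) l)%C.
Proof.
  destruct l as [|a l]; intros Hl; simpl in Hl.
  - simpl hd. rewrite Cmult_0_r. apply Csum_eq_0. reflexivity.
  - simpl hd. rewrite (Csum_ext _ (fun k => a
      + t * ((omega p ^ k) ^ 1 * peval l (omega p ^ k * t)))%C).
    + rewrite Csum_plus, Csum_scal, peval_average_aux by lia.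
      rewrite Cmult_0_r, Cplus_0_r. clear.
      induction p as [|p IH]; rewrite ?Csum_O, ?Csum_S, ?IH.
      * simpl. Cring.
      * rewrite (S_INR (S p)), RtoC_plus. Cring.
    + intros k _. rewrite Cpow_S. simpl peval. generalize (omega p ^ k)%C. intros x. simpl. ring.
Qed.

(** The degree is at most p and the p + 1 zeros are the vertices of a regular polygon about 0.
    Averaging over them isolates the constant coefficient, which is thus 0; then the nonzero factor
    [omega p ^ k * t] is cancelled and the next coefficient treated. *)
Lemma peval_zero (l : list C) (p : nat) (t : C) : (length l <= S p)%nat -> t <> RtoC 0 ->
  (forall k, peval l (omega p ^ k * t)%C = RtoC 0) -> forall s, peval l s = RtoC 0.
Proof.
  intros Hl Ht. induction l as [|a l IH]; intros H s; [reflexivity|].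
  assert (Ha : a = RtoC 0).
  { pose proof (peval_average (a :: l) p t Hl) as E.
    rewrite (Csum_ext _ (fun _ => RtoC 0)) in E by (intros; apply H).
    rewrite Csum_zero in E. symmetry in E. apply Cmult_integral in E.
    destruct E as [E|E]; [|exact E].
    exfalso. apply RtoC_inj in E. revert E. apply not_0_INR. lia. }
  subst a. simpl in *. rewrite IH; [ring|lia|].
  intros k. specialize (H k). rewrite Cplus_0_l in H. apply Cmult_integral in H.
  destruct H as [H|H]; [|exact H]. exfalso. apply Cmult_integral in H.
  destruct H as [H|H]; [|now apply Ht].
  pose proof (Cmod_omega_pow p k). rewrite H, Cmod_0 in H0. lra.
Qed.

Lemma polar (v : C) : exists a : R, v = (Cmod v * expi a)%C.
Proof.
  destruct (Ceq_dec v 0) as [->|Hv].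
  - exists 0. rewrite Cmod_0. ring.
  - assert (Hm : 0 < Cmod v) by now apply Cmod_gt_0.
    destruct v as [x y]. set (r := Cmod (x, y)) in *.
    assert (E : (x / r) * (x / r) + (y / r) * (y / r) = 1).
    { assert (r * r = x * x + y * y).
      { unfold r, Cmod. rewrite sqrt_sqrt; simpl; nra. }
      replace (x / r * (x / r) + y / r * (y / r)) with ((x * x + y * y) / (r * r))
        by (field; lra).
      rewrite <- H. field. lra. }
    assert (Hb : -1 <= x / r <= 1) by (split; nra).
    assert (Hs : sin (acos (x / r)) * sin (acos (x / r)) = (y / r) * (y / r)).
    { pose proof (sin2_cos2 (acos (x / r))) as Q. unfold Rsqr in Q.
      rewrite cos_acos in Q by exact Hb. lra. }
    (* [acos] recovers the angle only up to sign; the sign of the sine decides. *)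
    assert (Hor : sin (acos (x / r)) = y / r \/ sin (acos (x / r)) = - (y / r)).
    { assert ((sin (acos (x / r)) - y / r) * (sin (acos (x / r)) + y / r) = 0) by nra.
      apply Rmult_integral in H. destruct H; [left|right]; lra. }
    destruct Hor as [H|H]; [exists (acos (x / r))|exists (- acos (x / r))];
      unfold expi; rewrite ?cos_neg, ?sin_neg, cos_acos, H by exact Hb;
      unfold Cmult, RtoC; simpl; f_equal; field; lra.
Qed.

Lemma complex_root (v : C) (n : nat) : (0 < n)%nat -> exists x : C, (x ^ n)%C = v.
Proof.
  intros Hn. destruct (Ceq_dec v 0) as [->|Hv].
  - exists (RtoC 0). destruct n; [lia|]. simpl. ring.
  - destruct (polar v) as [a Ha].
    assert (Hm : 0 < Cmod v) by now apply Cmod_gt_0.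
    exists (Rpower (Cmod v) (/ INR n) * expi (a / INR n))%C.
    rewrite Cpow_mult_l, expi_pow, <- RtoC_pow, <- Rpower_pow by apply exp_pos.
    rewrite Rpower_mult. assert (INR n <> 0) by (apply not_0_INR; lia).
    replace (/ INR n * INR n) with 1 by (field; assumption).
    replace (INR n * (a / INR n)) with a by (field; assumption).
    rewrite Rpower_1 by exact Hm. now rewrite <- Ha.
Qed.

(** * Division by u w^m + z^K *)

(* The recursion q_(i,j) = (c_(i,j+m) - q_(i-K,j+m)) / u, which compares
   coefficients in c = (u w^m + z^K) q + r, run with k units of fuel. *)
Fixpoint quot_fuel (u : C) (m K : nat) (c : nat -> nat -> C) (k i j : nat) : C :=
  match k with
  | O => RtoC 0
  | S k' => ((c i (j + m)%nat
      - (if (K <=? i)%nat then quot_fuel u m K c k' (i - K) (j + m) else RtoC 0)) / u)%C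
  end.

(** [S i] units of fuel suffice when [K > 0], since each recursive call lowers [i] by [K]. *)
Definition quot (u : C) (m K : nat) (c : nat -> nat -> C) (i j : nat) : C :=
  quot_fuel u m K c (S i) i j.

Definition remainder (u : C) (m K : nat) (c : nat -> nat -> C) (i j : nat) : C :=
  if (j <? m)%nat
  then (c i j - (if (K <=? i)%nat then quot u m K c (i - K) j else RtoC 0))%C
  else RtoC 0.

Lemma quot_fuel_enough (u : C) (m K : nat) (c : nat -> nat -> C) : (0 < K)%nat ->
  forall k k' i j, (i < k)%nat -> (i < k')%nat ->
  quot_fuel u m K c k i j = quot_fuel u m K c k' i j.
Proof.
  intros HK k. induction k as [|k IH]; intros [|k'] i j H H'; try lia. simpl.
  destruct (K <=? i)%nat eqn:E; [|reflexivity]. apply Nat.leb_le in E.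
  rewrite (IH k'); [reflexivity|lia|lia].
Qed.

Lemma quot_eq (u : C) (m K : nat) (c : nat -> nat -> C) (i j : nat) : (0 < K)%nat ->
  quot u m K c i j = ((c i (j + m)%nat
    - (if (K <=? i)%nat then quot u m K c (i - K) (j + m) else RtoC 0)) / u)%C.
Proof.
  intros HK. unfold quot. simpl. destruct (K <=? i)%nat eqn:E; [|reflexivity].
  apply Nat.leb_le in E.
  now rewrite (quot_fuel_enough u m K c HK i (S (i - K))) by lia.
Qed.

(* With |c_(i,j)| <= A T^(i+j), the quotient is controlled by the weights
   (T^m)^i T^j, under which w^m and z are equally large. *)
Lemma tame_quot (u : C) (m K : nat) (c : nat -> nat -> C) :
  2 <= Cmod u -> (0 < m)%nat -> (0 < K)%nat -> tame c -> tame (quot u m K c).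
Proof.
  intros Hu Hm HK [A [T [HT H]]].
  assert (HA : 0 <= A).
  { specialize (H 0%nat 0%nat). simpl in H. pose proof (Cmod_ge_0 (c 0%nat 0%nat)). lra. }
  set (P := T ^ m).
  assert (HTP : T <= P).
  { unfold P. rewrite <- (pow_1 T) at 1. apply Rle_pow; [exact HT|lia]. }
  assert (HB : 0 <= A * P) by (apply Rmult_le_pos; lra).
  assert (Hq : forall k i j, Cmod (quot_fuel u m K c k i j) <= A * P * (P ^ i * T ^ j)).
  { assert (Hpos : forall i j, 0 <= P ^ i * T ^ j)
      by (intros; apply Rmult_le_pos; apply pow_le; lra).
    induction k as [|k IH]; intros i j; simpl.
    - rewrite Cmod_0. now apply Rmult_le_pos.
    - rewrite Cmod_div by (apply Cmod_gt_0; lra).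
      apply Rle_div_l; [lra|].
      apply Rle_trans with (2 * (A * P * (P ^ i * T ^ j))).
      + unfold Cminus. eapply Rle_trans; [apply Cmod_triangle|]. rewrite Cmod_opp.
        assert (H1 : Cmod (c i (j + m)%nat) <= A * P * (P ^ i * T ^ j)).
        { eapply Rle_trans; [apply H|]. rewrite Rmult_assoc.
          apply Rmult_le_compat_l; [exact HA|].
          rewrite Nat.add_assoc, !pow_add. fold P.
          assert (T ^ i <= P ^ i) by (apply pow_incr; lra).
          assert (0 <= T ^ j) by (apply pow_le; lra).
          assert (T ^ i * T ^ j <= P ^ i * T ^ j) by now apply Rmult_le_compat_r.
          rewrite (Rmult_comm P). apply Rmult_le_compat_r; lra. }
        assert (H2 : Cmod (if (K <=? i)%nat then quot_fuel u m K c k (i - K) (j + m)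
            else RtoC 0) <= A * P * (P ^ i * T ^ j)).
        { destruct (K <=? i)%nat eqn:E.
          - apply Nat.leb_le in E. eapply Rle_trans; [apply IH|].
            apply Rmult_le_compat_l; [exact HB|].
            rewrite (Nat.add_comm j), pow_add. fold P.
            rewrite <- Rmult_assoc. apply Rmult_le_compat_r; [apply pow_le; lra|].
            rewrite Rmult_comm. change (P ^ S (i - K) <= P ^ i). apply Rle_pow; [lra|lia].
          - rewrite Cmod_0. now apply Rmult_le_pos. }
        lra.
      + rewrite Rmult_comm. apply Rmult_le_compat_l; [|exact Hu].
        now apply Rmult_le_pos. }
  exists (A * P), P. split; [lra|]. intros i j. eapply Rle_trans; [apply Hq|].
  apply Rmult_le_compat_l; [exact HB|]. rewrite pow_add.
  apply Rmult_le_compat_l; [apply pow_le; lra|]. apply pow_incr. lra.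
Qed.

Lemma quot_remainder (u : C) (m K : nat) (c : nat -> nat -> C) (i j : nat) :
  u <> RtoC 0 -> (0 < K)%nat ->
  c i j = (u * Nat.iter m shw (quot u m K c) i j
    + Nat.iter K shz (quot u m K c) i j + remainder u m K c i j)%C.
Proof.
  intros Hu HK. rewrite iter_shw, iter_shz. unfold remainder.
  destruct (m <=? j)%nat eqn:E.
  - apply Nat.leb_le in E. replace (j <? m)%nat with false by (symmetry; apply Nat.ltb_ge; lia).
    rewrite quot_eq by exact HK. replace (j - m + m)%nat with j by lia. field. exact Hu.
  - apply Nat.leb_gt in E. replace (j <? m)%nat with true by (symmetry; apply Nat.ltb_lt; lia).
    ring.
Qed.

Lemma tame_iter (sh : (nat -> nat -> C) -> nat -> nat -> C) :
  (forall c, tame c -> tame (sh c)) ->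
  forall k c, tame c -> tame (Nat.iter k sh c).
Proof. intros H k c Hc. induction k; simpl; auto. Qed.

(** No new estimate: the remainder is [c] minus the coefficients of [(u w^m + z^K) q], all of them
    tame. *)
Lemma tame_remainder (u : C) (m K : nat) (c : nat -> nat -> C) :
  u <> RtoC 0 -> (0 < K)%nat -> tame c -> tame (quot u m K c) -> tame (remainder u m K c).
Proof.
  intros Hu HK Hc Hq.
  assert (T : tame (fun i j => c i j + ((- u) * Nat.iter m shw (quot u m K c) i j
      + - (1) * Nat.iter K shz (quot u m K c) i j))%C).
  { apply tame_plus; [exact Hc|]. apply tame_plus; apply tame_scal.
    - now apply (tame_iter _ tame_shw).
    - now apply (tame_iter _ tame_shz). }
  revert T. apply (tame_reindex _ (fun i _ => i) (fun _ j => j) 0); [intros; lia|].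
  intros i j. left. rewrite (quot_remainder u m K c i j Hu HK) at 1. ring.
Qed.

(** The coefficients of the polynomial in w are kept as mere functions of z, because it will be
    studied for one fixed z at a time. *)
Lemma expands_polynomial_w (m : nat) (c : nat -> nat -> C) (f : germ) :
  tame c -> expands c f -> (forall i j, (m <= j)%nat -> c i j = RtoC 0) ->
  exists l : C -> list C, (forall z, length (l z) = m) /\
    near (fun z w => f z w = peval (l z) w).
Proof.
  revert c f. induction m as [|m IH]; intros c f Hc Hf H.
  - exists (fun _ => nil). split; [reflexivity|].
    apply (expands_unique c); [exact Hf|]. apply near_all. intros z w.
    apply (Cseries_ext (fun _ => RtoC 0)); [|exact Cseries_zero].
    intros n. unfold hom. rewrite Csum_eq_0; [reflexivity|]. intros k _. rewrite H by lia. ring.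
  - destruct (expands_split_w c f Hc Hf) as [f' [Hf' E]].
    destruct (IH (fun i j => c i (S j)) f') as [l [Hl L]]; [|exact Hf'| |].
    + apply (tame_reindex c (fun i _ => i) (fun _ j => S j) 1); auto. intros; lia.
    + intros i j Hj. apply H. lia.
    + exists (fun z => f z (RtoC 0) :: l z). split; [intros z; simpl; now rewrite Hl|].
      apply (near_imp2 _ _ _ E L). intros z w -> E2. simpl. rewrite E2. ring.
Qed.

(** The condition [2 <= Cmod u] makes the coefficient recursion stable: a difference of two terms
    within the bound, divided by u, is within the bound again. *)
Lemma weierstrass_division (u : C) (m K : nat) (f : germ) :
  2 <= Cmod u -> (0 < m)%nat -> (0 < K)%nat -> holomorphic f ->
  exists (q : germ) (l : C -> list C), holomorphic q /\
    (forall z, length (l z) = m) /\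
    near (fun z w => f z w = ((u * w ^ m + z ^ K) * q z w + peval (l z) w)%C).
Proof.
  intros Hu Hm HK. rewrite holomorphic_tame. intros [c [Hc Hf]].
  assert (Hu0 : u <> RtoC 0) by (apply Cmod_gt_0; lra).
  assert (Hq := tame_quot u m K c Hu Hm HK Hc).
  assert (Hr := tame_remainder u m K c Hu0 HK Hc Hq).
  destruct (expands_exists _ Hq) as [q Eq]. destruct (expands_exists _ Hr) as [r Er].
  destruct (expands_polynomial_w m _ r Hr Er) as [l [Hl L]].
  { intros i j Hj. unfold remainder.
    now replace (j <? m)%nat with false by (symmetry; apply Nat.ltb_ge; lia). }
  exists q, l. split; [rewrite holomorphic_tame; eauto|]. split; [exact Hl|].
  assert (E := expands_plus _ _ _ _
    (expands_plus _ _ _ _ (expands_scal u _ _ (expands_wpow m _ _ Eq)) (expands_zpow K _ _ Eq))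
    Er).
  assert (E' : expands c (germ_add (germ_add (fun z w => (u * (w ^ m * q z w))%C)
    (fun z w => (z ^ K * q z w)%C)) r)).
  { revert E. apply expands_ext. intros i j. symmetry. now apply quot_remainder. }
  apply (near_imp2 _ _ _ (expands_unique _ _ _ Hf E') L). unfold germ_add.
  intros z w -> ->. ring.
Qed.

(** Vanishing on [z = 0] gives [f = z f']. For fixed [z <> 0] the m roots of [u w^m + z^K] are
    nonzero rotations of a single one, which is the configuration that [peval_zero] handles. *)
Lemma factor_zero_set (u : C) (m K : nat) (f : germ) :
  2 <= Cmod u -> (0 < m)%nat -> (0 < K)%nat -> holomorphic f ->
  near (fun z w => z = RtoC 0 \/ (u * w ^ m + z ^ K)%C = RtoC 0 -> f z w = RtoC 0) ->
  exists q, holomorphic q /\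
    near (fun z w => f z w = (z * (u * w ^ m + z ^ K) * q z w)%C).
Proof.
  intros Hu Hm HK Hf Hz.
  destruct (holomorphic_split_z f Hf) as [f' [Hf' Ef]].
  destruct (weierstrass_division u m K f' Hu Hm HK Hf') as [q [l [Hq [Hl El]]]].
  exists q. split; [exact Hq|].
  assert (Hu0 : u <> RtoC 0) by (apply Cmod_gt_0; lra).
  destruct (near_and _ _ Hz (near_and _ _ Ef El)) as [rho [Hrho H]].
  (* All roots w must lie in the bidisc where the hypotheses hold: [|z| < rho'] gives
     [|w|^m <= |z|^K <= |z| < rho^m]. *)
  set (rho' := Rmin 1 (Rmin rho (rho ^ m))).
  assert (Hrho' : 0 < rho').
  { unfold rho'. repeat apply Rmin_pos; try lra. now apply pow_lt. }
  assert (B1 : rho' <= 1) by apply Rmin_l.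
  assert (B2 : rho' <= rho) by (eapply Rle_trans; [apply Rmin_r|apply Rmin_l]).
  assert (B3 : rho' <= rho ^ m) by (eapply Rle_trans; [apply Rmin_r|apply Rmin_r]).
  exists rho'. split; [exact Hrho'|]. intros z w Bz Bw.
  destruct (H z w ltac:(lra) ltac:(lra)) as [_ [E1 E2]].
  assert (E0 : f (RtoC 0) w = RtoC 0).
  { apply (H (RtoC 0) w); [rewrite Cmod_0; lra|lra|now left]. }
  rewrite E1, E2, E0.
  (* At [z = 0] the roots collapse to 0 and say nothing about the remainder, but there both sides
     vanish. *)
  destruct (Ceq_dec z 0) as [->|Hz0]; [ring|].
  enough (P : peval (l z) w = RtoC 0) by (rewrite P; ring).
  destruct (complex_root (- z ^ K / u)%C m Hm) as [w0 Hw0].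
  assert (Hw0' : w0 <> RtoC 0).
  { intros ->. assert (E : (z ^ K)%C = RtoC 0).
    { transitivity (- (u * (- z ^ K / u)))%C; [field; exact Hu0|].
      rewrite <- Hw0. destruct m; [lia|]. simpl. ring. }
    now apply Cpow_integral in E. }
  assert (Bw0 : Cmod w0 < rho).
  { assert (Cmod w0 ^ m < rho ^ m).
    { rewrite <- Cmod_pow, Hw0, Cmod_div, Cmod_opp, Cmod_pow by exact Hu0.
      apply Rlt_le_trans with rho'; [|exact B3].
      pose proof (Cmod_ge_0 z).
      assert (Cmod z ^ K <= Cmod z).
      { destruct K as [|K']; [lia|]. simpl.
        assert (Cmod z ^ K' <= 1) by (rewrite <- (pow1 K'); apply pow_incr; lra).
        nra. }
      apply Rlt_div_l; nra. }
    destruct (Rlt_or_le (Cmod w0) rho) as [L|L]; [exact L|]. exfalso.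
    assert (rho ^ m <= Cmod w0 ^ m) by (apply pow_incr; lra). lra. }
  (* [omega (pred m)] has order m, so its powers times [w0] run through all m roots. *)
  apply (peval_zero (l z) (pred m) w0); [rewrite Hl; lia|exact Hw0'|].
  intros k. set (w1 := (omega (pred m) ^ k * w0)%C).
  assert (Hw1 : (w1 ^ m)%C = (- z ^ K / u)%C).
  { unfold w1. rewrite Cpow_mult_l, <- Cpow_mult_r, Nat.mul_comm, Cpow_mult_r.
    replace m with (S (pred m)) at 2 by lia. rewrite omega_pow_order, Cpow_1_l, Hw0. ring. }
  assert (Bw1 : Cmod w1 < rho).
  { unfold w1. rewrite Cmod_mult, Cmod_omega_pow. lra. }
  assert (G0 : (u * w1 ^ m + z ^ K)%C = RtoC 0) by (rewrite Hw1; field; exact Hu0).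
  destruct (H z w1 ltac:(lra) Bw1) as [F1 [F2 F3]].
  specialize (F1 (or_intror G0)). rewrite F2, F3, G0 in F1.
  assert (F0 : f (RtoC 0) w1 = RtoC 0).
  { apply (H (RtoC 0) w1); [rewrite Cmod_0; lra|exact Bw1|now left]. }
  rewrite F0, Cmult_0_l, Cplus_0_l, Cplus_0_r in F1.
  apply Cmult_integral in F1. tauto.
Qed.

(** * Derivatives and ideals *)

(** [Lim] is the mean of the upper and lower limits along [x + 1/(n+1)], so bounds on nearby values
    pass to it whether or not a limit exists. *)
Lemma Lim_bound (g : R -> R) (x l B rho : R) : 0 < rho ->
  (forall h : R, 0 < h < rho -> Rabs (g (x + h) - l) <= B) -> Rabs (real (Lim g x) - l) <= B.
Proof.
  intros Hrho H. unfold Lim, Lim_seq.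
  set (u := fun n : nat => g (Rbar_loc_seq x n)).
  assert (E : eventually (fun n => l - B <= u n <= l + B)).
  { destruct (nfloor_ex (/ rho)) as [N [_ HN]]; [left; now apply Rinv_0_lt_compat|].
    exists N. intros n Hn. unfold u. simpl.
    assert (Hpos : 0 < / rho) by now apply Rinv_0_lt_compat.
    assert (L : / rho < INR n + 1) by (apply le_INR in Hn; lra).
    assert (Hh : 0 < / (INR n + 1) < rho).
    { split; [apply Rinv_0_lt_compat; lra|].
      rewrite <- (Rinv_inv rho). apply Rinv_lt_contravar; [|exact L].
      apply Rmult_lt_0_compat; lra. }
    specialize (H _ Hh). apply Rabs_le_between in H. lra. }
  assert (S1 : Rbar_le (LimSup_seq u) (l + B)).
  { rewrite <- (LimSup_seq_const (l + B)). apply LimSup_le.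
    revert E. apply filter_imp. intros; lra. }
  assert (S2 : Rbar_le (l - B) (LimInf_seq u)).
  { rewrite <- (LimInf_seq_const (l - B)). apply LimInf_le.
    revert E. apply filter_imp. intros; lra. }
  pose proof (LimSup_LimInf_seq_le u) as S3.
  destruct (LimSup_seq u) as [a| |]; destruct (LimInf_seq u) as [b| |]; simpl in *;
    try tauto.
  apply Rabs_le_between. lra.
Qed.

(* C_derive takes its limit along the real direction only, and is defined even
   where the limit does not exist. *)
Lemma C_derive_bound (f : C -> C) (y l : C) (B rho : R) : 0 < rho ->
  (forall h : C, h <> RtoC 0 -> Cmod h < rho ->
     Cmod (f (y + h) - f y - h * l)%C <= B * Cmod h) ->
  Cmod (C_derive f y - l)%C <= 2 * B.
Proof.
  intros Hrho H. unfold C_derive, C_lim.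
  assert (Q : forall h : R, 0 < h < rho ->
    Cmod ((f ((fst y + h)%R, snd y) - f y) / (((fst y + h)%R, snd y) - y) - l)%C <= B).
  { intros h Hh.
    assert (E : (((fst y + h)%R, snd y) : C) = (y + h)%C).
    { destruct y as [a b]. unfold Cplus, RtoC. simpl. f_equal. ring. }
    rewrite E.
    assert (Hh0 : RtoC h <> RtoC 0) by (intros K; apply RtoC_inj in K; lra).
    assert (M : Cmod h = h) by (rewrite Cmod_R, Rabs_right; lra).
    specialize (H h Hh0 ltac:(lra)). rewrite M in H.
    replace ((f (y + h) - f y) / (y + h - y) - l)%C
      with ((f (y + h) - f y - h * l) / h)%C.
    - rewrite Cmod_div, M by exact Hh0. apply Rle_div_l; lra.
    - replace (y + h - y)%C with (RtoC h) by ring. field. exact Hh0. }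
  set (q := fun x : C => ((f x - f y) / (x - y))%C) in *.
  assert (L1 := Lim_bound (fun x => fst (q (x, snd y))) (fst y) (fst l) B rho Hrho).
  assert (L2 := Lim_bound (fun x => snd (q (x, snd y))) (fst y) (snd l) B rho Hrho).
  assert (K1 := L1 (fun h Hh => Rle_trans _ _ _ (re_le_Cmod _) (Q h Hh))).
  assert (K2 := L2 (fun h Hh => Rle_trans _ _ _ (im_le_Cmod _) (Q h Hh))).
  match goal with |- Cmod ?x <= _ => set (v := x) end.
  eapply Rle_trans; [apply (Cmod_2Rmax v)|].
  assert (0 <= B) by (pose proof (Rabs_pos (real (Lim (fun x => fst (q (x, snd y))) (fst y)) - fst l)); lra).
  apply Rle_trans with (sqrt 2 * B).
  - apply Rmult_le_compat_l; [apply sqrt_pos|]. apply Rmax_lub; [exact K1|exact K2].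
  - apply Rmult_le_compat_r; [assumption|].
    pose proof (sqrt_pos 2). pose proof (sqrt_sqrt 2). nra.
Qed.

(** A quadratic error instead of mere differentiability: polynomials satisfy it, and sums and
    products follow by inequalities with explicit constants. *)
Definition tangent (f : C -> C) (y l : C) : Prop :=
  exists B rho : R, 0 <= B /\ 0 < rho /\ forall h : C, Cmod h < rho ->
    Cmod (f (y + h) - f y - h * l)%C <= B * Cmod h ^ 2.

Lemma tangent_C_derive (f : C -> C) (y l : C) : tangent f y l -> C_derive f y = l.
Proof.
  intros [B [rho [HB [Hrho H]]]].
  assert (E : forall e, 0 < e -> Cmod (C_derive f y - l)%C <= 2 * (B * e)).
  { intros e He. apply (C_derive_bound f y l (B * e) (Rmin rho e)); [now apply Rmin_pos|].
    intros h _ Hh. pose proof (Rmin_l rho e). pose proof (Rmin_r rho e).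
    eapply Rle_trans; [apply H; lra|]. pose proof (Cmod_ge_0 h).
    replace (B * e * Cmod h) with (B * (e * Cmod h)) by ring.
    apply Rmult_le_compat_l; [exact HB|]. simpl. rewrite Rmult_1_r.
    apply Rmult_le_compat_r; lra. }
  assert (Z : Cmod (C_derive f y - l)%C = 0).
  { apply Rle_antisym; [|apply Cmod_ge_0]. apply Rnot_lt_le. intros L.
    (* With this [e] the estimate bounds the distance by [B/(B+1) <= 1] times its own half. *)
    specialize (E (Cmod (C_derive f y - l)%C / (4 * (B + 1)))
      ltac:(apply Rdiv_lt_0_compat; lra)).
    assert (B / (B + 1) <= 1) by (apply Rle_div_l; lra).
    replace (2 * (B * (Cmod (C_derive f y - l)%C / (4 * (B + 1)))))
      with (B / (B + 1) * (Cmod (C_derive f y - l)%C / 2)) in E by (field; lra).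
    nra. }
  apply Cmod_eq_0 in Z. transitivity (C_derive f y - l + l)%C; [ring|]. rewrite Z. ring.
Qed.

Lemma tangent_const (u y : C) : tangent (fun _ => u) y 0.
Proof.
  exists 0, 1. split; [lra|]. split; [lra|]. intros h _.
  replace (u - u - h * 0)%C with (RtoC 0) by ring. rewrite Cmod_0. lra.
Qed.

Lemma tangent_id (y : C) : tangent (fun x => x) y 1.
Proof.
  exists 0, 1. split; [lra|]. split; [lra|]. intros h _.
  replace (y + h - y - h * 1)%C with (RtoC 0) by ring. rewrite Cmod_0. lra.
Qed.

Lemma tangent_plus (f g : C -> C) (y l m : C) :
  tangent f y l -> tangent g y m -> tangent (fun x => (f x + g x)%C) y (l + m)%C.
Proof.
  intros [B [r [HB [Hr H]]]] [D [s [HD [Hs K]]]].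
  exists (B + D), (Rmin r s). split; [lra|]. split; [now apply Rmin_pos|].
  intros h Hh. pose proof (Rmin_l r s). pose proof (Rmin_r r s).
  replace (f (y + h) + g (y + h) - (f y + g y) - h * (l + m))%C
    with ((f (y + h) - f y - h * l) + (g (y + h) - g y - h * m))%C by ring.
  eapply Rle_trans; [apply Cmod_triangle|].
  rewrite Rmult_plus_distr_r. apply Rplus_le_compat; [apply H|apply K]; lra.
Qed.

Lemma tangent_mul (f g : C -> C) (y l m : C) :
  tangent f y l -> tangent g y m ->
  tangent (fun x => (f x * g x)%C) y (l * g y + f y * m)%C.
Proof.
  intros [B [r [HB [Hr H]]]] [D [s [HD [Hs K]]]].
  pose proof (Cmod_ge_0 (f y)) as P1. pose proof (Cmod_ge_0 (g y)) as P2.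
  pose proof (Cmod_ge_0 l) as P3. pose proof (Cmod_ge_0 m) as P4.
  exists (Cmod (f y) * D + Cmod l * (Cmod m + D) + B * (Cmod (g y) + Cmod m + D)),
    (Rmin 1 (Rmin r s)).
  split; [repeat apply Rplus_le_le_0_compat; apply Rmult_le_pos; lra|].
  split; [repeat apply Rmin_pos; lra|].
  intros h Hh. pose proof (Rmin_l 1 (Rmin r s)). pose proof (Rmin_r 1 (Rmin r s)).
  pose proof (Rmin_l r s). pose proof (Rmin_r r s).
  specialize (H h ltac:(lra)). specialize (K h ltac:(lra)).
  set (E1 := (f (y + h) - f y - h * l)%C) in *.
  set (E2 := (g (y + h) - g y - h * m)%C) in *.
  replace (f (y + h) * g (y + h) - f y * g y - h * (l * g y + f y * m))%C
    with (f y * E2 + h * l * (h * m + E2) + E1 * (g y + h * m + E2))%C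
    by (unfold E1, E2; ring).
  pose proof (Cmod_ge_0 h) as Ph. set (x := Cmod h) in *.
  assert (X2 : 0 <= x ^ 2 <= x) by (simpl; split; nra).
  assert (Q2 : Cmod E2 <= D * x) by nra.
  assert (Q2' : Cmod E2 <= D) by nra.
  assert (T1 : Cmod (h * m + E2)%C <= x * (Cmod m + D)).
  { eapply Rle_trans; [apply Cmod_triangle|]. rewrite Cmod_mult. fold x. lra. }
  assert (T2 : Cmod (g y + h * m + E2)%C <= Cmod (g y) + Cmod m + D).
  { eapply Rle_trans; [apply Cmod_triangle|]. apply Rplus_le_compat; [|exact Q2'].
    eapply Rle_trans; [apply Cmod_triangle|]. rewrite Cmod_mult. fold x. nra. }
  eapply Rle_trans; [apply Cmod_triangle|].
  rewrite !Rmult_plus_distr_r. apply Rplus_le_compat.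
  - eapply Rle_trans; [apply Cmod_triangle|]. apply Rplus_le_compat.
    + rewrite Cmod_mult, Rmult_assoc. apply Rmult_le_compat_l; assumption.
    + rewrite !Cmod_mult. fold x.
      apply Rle_trans with (x * Cmod l * (x * (Cmod m + D))).
      * apply Rmult_le_compat_l; [now apply Rmult_le_pos|exact T1].
      * right. simpl. ring.
  - rewrite Cmod_mult.
    apply Rle_trans with (B * x ^ 2 * (Cmod (g y) + Cmod m + D)); [|right; ring].
    apply Rmult_le_compat; try apply Cmod_ge_0; assumption.
Qed.

Lemma tangent_pow (y : C) (n : nat) : tangent (fun x => (x ^ n)%C) y (INR n * y ^ pred n)%C.
Proof.
  induction n as [|n IH].
  - simpl. replace (0 * 1)%C with (RtoC 0) by ring. apply tangent_const.
  - assert (T := tangent_mul _ _ _ _ _ (tangent_id y) IH).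
    replace (RtoC (INR (S n)) * y ^ pred (S n))%C
      with (1 * y ^ n + y * (INR n * y ^ pred n))%C; [exact T|].
    rewrite S_INR, RtoC_plus. simpl pred. destruct n as [|n]; [simpl; ring|].
    simpl pred. rewrite Cpow_S. ring.
Qed.

Lemma d_h1 (M : nat) (z w : C) :
  fst (d (h1 M)) z w = (INR M * z ^ pred M)%C /\ snd (d (h1 M)) z w = RtoC 0.
Proof.
  split; apply tangent_C_derive; unfold h1; [apply tangent_pow|apply tangent_const].
Qed.

Definition gw (K N : nat) : germ := fun z w => (INR N * w ^ pred N + z ^ K)%C.

Lemma d_h2 (K N : nat) (z w : C) :
  fst (d (h2 K N)) z w = (w * (INR K * z ^ pred K))%C /\ snd (d (h2 K N)) z w = gw K N z w.
Proof.
  split; apply tangent_C_derive; unfold h2.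
  - assert (T := tangent_plus _ _ _ _ _ (tangent_const (w ^ N) z)
      (tangent_mul _ _ _ _ _ (tangent_const w z) (tangent_pow z K))).
    match goal with |- tangent _ _ ?l => match type of T with tangent _ _ ?l' =>
      replace l with l'; [exact T|ring] end end.
  - assert (T := tangent_plus _ _ _ _ _ (tangent_pow w N)
      (tangent_mul _ _ _ _ _ (tangent_id w) (tangent_const (z ^ K) w))).
    match goal with |- tangent _ _ ?l => match type of T with tangent _ _ ?l' =>
      replace l with l'; [exact T|unfold gw; ring] end end.
Qed.

Definition zgw (K N : nat) : germ := fun z w => (z * gw K N z w)%C.

Lemma d_zgw (K N : nat) (z w : C) :
  fst (d (zgw K N)) z w = (gw K N z w + z * (INR K * z ^ pred K))%C /\
  snd (d (zgw K N)) z w = (z * (INR N * (INR (pred N) * w ^ pred (pred N))))%C.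
Proof.
  split; apply tangent_C_derive; unfold zgw, gw.
  - assert (T := tangent_mul _ _ _ _ _ (tangent_id z)
      (tangent_plus _ _ _ _ _ (tangent_const (INR N * w ^ pred N) z) (tangent_pow z K))).
    match goal with |- tangent _ _ ?l => match type of T with tangent _ _ ?l' =>
      replace l with l'; [exact T|ring] end end.
  - assert (T := tangent_mul _ _ _ _ _ (tangent_const z w)
      (tangent_plus _ _ _ _ _
        (tangent_mul _ _ _ _ _ (tangent_const (INR N) w) (tangent_pow w (pred N)))
        (tangent_const (z ^ K) w))).
    match goal with |- tangent _ _ ?l => match type of T with tangent _ _ ?l' =>
      replace l with l'; [exact T|ring] end end.
Qed.

(** * Ideals, spans of rows, and orders of roots *)

Lemma ideal_germ_eq (S : germ -> Prop) (f g : germ) :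
  germ_eq f g -> ideal_generated S f -> ideal_generated S g.
Proof.
  intros H K. apply germ_eq_sym in H. destruct K as [f K|a b h f Ha Hb Hh K].
  - apply ideal_zero. now apply (germ_eq_trans _ f).
  - apply (ideal_add _ a b h); auto. now apply (germ_eq_trans _ f).
Qed.

Lemma ideal_ext (S : germ -> Prop) (f g : germ) :
  (forall z w, f z w = g z w) -> ideal_generated S f -> ideal_generated S g.
Proof. intros H. apply ideal_germ_eq. now apply near_all. Qed.

Lemma ideal_plus (S : germ -> Prop) (f g : germ) :
  ideal_generated S f -> ideal_generated S g -> ideal_generated S (germ_add f g).
Proof.
  intros Hf Hg. induction Hf as [f H|a b h f Ha Hb Hh IH H].
  - revert Hg. apply ideal_germ_eq. apply (near_imp _ _ H).
    unfold germ_add, germ_zero. intros z w ->. ring.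
  - apply (ideal_add _ a b (germ_add h g)); auto. apply (near_imp _ _ H).
    unfold germ_add. intros z w ->. ring.
Qed.

Lemma ideal_mul (S : germ -> Prop) (a f : germ) :
  holomorphic a -> ideal_generated S f -> ideal_generated S (germ_mul a f).
Proof.
  intros Ha Hf. induction Hf as [f H|b g h f Hb Hg Hh IH H].
  - apply ideal_zero. apply (near_imp _ _ H).
    unfold germ_mul, germ_zero. intros z w ->. ring.
  - apply (ideal_add _ (germ_mul a b) g (germ_mul a h)); auto.
    + now apply holomorphic_mul.
    + apply (near_imp _ _ H). unfold germ_mul, germ_add. intros z w ->. ring.
Qed.

Lemma ideal_scal (S : germ -> Prop) (u : C) (f : germ) :
  ideal_generated S f -> ideal_generated S (fun z w => (u * f z w)%C).
Proof. apply (ideal_mul S (fun _ _ => u)), holomorphic_const. Qed.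

Lemma ideal_incl (S : germ -> Prop) (f : germ) : S f -> ideal_generated S f.
Proof.
  intros H. apply (ideal_add _ (fun _ _ => RtoC 1) f germ_zero); [apply holomorphic_const|exact H| |].
  - apply ideal_zero, germ_eq_refl.
  - apply near_all. intros. unfold germ_add, germ_mul, germ_zero. ring.
Qed.

Lemma rows_incl (S : row -> Prop) (u : row) : S u -> rows_spanned S u.
Proof.
  intros H. apply (rows_add _ (fun _ _ => RtoC 1) u (germ_zero, germ_zero));
    [apply holomorphic_const|exact H| | |];
    [apply rows_zero; apply germ_eq_refl|..];
    apply near_all; intros; unfold germ_add, germ_mul, germ_zero; simpl; ring.
Qed.

(** Binomial coefficients are avoided: all products [x^i y^j (x+y)^n] with [i + j + n >= p + q] lie
    in the ideal, by distributing one factor [x + y] at a time until [n = 0] forces [i >= p] or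
    [j >= q]. *)
Lemma ideal_binomial (S : germ -> Prop) (x y : germ) (p q : nat) :
  holomorphic x -> holomorphic y ->
  ideal_generated S (germ_pow x p) -> ideal_generated S (germ_pow y q) ->
  ideal_generated S (germ_pow (germ_add x y) (p + q)).
Proof.
  intros Hx Hy Px Py.
  assert (H : forall n i j, (p + q <= i + j + n)%nat -> ideal_generated S
    (fun z w => (x z w ^ i * y z w ^ j * (x z w + y z w) ^ n)%C)).
  { induction n as [|n IH]; intros i j Hij.
    - destruct (Nat.le_gt_cases p i) as [L|L].
      + assert (Q := ideal_mul _ _ _ (holomorphic_mul _ _ (holomorphic_pow x (i - p) Hx)
          (holomorphic_pow y j Hy)) Px).
        revert Q. apply ideal_ext. intros z w. unfold germ_mul, germ_pow.
        replace i with ((i - p) + p)%nat at 2 by lia. rewrite Cpow_add_r. simpl. ring.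
      + assert (Q := ideal_mul _ _ _ (holomorphic_mul _ _ (holomorphic_pow x i Hx)
          (holomorphic_pow y (j - q) Hy)) Py).
        revert Q. apply ideal_ext. intros z w. unfold germ_mul, germ_pow.
        replace j with ((j - q) + q)%nat at 2 by lia. rewrite Cpow_add_r. simpl. ring.
    - assert (Q := ideal_plus _ _ _ (IH (Datatypes.S i) j ltac:(lia)) (IH i (Datatypes.S j) ltac:(lia))).
      revert Q. apply ideal_ext. intros z w. unfold germ_add. simpl. ring. }
  specialize (H (p + q)%nat 0%nat 0%nat ltac:(lia)). revert H. apply ideal_ext.
  intros z w. unfold germ_pow, germ_add. simpl. ring.
Qed.

Lemma root_order_exists (J I : germ -> Prop) (s : nat) :
  root_exponent J I s -> exists t, root_order J I t.
Proof.
  induction s as [s IH] using (well_founded_ind lt_wf). intros H.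
  destruct (classic (exists t, (t < s)%nat /\ root_exponent J I t)) as [[t [L T]]|Hn].
  - now apply (IH t).
  - exists s. split; [exact H|]. intros t Ht.
    destruct (Nat.le_gt_cases s t) as [L|L]; [exact L|]. exfalso. eauto.
Qed.

Lemma power_comparison (c A rho : R) (p q : nat) : 0 < c -> 0 < rho ->
  (forall x, 0 < x < rho -> c * x ^ p <= A * x ^ q) -> (q <= p)%nat.
Proof.
  intros Hc Hr H. destruct (Nat.le_gt_cases q p) as [L|L]; [exact L|]. exfalso.
  replace q with (p + S (q - p - 1))%nat in H by lia. set (k := (q - p - 1)%nat) in *.
  set (B := Rabs A + 1). assert (HB : 0 < B) by (unfold B; pose proof (Rabs_pos A); lra).
  (* Chosen so that [B x <= c/2], against the inequality [c <= B x] that cancelling [x^p] yields. *)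
  set (x := Rmin (rho / 2) (Rmin 1 (c / (2 * B)))).
  assert (P : 0 < c / (2 * B)) by (apply Rdiv_lt_0_compat; lra).
  assert (Hx : 0 < x) by (unfold x; repeat apply Rmin_pos; lra).
  assert (X1 : x <= rho / 2) by apply Rmin_l.
  assert (X2 : x <= 1) by (eapply Rle_trans; [apply Rmin_r|apply Rmin_l]).
  assert (X3 : x <= c / (2 * B)) by (eapply Rle_trans; [apply Rmin_r|apply Rmin_r]).
  specialize (H x ltac:(lra)). rewrite pow_add in H.
  assert (Xp : 0 < x ^ p) by now apply pow_lt.
  assert (Xk : 0 < x ^ S k <= x).
  { split; [now apply pow_lt|]. simpl.
    assert (x ^ k <= 1) by (rewrite <- (pow1 k); apply pow_incr; lra). nra. }
  assert (H' : c <= B * x).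
  { apply (Rmult_le_reg_r (x ^ p)); [exact Xp|]. eapply Rle_trans; [exact H|].
    rewrite (Rmult_comm (x ^ p)), <- Rmult_assoc. apply Rmult_le_compat_r; [lra|].
    assert (A <= B) by (unfold B; pose proof (Rle_abs A); lra). nra. }
  assert (B * x <= B * (c / (2 * B))) by (apply Rmult_le_compat_l; lra).
  replace (B * (c / (2 * B))) with (c / 2) in H0 by (field; lra). lra.
Qed.

(** * Kohn's algorithm *)

Lemma holomorphic_monomial (u : C) (i j : nat) : holomorphic (fun z w => (u * z ^ i * w ^ j)%C).
Proof.
  apply (holomorphic_mul (fun z w => (u * z ^ i)%C) (fun z w => (w ^ j)%C)).
  - apply (holomorphic_mul (fun z w => u) (fun z w => (z ^ i)%C)).
    + apply holomorphic_const.
    + apply (holomorphic_pow _ _ holomorphic_z).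
  - apply (holomorphic_pow _ _ holomorphic_w).
Qed.

Lemma holomorphic_gw (K N : nat) : holomorphic (gw K N).
Proof.
  apply (holomorphic_germ_eq (germ_add (fun z w => (INR N * z ^ 0 * w ^ pred N)%C)
    (fun z w => (1 * z ^ K * w ^ 0)%C))).
  - apply near_all. intros. unfold germ_add, gw. simpl. ring.
  - apply holomorphic_add; apply holomorphic_monomial.
Qed.

Lemma holomorphic_zgw (K N : nat) : holomorphic (zgw K N).
Proof. apply (holomorphic_mul _ _ holomorphic_z (holomorphic_gw K N)). Qed.

Section Kohn.

Variables K M N : nat.
Hypothesis HM : (2 <= M)%nat.
Hypothesis HN : (3 <= N)%nat.
Hypothesis HK : (M < K)%nat.

Let rows (k : nat) : row -> Prop := stage_rows (kohn (h1 M) (h2 K N) k).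
Let J (k : nat) : germ -> Prop := kohn_J (h1 M) (h2 K N) k.
Let I (k : nat) : germ -> Prop := kohn_I (h1 M) (h2 K N) k.

(** On [z = 0] the dz-components of both generators vanish because [K > M >= 2], and on [g = 0]
    their dw-components do. Either way a determinant of such rows has a zero column. *)
Lemma rows_0_vanish (u : row) : rows 0 u ->
  near (fun z w => (gw K N z w = RtoC 0 -> snd u z w = RtoC 0) /\
                   (z = RtoC 0 -> fst u z w = RtoC 0)).
Proof.
  intros H. change (rows_spanned (fun v => v = d (h1 M) \/ v = d (h2 K N)) u) in H.
  induction H as [u H1 H2|a v t u Ha Hv Ht IH H1 H2].
  - apply (near_imp2 _ _ _ H1 H2). unfold germ_zero. tauto.
  - apply (near_imp2 _ _ _ IH (near_and _ _ H1 H2)). unfold germ_add, germ_mul.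
    intros z w [I1 I2] [-> ->].
    destruct (d_h1 M z w) as [F1 F2]. destruct (d_h2 K N z w) as [G1 G2].
    split; intros E; [rewrite (I1 E)|rewrite (I2 E)]; destruct Hv as [-> | ->];
      rewrite ?F1, ?F2, ?G1, ?G2, ?E.
    + ring.
    + ring.
    + destruct M as [|[|m]]; [lia|lia|]. simpl. ring.
    + destruct K as [|[|k]]; [lia|lia|]. simpl. ring.
Qed.

Lemma J_0_vanish (f : germ) : J 0 f ->
  near (fun z w => z = RtoC 0 \/ gw K N z w = RtoC 0 -> f z w = RtoC 0).
Proof.
  intros H. change (ideal_generated (is_det_of (rows 0)) f) in H.
  induction H as [f H|a g h f Ha Hg Hh IH H].
  - apply (near_imp _ _ H). auto.
  - destruct Hg as [u [v [Hu [Hv ->]]]].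
    apply (near_imp2 _ _ _ (near_and _ _ IH H)
      (near_and _ _ (rows_0_vanish u Hu) (rows_0_vanish v Hv))).
    unfold germ_add, germ_mul, row_det.
    intros z w [I0 ->] [[U1 U2] [V1 V2]] E. rewrite (I0 E).
    destruct E as [E|E]; [rewrite U2, V2 by exact E|rewrite U1, V1 by exact E]; ring.
Qed.

(** Some power of f vanishes on [z g = 0], so f does; the division is then applied with [u = N] and
    [m = N - 1]. *)
Lemma I_0_factor (f : germ) : I 0 f ->
  exists q, holomorphic q /\ near (fun z w => f z w = (zgw K N z w * q z w)%C).
Proof.
  intros [Hf [s [Hs H]]]. apply J_0_vanish in H.
  destruct (factor_zero_set (INR N) (pred N) K f) as [q [Hq E]];
    [|lia|lia|exact Hf| |exists q; split; [exact Hq|exact E]].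
  - rewrite Cmod_R, Rabs_right by (apply Rle_ge, pos_INR).
    apply (le_INR 2). lia.
  - apply (near_imp _ _ H). intros z w L E. apply (Cpow_integral _ s). now apply L.
Qed.

Lemma rows_0_h1 : rows 0 (d (h1 M)).
Proof. apply (rows_incl (fun v => v = d (h1 M) \/ v = d (h2 K N))). now left. Qed.

Lemma rows_0_h2 : rows 0 (d (h2 K N)).
Proof. apply (rows_incl (fun v => v = d (h1 M) \/ v = d (h2 K N))). now right. Qed.

Lemma J_0_generator : J 0 (fun z w => (z ^ pred M * gw K N z w)%C).
Proof.
  change (ideal_generated (is_det_of (rows 0)) (fun z w => (z ^ pred M * gw K N z w)%C)).
  assert (D : is_det_of (rows 0) (row_det (d (h1 M)) (d (h2 K N)))).
  { eexists; eexists. split; [exact rows_0_h1|]. split; [exact rows_0_h2|reflexivity]. }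
  generalize (ideal_scal _ (/ INR M) _ (ideal_incl _ _ D)). apply ideal_ext.
  intros z w. unfold row_det.
  destruct (d_h1 M z w) as [-> ->]. destruct (d_h2 K N z w) as [-> ->].
  field. intros E. apply RtoC_inj in E. revert E. apply not_0_INR. lia.
Qed.

Lemma I_0_zgw : I 0 (zgw K N).
Proof.
  split; [apply holomorphic_zgw|]. exists (pred M). split; [lia|].
  generalize (ideal_mul _ _ _ (holomorphic_pow _ (pred (pred M)) (holomorphic_gw K N))
    J_0_generator).
  apply ideal_ext. intros z w. unfold germ_mul, germ_pow, zgw.
  rewrite Cpow_mult_l. destruct M as [|[|m]]; [lia|lia|]. simpl. ring.
Qed.

(** [(z g q)^(M-1) = q^(M-1) g^(M-2) (z^(M-1) g)], and the last factor is the determinant of [dh_1]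
    and [dh_2] up to the constant M. *)
Lemma root_exponent_0 : root_exponent (J 0) (I 0) (pred M).
Proof.
  split; [lia|]. intros f Hf. destruct (I_0_factor f Hf) as [q [Hq E]].
  assert (H : J 0 (germ_mul (germ_pow q (pred M))
    (germ_mul (germ_pow (gw K N) (pred (pred M))) (fun z w => (z ^ pred M * gw K N z w)%C)))).
  { apply ideal_mul; [now apply holomorphic_pow|].
    apply ideal_mul; [apply holomorphic_pow, holomorphic_gw|apply J_0_generator]. }
  revert H. apply ideal_germ_eq. apply (near_imp _ _ E). intros z w E'.
  unfold germ_mul, germ_pow. rewrite E'. unfold zgw. rewrite !Cpow_mult_l.
  destruct M as [|[|m]]; [lia|lia|]. simpl. ring.
Qed.

(** The condition on the line [w = 0] that survives spanning with holomorphic coefficients and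
    forces determinants to be [O(z^K)]. A single constant serves both components. *)
Definition row_bound (u : row) : Prop :=
  exists A : R, 0 <= A /\ near (fun z _ => Cmod (fst u z (RtoC 0)) <= A /\
    Cmod (snd u z (RtoC 0)) <= A * Cmod z ^ K).

(** With 0 as comparison value, [C_derive_bound] turns a bound on difference quotients into one on
    the derivative, and the quotients of [f(., 0)] are values of a holomorphic germ. *)
Lemma row_bound_d_fst (f : germ) : holomorphic f ->
  exists A, 0 <= A /\ near (fun z _ => Cmod (fst (d f) z (RtoC 0)) <= A).
Proof.
  intros Hf. destruct (holomorphic_difference f Hf) as [k [Hk E]].
  destruct (holomorphic_bounded k Hk) as [B [HB Bk]].
  destruct (near_and _ _ E Bk) as [rho [Hrho H]].
  exists (2 * B). split; [lra|]. exists (rho / 2). split; [lra|]. intros z _ Hz _.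
  assert (Q := C_derive_bound (fun x => f x (RtoC 0)) z 0 B (rho / 2) ltac:(lra)).
  replace (C_derive (fun x => f x (RtoC 0)) z - 0)%C
    with (fst (d f) z (RtoC 0)) in Q by (unfold d; simpl; ring).
  apply Q. intros h _ Hh.
  assert (Hzh : Cmod (z + h)%C < rho).
  { eapply Rle_lt_trans; [apply Cmod_triangle|]. lra. }
  destruct (H (z + h)%C z Hzh ltac:(lra)) as [E1 E2].
  replace (f (z + h) 0 - f z 0 - h * 0)%C with (h * k (z + h) z)%C.
  - rewrite Cmod_mult, Rmult_comm. apply Rmult_le_compat_r; [apply Cmod_ge_0|exact E2].
  - transitivity (f (z + h) 0 - f z 0)%C; [|ring]. rewrite E1. ring.
Qed.

(** With [f = z g q] and [q(z, h) = h q'(z, h) + q(z, 0)] the increment is [f(z, h) - f(z, 0) = h z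
    (N h^(N-2) q(z, h) + z^K q'(z, h))]. As [N >= 3], the bracket is [O(z^K)] as soon as
    [|h| <= |z|^K]. *)
Lemma row_bound_d (f : germ) : I 0 f -> row_bound (d f).
Proof.
  intros Hf. destruct (row_bound_d_fst f (proj1 Hf)) as [A [HA L]].
  destruct (I_0_factor f Hf) as [q [Hq E]].
  destruct (holomorphic_split_w q Hq) as [q' [Hq' E']].
  destruct (holomorphic_bounded q Hq) as [B [HB Bq]].
  destruct (holomorphic_bounded q' Hq') as [B' [HB' Bq']].
  set (D := INR N * B + B').
  assert (HD : 0 <= D) by (unfold D; pose proof (pos_INR N); nra).
  exists (A + 2 * D). split; [lra|].
  destruct (near_and _ _ (near_and _ _ L E) (near_and _ _ E' (near_and _ _ Bq Bq')))
    as [rho [Hrho H]].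
  exists (Rmin 1 rho). split; [apply Rmin_pos; lra|]. intros z w Hz Hw.
  pose proof (Rmin_l 1 rho). pose proof (Rmin_r 1 rho).
  destruct (H z w ltac:(lra) ltac:(lra)) as [[L1 _] _].
  split; [lra|].
  apply Rle_trans with (2 * (D * Cmod z ^ K)).
  2: { pose proof (pow_le (Cmod z) K (Cmod_ge_0 z)). nra. }
  (* The radius for h may depend on z. At [z = 0] the choice [|z|^K] would be 0; there the factor z
     makes the increment of f vanish, and radius 1 will do. *)
  assert (Hs : 0 < (if Ceq_dec z 0 then 1 else Cmod z ^ K)).
  { destruct (Ceq_dec z 0); [lra|]. apply pow_lt, Cmod_gt_0. assumption. }
  set (s := if Ceq_dec z 0 then 1 else Cmod z ^ K) in *.
  assert (Q := C_derive_bound (fun y => f z y) 0 0 (D * Cmod z ^ K) (Rmin (Rmin 1 rho) s)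
    ltac:(repeat apply Rmin_pos; lra)).
  replace (C_derive (fun y => f z y) 0 - 0)%C
    with (snd (d f) z (RtoC 0)) in Q by (unfold d; simpl; ring).
  apply Q. intros h _ Hh.
  pose proof (Rmin_l (Rmin 1 rho) s). pose proof (Rmin_r (Rmin 1 rho) s).
  destruct (H z h ltac:(lra) ltac:(lra)) as [[_ F1] [F2 [F3 F4]]].
  destruct (H z (RtoC 0) ltac:(lra) ltac:(rewrite Cmod_0; lra)) as [[_ G1] _].
  replace (f z (0 + h) - f z 0 - h * 0)%C with (f z h - f z 0)%C
    by (rewrite Cplus_0_l; ring).
  replace (f z h - f z 0)%C
    with (h * (z * (INR N * h ^ pred (pred N) * q z h + z ^ K * q' z h)))%C.
  2: { rewrite F1, G1, F2. unfold zgw, gw. destruct N as [|[|[|n]]]; try lia. simpl. ring. }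
  rewrite !Cmod_mult, (Rmult_comm (Cmod h)). apply Rmult_le_compat_r; [apply Cmod_ge_0|].
  unfold s in *. destruct (Ceq_dec z 0) as [->|Hz0].
  - rewrite Cmod_0, Rmult_0_l. apply Rmult_le_pos; [exact HD|]. apply pow_le; lra.
  - pose proof (Cmod_ge_0 z). pose proof (Cmod_ge_0 h).
    assert (T : Cmod (INR N * h ^ pred (pred N) * q z h + z ^ K * q' z h)%C
      <= D * Cmod z ^ K).
    { eapply Rle_trans; [apply Cmod_triangle|]. unfold D. rewrite Rmult_plus_distr_r.
      apply Rplus_le_compat.
      - rewrite !Cmod_mult, Cmod_pow, Cmod_R, Rabs_right by (apply Rle_ge, pos_INR).
        assert (P : Cmod h ^ pred (pred N) <= Cmod z ^ K).
        { apply Rle_trans with (Cmod h); [|lra]. destruct N as [|[|[|n]]]; try lia. simpl.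
          assert (Cmod h ^ n <= 1) by (rewrite <- (pow1 n); apply pow_incr; lra). nra. }
        rewrite !(Rmult_assoc (INR N)). apply Rmult_le_compat_l; [apply pos_INR|].
        rewrite Rmult_comm. apply Rmult_le_compat; try apply Cmod_ge_0; try assumption.
        apply pow_le, Cmod_ge_0.
      - rewrite Cmod_mult, Cmod_pow, Rmult_comm. apply Rmult_le_compat_r; [|assumption].
        apply pow_le, Cmod_ge_0. }
    pose proof (Cmod_ge_0 (INR N * h ^ pred (pred N) * q z h + z ^ K * q' z h)%C). nra.
Qed.

Lemma row_bound_spanned (S : row -> Prop) (u : row) :
  (forall v, S v -> row_bound v) -> rows_spanned S u -> row_bound u.
Proof.
  intros HS H. induction H as [u H1 H2|a v t u Ha Hv Ht IH H1 H2].
  - exists 0. split; [lra|].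
    apply (near_imp2 _ _ _ (near_0_r _ H1) (near_0_r _ H2)). unfold germ_zero.
    intros z _ -> ->. rewrite Cmod_0. lra.
  - destruct IH as [A [HA LA]]. destruct (HS v Hv) as [B [HB LB]].
    destruct (holomorphic_bounded a Ha) as [D [HD LD]].
    exists (D * B + A). split; [nra|].
    apply (near_imp2 _ _ _ (near_and _ _ LA (near_and _ _ LB (near_0_r _ LD)))
      (near_and _ _ (near_0_r _ H1) (near_0_r _ H2))).
    unfold germ_add, germ_mul.
    intros z _ [[A1 A2] [[B1 B2] D1]] [-> ->].
    pose proof (Cmod_ge_0 (a z (RtoC 0))).
    pose proof (Cmod_ge_0 (fst v z (RtoC 0))). pose proof (Cmod_ge_0 (snd v z (RtoC 0))).
    split; (eapply Rle_trans; [apply Cmod_triangle|]); rewrite Cmod_mult.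
    + apply Rplus_le_compat; [apply Rmult_le_compat; assumption|assumption].
    + rewrite Rmult_plus_distr_r, Rmult_assoc.
      apply Rplus_le_compat; [apply Rmult_le_compat; assumption|assumption].
Qed.

Lemma row_bound_h1 : row_bound (d (h1 M)).
Proof.
  destruct (holomorphic_bounded _ (holomorphic_monomial (INR M) (pred M) 0)) as [A [HA L]].
  exists A. split; [lra|]. apply (near_imp _ _ (near_0_r _ L)). intros z _ Q.
  destruct (d_h1 M z (RtoC 0)) as [-> ->]. simpl in Q. rewrite Cmult_1_r in Q.
  rewrite Cmod_0. split; [exact Q|]. apply Rmult_le_pos; [lra|]. apply pow_le, Cmod_ge_0.
Qed.

Lemma row_bound_h2 : row_bound (d (h2 K N)).
Proof.
  exists 1. split; [lra|]. apply near_all. intros z _.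
  destruct (d_h2 K N z (RtoC 0)) as [-> ->]. unfold gw. split.
  - rewrite Cmult_0_l, Cmod_0. lra.
  - replace (INR N * 0 ^ pred N + z ^ K)%C with (z ^ K)%C.
    + rewrite Cmod_pow. lra.
    + destruct N as [|[|n]]; try lia. simpl. ring.
Qed.

Lemma rows_1_bound (u : row) : rows 1 u -> row_bound u.
Proof.
  apply row_bound_spanned. intros v [Hv|[f [Hf ->]]].
  - revert Hv. apply row_bound_spanned. intros t [-> | ->];
      [apply row_bound_h1|apply row_bound_h2].
  - now apply row_bound_d.
Qed.

(** An element [z g q] of [I_0] restricts to [z^(K+1) q(z, 0)] on [w = 0], and in a determinant each
    product pairs a bounded dz-component with a dw-component of size [O(z^K)]. *)
Lemma J_1_bound (f : germ) : J 1 f ->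
  exists A : R, near (fun z _ => Cmod (f z (RtoC 0)) <= A * Cmod z ^ K).
Proof.
  intros H.
  change (ideal_generated (fun g => I 0 g \/ is_det_of (rows 1) g) f) in H.
  induction H as [f H|a g h f Ha Hg Hh IH H].
  - exists 0. apply (near_imp _ _ (near_0_r _ H)). unfold germ_zero. intros z _ ->.
    rewrite Cmod_0. lra.
  - assert (G : exists A, 0 <= A /\ near (fun z _ => Cmod (g z (RtoC 0)) <= A * Cmod z ^ K)).
    { destruct Hg as [Hg|[u [v [Hu [Hv ->]]]]].
      - destruct (I_0_factor g Hg) as [q [Hq E]].
        destruct (holomorphic_bounded q Hq) as [A [HA L]].
        exists A. split; [lra|].
        apply (near_imp2 _ _ _ (near_0_r _ (near_and _ _ E L)) (near_ball 1 ltac:(lra))).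
        intros z _ [E1 E2] [Hz _]. rewrite E1. unfold zgw, gw.
        replace (z * (INR N * 0 ^ pred N + z ^ K) * q z 0)%C with (q z 0 * (z * z ^ K))%C.
        + rewrite !Cmod_mult, Cmod_pow. pose proof (Cmod_ge_0 z).
          pose proof (pow_le (Cmod z) K (Cmod_ge_0 z)). pose proof (Cmod_ge_0 (q z (RtoC 0))).
          apply Rmult_le_compat; try assumption; nra.
        + destruct N as [|[|n]]; try lia. simpl. ring.
      - destruct (rows_1_bound u Hu) as [A [HA LA]].
        destruct (rows_1_bound v Hv) as [B [HB LB]].
        exists (2 * (A * B)). split; [nra|].
        apply (near_imp2 _ _ _ LA LB). unfold row_det. intros z _ [A1 A2] [B1 B2].
        unfold Cminus. eapply Rle_trans; [apply Cmod_triangle|].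
        rewrite Cmod_opp, !Cmod_mult.
        assert (T1 : Cmod (fst u z (RtoC 0)) * Cmod (snd v z (RtoC 0))
          <= A * (B * Cmod z ^ K)) by (apply Rmult_le_compat; try apply Cmod_ge_0; assumption).
        assert (T2 : Cmod (snd u z (RtoC 0)) * Cmod (fst v z (RtoC 0))
          <= (A * Cmod z ^ K) * B) by (apply Rmult_le_compat; try apply Cmod_ge_0; assumption).
        lra. }
    destruct G as [A [HA LA]]. destruct IH as [B LB].
    destruct (holomorphic_bounded a Ha) as [D [HD LD]].
    exists (D * A + B).
    apply (near_imp2 _ _ _ (near_and _ _ LA LB) (near_0_r _ (near_and _ _ LD H))).
    unfold germ_add, germ_mul. intros z _ [A1 B1] [D1 ->].
    eapply Rle_trans; [apply Cmod_triangle|]. rewrite Cmod_mult, Rmult_plus_distr_r, Rmult_assoc.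
    apply Rplus_le_compat; [|exact B1].
    apply Rmult_le_compat; try apply Cmod_ge_0; assumption.
Qed.

(** At small positive [z = x] the bound on [J_1] reads [x^s <= A x^K]. *)
Lemma J_1_zpow (s : nat) : J 1 (germ_pow (fun z _ => z) s) -> (K <= s)%nat.
Proof.
  intros H. destruct (J_1_bound _ H) as [A [rho [Hrho L]]].
  apply (power_comparison 1 A rho s K); [lra|exact Hrho|].
  intros x Hx. assert (E : Cmod x = x) by (rewrite Cmod_R, Rabs_right; lra).
  specialize (L x (RtoC 0) ltac:(lra) ltac:(rewrite Cmod_0; lra)).
  unfold germ_pow in L. rewrite Cmod_pow, E in L. lra.
Qed.

Lemma J_1_origin (f : germ) : J 1 f -> f (RtoC 0) (RtoC 0) = RtoC 0.
Proof.
  intros H. destruct (J_1_bound _ H) as [A L]. apply near_origin in L.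
  rewrite Cmod_0, pow_i, Rmult_0_r in L by lia.
  apply Cmod_eq_0. apply Rle_antisym; [exact L|apply Cmod_ge_0].
Qed.

(** * Explicit elements of [J_1], and the end of the algorithm *)

Lemma J_1_zgw : J 1 (zgw K N).
Proof. apply (ideal_incl (fun g => I 0 g \/ is_det_of (rows 1) g)). left. apply I_0_zgw. Qed.

Lemma J_1_det (u v : row) : rows 1 u -> rows 1 v -> J 1 (row_det u v).
Proof.
  intros Hu Hv. apply (ideal_incl (fun g => I 0 g \/ is_det_of (rows 1) g)). right.
  exists u, v. auto.
Qed.

Lemma rows_1_0 (u : row) : rows 0 u -> rows 1 u.
Proof.
  intros H. apply (rows_incl (fun u => rows 0 u \/ exists f, I 0 f /\ u = d f)). now left.
Qed.

Lemma rows_1_zgw : rows 1 (d (zgw K N)).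
Proof.
  apply (rows_incl (fun u => rows 0 u \/ exists f, I 0 f /\ u = d f)). right.
  exists (zgw K N). split; [apply I_0_zgw|reflexivity].
Qed.

Lemma INR_C_neq_0 (n : nat) : (0 < n)%nat -> RtoC (INR n) <> RtoC 0.
Proof. intros Hn E. apply RtoC_inj in E. revert E. apply not_0_INR. lia. Qed.

(** The determinant of [dh_1] and [d (z g)], divided by [M N (N-1)]. *)
Lemma J_1_mixed : J 1 (fun z w => (z ^ M * w ^ pred (pred N))%C).
Proof.
  assert (H := J_1_det _ _ (rows_1_0 _ rows_0_h1) rows_1_zgw).
  generalize (ideal_scal _ (/ (INR M * (INR N * INR (pred N)))) _ H). apply ideal_ext.
  intros z w. unfold row_det.
  destruct (d_h1 M z w) as [-> ->]. destruct (d_zgw K N z w) as [-> ->].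
  assert (RtoC (INR M) <> RtoC 0) by (apply INR_C_neq_0; lia).
  assert (RtoC (INR N) <> RtoC 0) by (apply INR_C_neq_0; lia).
  assert (RtoC (INR (pred N)) <> RtoC 0) by (apply INR_C_neq_0; lia).
  replace (z ^ M)%C with (z * z ^ pred M)%C by (rewrite <- Cpow_S; f_equal; lia).
  field. auto.
Qed.

(** [z^(M-1) (z g) - N w (z^M w^(N-2)) = z^(K+M)]. *)
Lemma J_1_z : J 1 (fun z w => (z ^ (K + M))%C).
Proof.
  assert (H := ideal_plus _ _ _
    (ideal_mul _ _ _ (holomorphic_monomial 1 (pred M) 0) J_1_zgw)
    (ideal_mul _ _ _ (holomorphic_monomial (- INR N) 0 1) J_1_mixed)).
  revert H. apply ideal_ext. intros z w. unfold germ_add, germ_mul, zgw, gw.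
  rewrite Cpow_add_r.
  replace (z ^ M)%C with (z * z ^ pred M)%C by (rewrite <- Cpow_S; f_equal; lia).
  replace (w ^ pred N)%C with (w * w ^ pred (pred N))%C by (rewrite <- Cpow_S; f_equal; lia).
  simpl. ring.
Qed.

(* The determinant of dh_2 and d(z g), where g = N w^(N-1) + z^K, is
   K N (N-1) z^K w^(N-1) - g^2 - K z^K g. *)
Lemma J_1_w : J 1 (fun z w => (w ^ (2 * pred N))%C).
Proof.
  set (k := (K - M)%nat).
  (* [H1] contributes [g^2 + K z^K g - K N (N-1) z^K w^(N-1)]. [H2] cancels the last term together
     with the cross term [2 N z^K w^(N-1)] of [g^2], [H3] cancels [K z^K g], and [H4] cancels
     [z^(2K)]. What remains is [N^2 w^(2N-2)]. *)
  assert (H1 := ideal_scal _ (- (1)) _ (J_1_det _ _ (rows_1_0 _ rows_0_h2) rows_1_zgw)).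
  assert (H2 := ideal_mul _ _ _
    (holomorphic_monomial (INR K * (INR N * INR (pred N)) - INR N * 2) k 1) J_1_mixed).
  assert (H3 := ideal_mul _ _ _ (holomorphic_monomial (- INR K) (pred K) 0) J_1_zgw).
  assert (H4 := ideal_mul _ _ _ (holomorphic_monomial (- (1)) k 0) J_1_z).
  assert (H := ideal_plus _ _ _ (ideal_plus _ _ _ H1 H2) (ideal_plus _ _ _ H3 H4)).
  generalize (ideal_scal _ (/ (INR N * INR N)) _ H). apply ideal_ext.
  intros z w. unfold germ_add, germ_mul, row_det.
  destruct (d_h2 K N z w) as [-> ->]. destruct (d_zgw K N z w) as [-> ->].
  unfold zgw, gw.
  assert (RtoC (INR N) <> RtoC 0) by (apply INR_C_neq_0; lia).
  replace (2 * pred N)%nat with (pred N + pred N)%nat by lia.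
  rewrite !Cpow_add_r.
  replace (w ^ pred N)%C with (w * w ^ pred (pred N))%C by (rewrite <- Cpow_S; f_equal; lia).
  assert (EK : (z ^ K)%C = (z * z ^ pred K)%C) by (rewrite <- Cpow_S; f_equal; lia).
  (* The truncated subtraction in [k = K - M] hides this relation from [ring], which receives it as
     an equation. *)
  assert (E : (z ^ k * z ^ M)%C = (z * z ^ pred K)%C)
    by (rewrite <- EK, <- Cpow_add_r; f_equal; lia).
  rewrite EK, Cpow_1_r. simpl Cpow.
  set (a := (z ^ pred K)%C) in *. set (b := (z ^ k)%C) in *. set (c := (z ^ M)%C) in *.
  set (y := (w ^ pred (pred N))%C).
  match goal with |- (/ ?n * ?x)%C = _ =>
    replace x with (n * ((w * y) * (w * y)))%C by ring [E] end.
  field. exact H0.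
Qed.

Lemma I_1_z : I 1 (fun z _ => z).
Proof.
  split; [apply holomorphic_z|]. exists (K + M)%nat. split; [lia|apply J_1_z].
Qed.

Lemma I_1_w : I 1 (fun _ w => w).
Proof.
  split; [apply holomorphic_w|]. exists (2 * pred N)%nat. split; [lia|apply J_1_w].
Qed.

Lemma I_1_origin (f : germ) : I 1 f -> f (RtoC 0) (RtoC 0) = RtoC 0.
Proof. intros [_ [s [_ H]]]. apply J_1_origin in H. now apply Cpow_integral in H. Qed.

Lemma root_exponent_1_ge (s : nat) : root_exponent (J 1) (I 1) s -> (K <= s)%nat.
Proof. intros [_ H]. apply J_1_zpow. apply H, I_1_z. Qed.

(** Vanishing at the origin gives [f = a z + b w]. Since [z^(K+M)] and [w^(2N-2)] lie in [J_1], the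
    sum of the two exponents works for every f at once. *)
Lemma root_exponent_1 : root_exponent (J 1) (I 1) (K + M + 2 * pred N).
Proof.
  split; [lia|]. intros f Hf. pose proof (I_1_origin f Hf) as F0. destruct Hf as [Hf _].
  destruct (holomorphic_split_z f Hf) as [a [Ha Ea]].
  destruct (holomorphic_split_w _ (holomorphic_0_l f Hf)) as [b [Hb Eb]].
  assert (H : J 1 (germ_pow (germ_add (germ_mul a (fun z _ => z)) (germ_mul b (fun _ w => w)))
    (K + M + 2 * pred N))).
  { apply ideal_binomial;
      [apply holomorphic_mul; [exact Ha|apply holomorphic_z]
      |apply holomorphic_mul; [exact Hb|apply holomorphic_w]| |].
    - generalize (ideal_mul _ _ _ (holomorphic_pow _ (K + M) Ha) J_1_z).
      apply ideal_ext. intros z w. unfold germ_mul, germ_pow. now rewrite Cpow_mult_l.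
    - generalize (ideal_mul _ _ _ (holomorphic_pow _ (2 * pred N) Hb) J_1_w).
      apply ideal_ext. intros z w. unfold germ_mul, germ_pow. now rewrite Cpow_mult_l. }
  revert H. apply ideal_germ_eq. apply (near_imp2 _ _ _ Ea Eb).
  intros z w E1 E2. unfold germ_pow, germ_add, germ_mul. rewrite E1, E2, F0.
  f_equal. ring.
Qed.

Lemma d_z_det_d_w (z w : C) :
  row_det (d (fun z _ => z)) (d (fun _ w => w)) z w = RtoC 1.
Proof.
  unfold row_det, d. simpl.
  rewrite (tangent_C_derive _ z _ (tangent_id z)), (tangent_C_derive _ w _ (tangent_id w)).
  rewrite (tangent_C_derive _ z _ (tangent_const w z)). ring.
Qed.

(** [z] and [w] lie in [I_1], so [dz] and [dw] are allowable rows, of determinant 1. *)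
Lemma J_2_one : J 2 germ_one.
Proof.
  assert (R2 : forall f, I 1 f -> rows 2 (d f)).
  { intros f Hf. apply (rows_incl (fun u => rows 1 u \/ exists f, I 1 f /\ u = d f)).
    right. eauto. }
  assert (H : J 2 (row_det (d (fun z _ => z)) (d (fun _ w => w)))).
  { apply (ideal_incl (fun g => I 1 g \/ is_det_of (rows 2) g)). right.
    eexists; eexists. split; [apply R2, I_1_z|]. split; [apply R2, I_1_w|reflexivity]. }
  revert H. apply ideal_ext. intros z w. rewrite d_z_det_d_w. reflexivity.
Qed.

Lemma I_2_one : I 2 germ_one.
Proof.
  split; [apply (holomorphic_const 1)|]. exists 1%nat. split; [lia|].
  generalize J_2_one. apply ideal_ext. intros z w. unfold germ_pow, germ_one. simpl. ring.
Qed.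

Lemma root_order_2 : root_order (J 2) (I 2) 1.
Proof.
  split; [split; [lia|]|intros t [Ht _]; lia]. intros f [Hf _].
  generalize (ideal_mul _ _ _ Hf J_2_one). apply ideal_ext.
  intros z w. unfold germ_pow, germ_mul, germ_one. simpl. ring.
Qed.

Lemma I_0_not_one : ~ I 0 germ_one.
Proof.
  intros H. destruct (I_0_factor _ H) as [q [_ E]]. apply near_origin in E.
  unfold germ_one, zgw in E. rewrite !Cmult_0_l in E. apply RtoC_inj in E. lra.
Qed.

Lemma I_1_not_one : ~ I 1 germ_one.
Proof. intros H. apply I_1_origin in H. apply RtoC_inj in H. lra. Qed.

Lemma kohn_epsilon_exists :
  exists eps, kohn_epsilon (h1 M) (h2 K N) eps /\ eps <= / INR K.
Proof.
  destruct (root_order_exists _ _ _ root_exponent_0) as [s0 R0].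
  destruct (root_order_exists _ _ _ root_exponent_1) as [s1 R1].
  set (s := fun j => match j with O => s0 | 1%nat => s1 | _ => 1%nat end).
  exists (epsilon_after s 2). split.
  - exists 2%nat, s. split; [|split; [exact I_2_one|split; [|reflexivity]]].
    + intros [|[|[|j]]] Hj; [exact R0|exact R1|exact root_order_2|lia].
    + intros [|[|j]] Hj; [exact I_0_not_one|exact I_1_not_one|lia].
  - assert (L1 : (K <= s1)%nat) by (apply root_exponent_1_ge, R1).
    assert (L0 : 1 <= INR s0) by (apply (le_INR 1); destruct R0 as [[? _] _]; lia).
    assert (LK : 1 <= INR K) by (apply (le_INR 1); lia).
    apply le_INR in L1. simpl.
    assert (B0 : / INR s0 <= 1) by (rewrite <- Rinv_1; apply Rinv_le_contravar; lra).
    assert (P0 : 0 < / INR s0) by (apply Rinv_0_lt_compat; lra).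
    assert (B1 : / INR s1 <= / INR K) by (apply Rinv_le_contravar; lra).
    assert (P1 : 0 < / INR s1) by (apply Rinv_0_lt_compat; lra).
    unfold Rdiv. rewrite Rinv_1. nra.
Qed.

End Kohn.

(** * Orders of vanishing along curves *)

(** [holomorphic1] asks for plain convergence; bounded terms at [rho/2] already make the
    coefficients grow geometrically. *)
Lemma holomorphic1_tame (a : nat -> C) (g : C -> C) (rho : R) : 0 < rho ->
  (forall t : C, Cmod t < rho -> Cseries (fun n => (a n * t ^ n)%C) (g t)) ->
  tame (zpart a).
Proof.
  intros Hr H.
  assert (K := H (RtoC (rho / 2)) ltac:(rewrite Cmod_R, Rabs_right; lra)).
  destruct (Cseries_terms_bounded _ _ K) as [A HA].
  exists A, (Rmax 1 (/ (rho / 2))). split; [apply Rmax_l|].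
  assert (HB : forall n, Cmod (a n) <= A * Rmax 1 (/ (rho / 2)) ^ n).
  { intros n. specialize (HA n).
    rewrite Cmod_mult, Cmod_pow, Cmod_R, Rabs_right in HA by lra.
    assert (0 <= A).
    { eapply Rle_trans; [|exact HA]. apply Rmult_le_pos; [apply Cmod_ge_0|].
      apply pow_le; lra. }
    apply Rle_trans with (A * (/ (rho / 2)) ^ n).
    - rewrite pow_inv. apply Rle_div_r; [apply pow_lt; lra|exact HA].
    - apply Rmult_le_compat_l; [assumption|]. apply pow_incr. split; [|apply Rmax_r].
      left. apply Rinv_0_lt_compat. lra. }
  intros i [|j]; simpl zpart; [rewrite Nat.add_0_r; apply HB|].
  rewrite Cmod_0. apply Rmult_le_pos.
  - specialize (HB 0%nat). simpl in HB. pose proof (Cmod_ge_0 (a 0%nat)). lra.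
  - apply pow_le. pose proof (Rmax_l 1 (/ (rho / 2))). lra.
Qed.

Lemma holomorphic1_expands (g : C -> C) : holomorphic1 g ->
  exists a, tame (zpart a) /\ expands (zpart a) (fun z _ => g z).
Proof.
  intros [a [rho [Hr H]]]. exists a. split; [now apply (holomorphic1_tame a g rho)|].
  exists rho. split; [exact Hr|]. intros z w Hz _. generalize (H z Hz).
  apply Cseries_ext. intros n. now rewrite hom_zpart.
Qed.

Lemma expands_order (a : nat -> C) (g : C -> C) (m : nat) :
  tame (zpart a) -> expands (zpart a) (fun z _ => g z) ->
  (forall n, (n < m)%nat -> a n = RtoC 0) ->
  exists k, holomorphic k /\ k (RtoC 0) (RtoC 0) = a m /\
    near (fun z _ => g z = (z ^ m * k z (RtoC 0))%C).
Proof.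
  intros Ha Hg Hz.
  assert (T : tame (zpart (fun n => a (n + m)%nat))).
  { revert Ha. apply (tame_reindex _ (fun i _ => i + m)%nat (fun _ j => j) m); [intros; lia|].
    intros i [|j]; simpl; auto. }
  destruct (expands_exists _ T) as [k Hk]. exists k.
  split; [rewrite holomorphic_tame; eauto|].
  split; [rewrite (expands_origin _ _ Hk); reflexivity|].
  assert (E : expands (zpart a) (fun z w => (z ^ m * k z w)%C)).
  { generalize (expands_zpow m _ _ Hk). apply expands_ext. intros i j.
    rewrite iter_shz. destruct (m <=? i)%nat eqn:L.
    - apply Nat.leb_le in L. destruct j as [|j]; simpl; [|reflexivity].
      f_equal. lia.
    - apply Nat.leb_gt in L. destruct j as [|j]; simpl; [|reflexivity].
      symmetry. now apply Hz. }
  exact (near_0_r _ (expands_unique _ _ _ Hg E)).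
Qed.

Lemma holomorphic_lower (k : germ) : holomorphic k -> k (RtoC 0) (RtoC 0) <> RtoC 0 ->
  exists c, 0 < c /\ near (fun z _ => c <= Cmod (k z (RtoC 0))).
Proof.
  intros Hk H0. apply Cmod_gt_0 in H0.
  destruct (holomorphic_split_z k Hk) as [k' [Hk' E]].
  destruct (holomorphic_bounded k' Hk') as [B [HB L]].
  set (v := k (RtoC 0) (RtoC 0)) in *.
  exists (Cmod v / 2). split; [lra|].
  assert (Hs : 0 < Cmod v / (2 * B)) by (apply Rdiv_lt_0_compat; lra).
  apply (near_imp2 _ _ _ (near_0_r _ (near_and _ _ E L)) (near_ball _ Hs)).
  intros z _ [E1 L1] [Hz _]. fold v in E1.
  assert (T : Cmod v <= Cmod (k z (RtoC 0)) + Cmod z * B).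
  { replace v with (k z 0 + - (z * k' z 0))%C by (rewrite E1; ring).
    eapply Rle_trans; [apply Cmod_triangle|]. rewrite Cmod_opp, Cmod_mult.
    apply Rplus_le_compat_l. apply Rmult_le_compat_l; [apply Cmod_ge_0|exact L1]. }
  assert (Cmod z * B <= Cmod v / 2).
  { apply Rle_trans with (Cmod v / (2 * B) * B); [apply Rmult_le_compat_r; lra|].
    right. field. lra. }
  lra.
Qed.

Lemma holomorphic_taylor (L : nat) (F : germ) : holomorphic F ->
  exists (l : list C) (k : germ), length l = L /\ holomorphic k /\
    ((0 < L)%nat -> hd (RtoC 0) l = F (RtoC 0) (RtoC 0)) /\
    near (fun z _ => F z (RtoC 0) = (peval l z + z ^ L * k z (RtoC 0))%C).
Proof.
  revert F. induction L as [|L IH]; intros F HF.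
  - exists nil, F. split; [reflexivity|]. split; [exact HF|]. split; [lia|].
    apply near_all. intros. simpl. ring.
  - destruct (holomorphic_split_z F HF) as [F' [HF' E]].
    destruct (IH F' HF') as [l [k [Hl [Hk [_ E']]]]].
    exists (F (RtoC 0) (RtoC 0) :: l), k. split; [simpl; now rewrite Hl|].
    split; [exact Hk|]. split; [reflexivity|].
    apply (near_imp2 _ _ _ (near_0_r _ E) E'). intros z _ -> ->. simpl. ring.
Qed.

(** The Taylor polynomial of degree p averages to its constant term [F(0, 0) = 0], and rotations do
    not affect the size of the remainder. *)
Lemma holomorphic_average (p : nat) (F : germ) :
  holomorphic F -> F (RtoC 0) (RtoC 0) = RtoC 0 ->
  exists A, near (fun z _ =>
    Cmod (Csum (fun k => F (omega p ^ k * z)%C (RtoC 0)) p) <= A * Cmod z ^ S p).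
Proof.
  intros HF F0. destruct (holomorphic_taylor (S p) F HF) as [l [k [Hl [Hk [Hhd E]]]]].
  destruct (holomorphic_bounded k Hk) as [B [HB L]].
  destruct (near_and _ _ E (near_0_r _ L)) as [rho [Hr H]].
  exists ((INR p + 1) * B). exists rho. split; [exact Hr|]. intros z w Hz Hw.
  assert (Hm : forall k, Cmod (omega p ^ k * z)%C = Cmod z)
    by (intros; rewrite Cmod_mult, Cmod_omega_pow; ring).
  rewrite (Csum_ext _ (fun j => peval l (omega p ^ j * z)
    + (omega p ^ j * z) ^ S p * k (omega p ^ j * z) 0)%C).
  2: { intros j _. apply (H _ w); [rewrite Hm; exact Hz|exact Hw]. }
  rewrite Csum_plus, peval_average by lia. rewrite Hhd, F0, Cmult_0_r, Cplus_0_l by lia.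
  eapply Rle_trans; [apply Cmod_Csum|].
  apply Rle_trans with (sum_n (fun _ => B * Cmod z ^ S p) p).
  - apply Rsum_le. intros j _. rewrite Cmod_mult, Cmod_pow, Hm, Rmult_comm.
    apply Rmult_le_compat_r; [apply pow_le, Cmod_ge_0|].
    apply (H _ w); [rewrite Hm; exact Hz|exact Hw].
  - rewrite Rsum_const. lra.
Qed.

(* Averaging over the n+1-st roots of unity removes the harmonic part Re F up
   to O(|t|^(n+1)), and what is left is a sum of nonnegative terms. *)
Lemma harmonic_plus_positive (F : germ) (phi : C -> R) (c A : R) (e n : nat) :
  holomorphic F -> F (RtoC 0) (RtoC 0) = RtoC 0 -> 0 < c ->
  near (fun t _ => c * Cmod t ^ e <= phi t) ->
  near (fun t _ => Rabs (Re (F t (RtoC 0)) + phi t) <= A * Cmod t ^ n) -> (n <= e)%nat.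
Proof.
  intros HF F0 Hc Hphi Hr.
  destruct (holomorphic_average n F HF F0) as [B HB].
  destruct (near_and _ _ HB (near_and _ _ (near_and _ _ Hphi Hr) (near_ball 1 ltac:(lra))))
    as [rho [Hrho H]].
  assert (Hn : 0 < INR n + 1) by (pose proof (pos_INR n); lra).
  apply (power_comparison ((INR n + 1) * c) ((INR n + 1) * A + Rabs B) rho); [nra|exact Hrho|].
  intros x Hx. assert (Ex : Cmod x = x) by (rewrite Cmod_R, Rabs_right; lra).
  assert (Z : Cmod 0 < rho) by (rewrite Cmod_0; lra).
  assert (Hm : forall k, Cmod (omega n ^ k * x)%C = x)
    by (intros; rewrite Cmod_mult, Cmod_omega_pow, Ex; ring).
  destruct (H x (RtoC 0) ltac:(lra) Z) as [B1 [_ [X1 _]]]. rewrite Ex in *.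
  assert (S1 : (INR n + 1) * (c * x ^ e) <= sum_n (fun k => phi (omega n ^ k * x)%C) n).
  { rewrite <- Rsum_const. apply Rsum_le. intros k _.
    destruct (H (omega n ^ k * x)%C (RtoC 0) ltac:(rewrite Hm; lra) Z) as [_ [[Q _] _]].
    now rewrite Hm in Q. }
  assert (S2 : sum_n (fun k => Re (F (omega n ^ k * x)%C (RtoC 0)) + phi (omega n ^ k * x)%C) n
    <= (INR n + 1) * (A * x ^ n)).
  { rewrite <- Rsum_const. apply Rsum_le. intros k _.
    destruct (H (omega n ^ k * x)%C (RtoC 0) ltac:(rewrite Hm; lra) Z) as [_ [[_ Q] _]].
    rewrite Hm in Q. apply Rabs_le_between in Q. lra. }
  assert (S3 : sum_n (fun k => Re (F (omega n ^ k * x)%C (RtoC 0)) + phi (omega n ^ k * x)%C) n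
    = sum_n (fun k => Re (F (omega n ^ k * x)%C (RtoC 0))) n
      + sum_n (fun k => phi (omega n ^ k * x)%C) n).
  { apply (sum_n_plus (G := R_AbelianMonoid)
      (fun k => Re (F (omega n ^ k * x)%C (RtoC 0)))). }
  rewrite <- Re_Csum in S3.
  pose proof (re_le_Cmod (Csum (fun k => F (omega n ^ k * x)%C (RtoC 0)) n)) as S4.
  apply Rabs_le_between in S4.
  assert (S5 : B * x ^ S n <= Rabs B * x ^ n).
  { assert (0 <= x ^ n) by (apply pow_le; lra).
    apply Rle_trans with (Rabs B * x ^ S n).
    - apply Rmult_le_compat_r; [apply pow_le; lra|apply Rle_abs].
    - apply Rmult_le_compat_l; [apply Rabs_pos|]. simpl. nra. }
  lra.
Qed.

Lemma Rbar_lub_le (E : Rbar -> Prop) (b : Rbar) :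
  Rbar_is_upper_bound E b -> Rbar_le (Rbar_lub E) b.
Proof.
  intros H. destruct (Rbar_ex_lub E) as [l Hl].
  rewrite (Rbar_is_lub_unique E l Hl). now apply Hl.
Qed.

Lemma vanishing_order_le (u : C -> R) (T : nat) :
  (forall n A, near (fun t _ => Rabs (u t) <= A * Cmod t ^ n) -> (n <= T)%nat) ->
  Rbar_le (vanishing_order u) (Finite (INR T)).
Proof.
  intros H. unfold vanishing_order.
  apply Rbar_lub_le. intros x [n [-> [A [rho [Hr Q]]]]]. simpl. apply le_INR. apply (H n A).
  exists rho. split; [exact Hr|]. auto.
Qed.

Lemma vanishing_order_eq (u : C -> R) (c A : R) (m : nat) : 0 < c ->
  near (fun t _ => c * Cmod t ^ m <= Rabs (u t)) ->
  near (fun t _ => Rabs (u t) <= A * Cmod t ^ m) ->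
  vanishing_order u = Finite (INR m).
Proof.
  intros Hc Hl [rho [Hr Hu]]. apply Rbar_is_lub_unique. split.
  - intros x [n [-> [B [s [Hs Q]]]]]. simpl. apply le_INR.
    destruct Hl as [r [Hr' Hl]].
    apply (power_comparison c B (Rmin r s)); [exact Hc|now apply Rmin_pos|].
    intros y Hy. pose proof (Rmin_l r s). pose proof (Rmin_r r s).
    assert (E : Cmod y = y) by (rewrite Cmod_R, Rabs_right; lra).
    specialize (Q y ltac:(lra)). specialize (Hl y (RtoC 0) ltac:(lra) ltac:(rewrite Cmod_0; lra)).
    rewrite E in *. lra.
  - intros b Hb. apply Hb. exists m. split; [reflexivity|]. exists A, rho.
    split; [exact Hr|]. intros t Ht. apply (Hu t (RtoC 0) Ht). rewrite Cmod_0. exact Hr.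
Qed.

Lemma Rbar_div_le (v : Rbar) (T m : nat) : (0 < m)%nat ->
  Rbar_le v (Finite (INR (T * m))) ->
  Rbar_le (Rbar_div v (Finite (INR m))) (Finite (INR T)).
Proof.
  intros Hm H. assert (P : 0 < INR m) by (apply lt_0_INR; lia).
  assert (P' : 0 < / INR m) by now apply Rinv_0_lt_compat.
  destruct v as [a| |]; simpl in H |- *; [|contradiction|].
  - rewrite mult_INR in H. apply Rle_div_l; assumption.
  (* The value minus infinity, which [Rbar_lub] gives to an empty set of orders, is unchanged by
     division by [m > 0]. *)
  - unfold Rbar_div, Rbar_mult, Rbar_mult', Rbar_inv.
    destruct (Rle_dec 0 (/ INR m)) as [L|L]; [|lra].
    destruct (Rle_lt_or_eq_dec 0 (/ INR m) L); simpl; [exact Logic.I|lra].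
Qed.

Lemma expands_zero (a : nat -> C) (g : C -> C) :
  (forall n, a n = RtoC 0) -> expands (zpart a) (fun z _ => g z) ->
  near (fun z _ => g z = RtoC 0).
Proof.
  intros Ha H. apply (near_imp _ _ H). intros z w Q. apply (Cseries_unique _ _ _ Q).
  generalize Cseries_zero. apply Cseries_ext. intros n. rewrite hom_zpart, Ha. ring.
Qed.

Lemma least_nat (P : nat -> Prop) : (exists n, P n) ->
  exists n, P n /\ forall k, (k < n)%nat -> ~ P k.
Proof.
  intros [n Hn]. revert Hn. induction n as [n IH] using (well_founded_ind lt_wf). intros Hn.
  destruct (classic (exists k, (k < n)%nat /\ P k)) as [[k [L Hk]]|H].
  - now apply (IH k).
  - exists n. split; [exact Hn|]. intros k L Hk. eauto.
Qed.

(** [m] is the least index at which one of the three series has a nonzero coefficient. It exists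
    because the germ is not constant, and is positive because the curve starts at the origin. *)
Lemma curve_order (zeta : C -> C3) : curve_germ origin zeta ->
  exists (m : nat) (k1 k2 k3 : germ), (0 < m)%nat /\
    (holomorphic k1 /\ holomorphic k2 /\ holomorphic k3) /\
    near (fun t _ => c1 (zeta t) = (t ^ m * k1 t (RtoC 0))%C /\
      c2 (zeta t) = (t ^ m * k2 t (RtoC 0))%C /\ c3 (zeta t) = (t ^ m * k3 t (RtoC 0))%C) /\
    (k1 (RtoC 0) (RtoC 0) <> RtoC 0 \/ k2 (RtoC 0) (RtoC 0) <> RtoC 0 \/
     k3 (RtoC 0) (RtoC 0) <> RtoC 0).
Proof.
  intros [H1 [H2 [H3 [H0 Hn]]]].
  destruct (holomorphic1_expands _ H1) as [a1 [T1 E1]].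
  destruct (holomorphic1_expands _ H2) as [a2 [T2 E2]].
  destruct (holomorphic1_expands _ H3) as [a3 [T3 E3]].
  destruct (least_nat (fun n => a1 n <> RtoC 0 \/ a2 n <> RtoC 0 \/ a3 n <> RtoC 0))
    as [m [Hm Hl]].
  { apply NNPP. intros Hc. apply Hn.
    assert (Z : forall n, a1 n = RtoC 0 /\ a2 n = RtoC 0 /\ a3 n = RtoC 0).
    { intros n. apply NNPP. intros Hc'. apply Hc. exists n.
      destruct (Ceq_dec (a1 n) 0), (Ceq_dec (a2 n) 0), (Ceq_dec (a3 n) 0); tauto. }
    destruct (near_and _ _ (expands_zero _ _ (fun n => proj1 (Z n)) E1)
      (near_and _ _ (expands_zero _ _ (fun n => proj1 (proj2 (Z n))) E2)
        (expands_zero _ _ (fun n => proj2 (proj2 (Z n))) E3))) as [rho [Hr Q]].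
    exists rho. split; [exact Hr|]. intros t Ht.
    destruct (Q t (RtoC 0) Ht ltac:(rewrite Cmod_0; exact Hr)) as [Q1 [Q2 Q3]].
    destruct (zeta t) as [[x y] s]. unfold c1, c2, c3 in *. simpl in *.
    unfold origin. congruence. }
  assert (Z : forall n, (n < m)%nat -> a1 n = RtoC 0 /\ a2 n = RtoC 0 /\ a3 n = RtoC 0).
  { intros n L. specialize (Hl n L).
    destruct (Ceq_dec (a1 n) 0), (Ceq_dec (a2 n) 0), (Ceq_dec (a3 n) 0); tauto. }
  destruct (expands_order a1 _ m T1 E1) as [k1 [K1 [O1 F1]]]; [intros; now apply Z|].
  destruct (expands_order a2 _ m T2 E2) as [k2 [K2 [O2 F2]]]; [intros; now apply Z|].
  destruct (expands_order a3 _ m T3 E3) as [k3 [K3 [O3 F3]]]; [intros; now apply Z|].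
  exists m, k1, k2, k3. split; [|split; [auto|split]].
  - destruct m as [|m]; [|lia]. exfalso.
    pose proof (expands_origin _ _ E1) as X1. pose proof (expands_origin _ _ E2) as X2.
    pose proof (expands_origin _ _ E3) as X3. simpl in X1, X2, X3.
    rewrite H0 in X1, X2, X3. unfold c1, c2, c3, origin in X1, X2, X3. simpl in X1, X2, X3.
    destruct Hm as [Q|[Q|Q]]; apply Q; congruence.
  - exact (near_and _ _ F1 (near_and _ _ F2 F3)).
  - rewrite O1, O2, O3. exact Hm.
Qed.

Lemma dist3_origin (x : C3) :
  dist3 x origin = sqrt (Cmod (c1 x) ^ 2 + Cmod (c2 x) ^ 2 + Cmod (c3 x) ^ 2).
Proof.
  unfold dist3. destruct x as [[a b] c]. unfold origin, c1, c2, c3. simpl.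
  replace (a - 0)%C with a by ring. replace (b - 0)%C with b by ring.
  replace (c - 0)%C with c by ring. reflexivity.
Qed.

Lemma dist3_bounds (x : C3) :
  Cmod (c1 x) <= dist3 x origin /\ Cmod (c2 x) <= dist3 x origin /\
  Cmod (c3 x) <= dist3 x origin /\
  dist3 x origin <= Cmod (c1 x) + Cmod (c2 x) + Cmod (c3 x).
Proof.
  rewrite dist3_origin.
  pose proof (Cmod_ge_0 (c1 x)). pose proof (Cmod_ge_0 (c2 x)). pose proof (Cmod_ge_0 (c3 x)).
  set (a := Cmod (c1 x)) in *. set (b := Cmod (c2 x)) in *. set (c := Cmod (c3 x)) in *.
  repeat split.
  - rewrite <- (sqrt_pow2 a) at 1 by assumption. apply sqrt_le_1_alt. nra.
  - rewrite <- (sqrt_pow2 b) at 1 by assumption. apply sqrt_le_1_alt. nra.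
  - rewrite <- (sqrt_pow2 c) at 1 by assumption. apply sqrt_le_1_alt. nra.
  - rewrite <- (sqrt_pow2 (a + b + c)) by lra. apply sqrt_le_1_alt. nra.
Qed.

Lemma order_lower (k : germ) (g : C -> C) (m : nat) : holomorphic k ->
  k (RtoC 0) (RtoC 0) <> RtoC 0 -> near (fun t _ => g t = (t ^ m * k t (RtoC 0))%C) ->
  exists c, 0 < c /\ near (fun t _ => c * Cmod t ^ m <= Cmod (g t)).
Proof.
  intros Hk H0 E. destruct (holomorphic_lower k Hk H0) as [c [Hc L]].
  exists c. split; [exact Hc|]. apply (near_imp2 _ _ _ E L). intros t _ -> Q.
  rewrite Cmod_mult, Cmod_pow, (Rmult_comm c).
  apply Rmult_le_compat_l; [apply pow_le, Cmod_ge_0|exact Q].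
Qed.

Lemma order_upper (k : germ) (g : C -> C) (m : nat) : holomorphic k ->
  near (fun t _ => g t = (t ^ m * k t (RtoC 0))%C) ->
  exists A, 0 < A /\ near (fun t _ => Cmod (g t) <= A * Cmod t ^ m).
Proof.
  intros Hk E. destruct (holomorphic_bounded k Hk) as [A [HA L]].
  exists A. split; [exact HA|]. apply (near_imp2 _ _ _ E (near_0_r _ L)). intros t _ -> Q.
  rewrite Cmod_mult, Cmod_pow, (Rmult_comm A).
  apply Rmult_le_compat_l; [apply pow_le, Cmod_ge_0|exact Q].
Qed.

Lemma near_sqr_lower (g : C -> C) (c : R) (e : nat) : 0 < c ->
  near (fun t _ => c * Cmod t ^ e <= Cmod (g t)) ->
  near (fun t _ => (c * c) * Cmod t ^ (2 * e) <= Cmod (g t) ^ 2).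
Proof.
  intros Hc H. apply (near_imp _ _ H). intros t _ Q.
  pose proof (pow_le (Cmod t) e (Cmod_ge_0 t)).
  replace (2 * e)%nat with (e + e)%nat by lia. rewrite pow_add.
  replace (c * c * (Cmod t ^ e * Cmod t ^ e)) with ((c * Cmod t ^ e) ^ 2) by ring.
  apply pow_incr. split; [apply Rmult_le_pos; lra|exact Q].
Qed.

(* Testing on t > 0 and on t = x exp(i pi / 2m) sees both Re a and Im a. *)
Lemma real_part_not_small (k : germ) (C0 : R) (m : nat) : (0 < m)%nat -> holomorphic k ->
  k (RtoC 0) (RtoC 0) <> RtoC 0 ->
  ~ near (fun t _ => Rabs (Re (t ^ m * k t (RtoC 0))%C) <= C0 * Cmod t ^ S m).
Proof.
  intros Hm Hk H0 H. destruct (holomorphic_split_z k Hk) as [k' [Hk' E]].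
  destruct (holomorphic_bounded k' Hk') as [B [HB L]].
  set (a := k (RtoC 0) (RtoC 0)) in *.
  destruct (near_and _ _ H (near_0_r _ (near_and _ _ E L))) as [rho [Hr Q]].
  assert (P : forall t : C, Cmod t < rho ->
    Rabs (Re (t ^ m * a)%C) <= (C0 + B) * Cmod t ^ S m).
  { intros t Ht. destruct (Q t (RtoC 0) Ht ltac:(rewrite Cmod_0; exact Hr)) as [Q1 [Q2 Q3]].
    fold a in Q2.
    replace (t ^ m * a)%C with (t ^ m * k t 0 + - (t ^ S m * k' t 0))%C
      by (rewrite Q2, Cpow_S; ring).
    change (Re (t ^ m * k t 0 + - (t ^ S m * k' t 0))%C)
      with (Re (t ^ m * k t 0)%C + Re (- (t ^ S m * k' t 0))%C).
    eapply Rle_trans; [apply Rabs_triang|]. rewrite Rmult_plus_distr_r.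
    apply Rplus_le_compat; [exact Q1|].
    eapply Rle_trans; [apply re_le_Cmod|]. rewrite Cmod_opp, Cmod_mult, Cmod_pow, Rmult_comm.
    apply Rmult_le_compat_r; [apply pow_le, Cmod_ge_0|exact Q3]. }
  assert (Hdir : forall u : C, Cmod u = 1 -> Re (u ^ m * a)%C = 0).
  { intros u Hu. destruct (Req_dec (Re (u ^ m * a)%C) 0) as [Z|Z]; [exact Z|]. exfalso.
    apply Rabs_pos_lt in Z.
    enough (S m <= m)%nat by lia.
    apply (power_comparison (Rabs (Re (u ^ m * a)%C)) (C0 + B) rho); [exact Z|exact Hr|].
    intros x Hx. assert (Ex : Cmod (u * x)%C = x).
    { rewrite Cmod_mult, Hu, Cmod_R, Rabs_right; lra. }
    specialize (P (u * x)%C ltac:(lra)). rewrite Ex in P.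
    replace ((u * x) ^ m * a)%C with ((u ^ m * a) * RtoC (x ^ m))%C in P
      by (rewrite Cpow_mult_l, RtoC_pow; ring).
    replace (Re (u ^ m * a * RtoC (x ^ m))%C) with (Re (u ^ m * a)%C * x ^ m) in P
      by (unfold Re, Cmult, RtoC; simpl; ring).
    rewrite Rabs_mult, (Rabs_right (x ^ m)) in P; [exact P|].
    apply Rle_ge, pow_le. lra. }
  apply H0. pose proof (Hdir (RtoC 1) Cmod_1) as R1. rewrite Cpow_1_l, Cmult_1_l in R1.
  pose proof (Hdir (expi (PI / (2 * INR m))) (Cmod_expi _)) as R2.
  rewrite expi_pow in R2.
  replace (INR m * (PI / (2 * INR m))) with (PI / 2) in R2
    by (field; apply not_0_INR; lia).
  unfold expi in R2. rewrite cos_PI2, sin_PI2 in R2.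
  destruct a as [x y]. unfold Re, Cmult in *. simpl in *. unfold RtoC. f_equal; lra.
Qed.

(** Whichever [k_i(0)] is nonzero bounds the order of r along the curve: by [2 m M] through
    [|h_1|^2], by [2 m N] through [|h_2|^2], or by m through the real part of the third
    coordinate. *)
Lemma curve_ratio_le (K M N : nat) (zeta : C -> C3) :
  (2 <= M)%nat -> (3 <= N)%nat -> (N <= K)%nat -> curve_germ origin zeta ->
  Rbar_le (Rbar_div (vanishing_order (fun t => r_def K M N (zeta t)))
                    (vanishing_order (fun t => dist3 (zeta t) origin)))
          (Finite (INR (2 * max M N))).
Proof.
  intros HM HN HK Hz.
  destruct (curve_order zeta Hz) as [m [k1 [k2 [k3 [Hm [[K1 [K2 K3]] [E Hne]]]]]]].
  assert (E1 : near (fun t _ => c1 (zeta t) = (t ^ m * k1 t (RtoC 0))%C))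
    by (apply (near_imp _ _ E); tauto).
  assert (E2 : near (fun t _ => c2 (zeta t) = (t ^ m * k2 t (RtoC 0))%C))
    by (apply (near_imp _ _ E); tauto).
  assert (E3 : near (fun t _ => c3 (zeta t) = (t ^ m * k3 t (RtoC 0))%C))
    by (apply (near_imp _ _ E); tauto).
  assert (D : vanishing_order (fun t => dist3 (zeta t) origin) = Finite (INR m)).
  { destruct (order_upper _ _ _ K1 E1) as [A1 [P1 U1]].
    destruct (order_upper _ _ _ K2 E2) as [A2 [P2 U2]].
    destruct (order_upper _ _ _ K3 E3) as [A3 [P3 U3]].
    assert (Hd : forall t, Rabs (dist3 (zeta t) origin) = dist3 (zeta t) origin).
    { intros t. apply Rabs_right, Rle_ge. rewrite dist3_origin. apply sqrt_pos. }
    assert (L : exists c, 0 < c /\ near (fun t _ => c * Cmod t ^ m <= Rabs (dist3 (zeta t) origin))).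
    { destruct Hne as [H|[H|H]];
        [destruct (order_lower _ _ _ K1 H E1) as [c [Hc L]]
        |destruct (order_lower _ _ _ K2 H E2) as [c [Hc L]]
        |destruct (order_lower _ _ _ K3 H E3) as [c [Hc L]]];
        exists c; (split; [exact Hc|]); apply (near_imp _ _ L); intros t _ Q;
        rewrite Hd; destruct (dist3_bounds (zeta t)) as [B1 [B2 [B3 _]]]; lra. }
    destruct L as [c [Hc L]].
    apply (vanishing_order_eq _ c (A1 + A2 + A3)); [exact Hc|exact L|].
    apply (near_imp2 _ _ _ U1 (near_and _ _ U2 U3)). intros t _ Q1 [Q2 Q3].
    rewrite Hd. destruct (dist3_bounds (zeta t)) as [_ [_ [_ B]]]. lra. }
  rewrite D. apply Rbar_div_le; [exact Hm|]. apply vanishing_order_le.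
  intros n A Hr.
  set (F := fun z w : C => (z ^ m * k3 z w)%C).
  assert (HF : holomorphic F).
  { apply (holomorphic_mul (germ_pow (fun z _ => z) m) k3);
      [apply holomorphic_pow, holomorphic_z|exact K3]. }
  assert (F0 : F (RtoC 0) (RtoC 0) = RtoC 0).
  { unfold F. destruct m; [lia|]. simpl. ring. }
  set (g1 := fun t => (c1 (zeta t) ^ M)%C).
  set (g2 := fun t => h2 K N (c1 (zeta t)) (c2 (zeta t))).
  assert (Hr' : near (fun t _ => Rabs (Re (F t (RtoC 0))
      + (Cmod (g1 t) ^ 2 + Cmod (g2 t) ^ 2)) <= A * Cmod t ^ n)).
  { apply (near_imp2 _ _ _ Hr E3). intros t _ Q Q3. unfold F. rewrite <- Q3.
    unfold r_def, h1 in Q. unfold g1, g2. rewrite <- Rplus_assoc. exact Q. }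
  assert (G1 : near (fun t _ => g1 t = (t ^ (m * M) * k1 t (RtoC 0) ^ M)%C)).
  { apply (near_imp _ _ E1). intros t _ Q. unfold g1.
    now rewrite Q, Cpow_mult_l, <- Cpow_mult_r. }
  (* The cofactor of [t^(m N)] in [h_2] along the curve. As [K >= N], the term [w z^K] has the
     positive excess exponent [m (K + 1 - N)], so [q2] equals [k2^N] at the origin. *)
  set (q2 := fun z w : C => (k2 z w ^ N + z ^ (m * (K + 1 - N)) * (k2 z w * k1 z w ^ K))%C).
  assert (Hq2 : holomorphic q2).
  { apply (holomorphic_add (germ_pow k2 N)
      (germ_mul (germ_pow (fun z _ => z) (m * (K + 1 - N))) (germ_mul k2 (germ_pow k1 K)))).
    - now apply holomorphic_pow.
    - apply holomorphic_mul; [apply holomorphic_pow, holomorphic_z|].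
      apply holomorphic_mul; [exact K2|now apply holomorphic_pow]. }
  assert (G2 : near (fun t _ => g2 t = (t ^ (m * N) * q2 t (RtoC 0))%C)).
  { apply (near_imp2 _ _ _ E1 E2). intros t _ Q1 Q2. unfold g2, h2, q2.
    rewrite Q1, Q2, !Cpow_mult_l, <- !Cpow_mult_r.
    match goal with |- _ = (?x * (?y + ?u * ?v))%C =>
      replace (x * (y + u * v))%C with (x * y + (x * u) * v)%C by ring end.
    rewrite <- (Cpow_add_r t (m * N)).
    replace (m * N + m * (K + 1 - N))%nat with (m + m * K)%nat by nia.
    rewrite Cpow_add_r. ring. }
  assert (Hmax : (M <= max M N)%nat /\ (N <= max M N)%nat) by lia.
  destruct Hne as [H|[H|H]].
  - destruct (order_lower (germ_pow k1 M) g1 (m * M)) as [c [Hc L]];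
      [now apply holomorphic_pow|now apply Cpow_nz|exact G1|].
    assert (n <= 2 * (m * M))%nat; [|nia].
    apply (harmonic_plus_positive F (fun t => Cmod (g1 t) ^ 2 + Cmod (g2 t) ^ 2)
      (c * c) A _ _ HF F0 ltac:(nra)); [|exact Hr'].
    apply (near_imp _ _ (near_sqr_lower _ _ _ Hc L)). intros t _ Q.
    pose proof (pow_le (Cmod (g2 t)) 2 (Cmod_ge_0 _)). lra.
  - destruct (order_lower q2 g2 (m * N)) as [c [Hc L]]; [exact Hq2| |exact G2|].
    { unfold q2. replace (m * (K + 1 - N))%nat with (S (m * (K + 1 - N) - 1)) by nia.
      rewrite Cpow_S, !Cmult_0_l, Cplus_0_r. now apply Cpow_nz. }
    assert (n <= 2 * (m * N))%nat; [|nia].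
    apply (harmonic_plus_positive F (fun t => Cmod (g1 t) ^ 2 + Cmod (g2 t) ^ 2)
      (c * c) A _ _ HF F0 ltac:(nra)); [|exact Hr'].
    apply (near_imp _ _ (near_sqr_lower _ _ _ Hc L)). intros t _ Q.
    pose proof (pow_le (Cmod (g1 t)) 2 (Cmod_ge_0 _)). lra.
  (* Both squares are [O(|t|^(m+1))], because [2 m M] and [2 m N] exceed m. With [n > m] the real
     part of the third coordinate would be [O(|t|^(m+1))] too, which [k3(0) <> 0] excludes. *)
  - assert (n <= m)%nat; [|nia].
    destruct (Nat.le_gt_cases n m) as [L|L]; [exact L|]. exfalso.
    destruct (order_upper _ _ _ (holomorphic_pow _ M K1) G1) as [B1 [P1 U1]].
    destruct (order_upper _ _ _ Hq2 G2) as [B2 [P2 U2]].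
    apply (real_part_not_small k3 (Rabs A + B1 ^ 2 + B2 ^ 2) m Hm K3 H).
    apply (near_imp2 _ _ _ Hr' (near_and _ _ (near_and _ _ U1 U2) (near_ball 1 ltac:(lra)))).
    intros t _ Q [[Q1 Q2] [Ht _]]. unfold F in Q. pose proof (Cmod_ge_0 t).
    assert (Pw : forall e, (S m <= e)%nat -> 0 <= Cmod t ^ e <= Cmod t ^ S m).
    { intros e He. split; [now apply pow_le|].
      replace e with (S m + (e - S m))%nat by lia. rewrite pow_add.
      rewrite <- (Rmult_1_r (Cmod t ^ S m)) at 2. apply Rmult_le_compat_l; [now apply pow_le|].
      rewrite <- (pow1 (e - S m)). apply pow_incr. lra. }
    assert (Sq : forall g B e, 0 < B -> (S m <= 2 * e)%nat -> Cmod g <= B * Cmod t ^ e ->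
      0 <= Cmod g ^ 2 <= B ^ 2 * Cmod t ^ S m).
    { intros g B e HB He Hg. split; [apply pow_le, Cmod_ge_0|].
      apply Rle_trans with ((B * Cmod t ^ e) ^ 2); [apply pow_incr; split; [apply Cmod_ge_0|exact Hg]|].
      rewrite Rpow_mult_distr, <- pow_mult, Nat.mul_comm.
      apply Rmult_le_compat_l; [apply pow_le; lra|]. now apply Pw. }
    pose proof (Sq _ _ (m * M)%nat P1 ltac:(nia) Q1) as S1. pose proof (Sq _ _ (m * N)%nat P2 ltac:(nia) Q2) as S2.
    assert (S3 : A * Cmod t ^ n <= Rabs A * Cmod t ^ S m).
    { apply Rle_trans with (Rabs A * Cmod t ^ n).
      - apply Rmult_le_compat_r; [now apply pow_le|apply Rle_abs].
      - apply Rmult_le_compat_l; [apply Rabs_pos|]. now apply Pw. }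
    rewrite !Rmult_plus_distr_r. apply Rabs_le_between. apply Rabs_le_between in Q. lra.
Qed.

(** * Curves that attain the type *)

Lemma holomorphic1_id : holomorphic1 (fun t => t).
Proof.
  exists (fun n => match n with 1%nat => RtoC 1 | _ => RtoC 0 end), 1.
  split; [lra|]. intros t _. generalize (Cseries_shift _ _ (Cseries_head t)).
  apply Cseries_ext. intros [|[|n]]; simpl; ring.
Qed.

Lemma holomorphic1_zero : holomorphic1 (fun _ => RtoC 0).
Proof.
  exists (fun _ => RtoC 0), 1. split; [lra|]. intros t _.
  generalize Cseries_zero. apply Cseries_ext. intros n. ring.
Qed.

Lemma vanishing_order_pow (u : C -> R) (m : nat) :
  (forall t, u t = Cmod t ^ m) -> vanishing_order u = Finite (INR m).
Proof.
  intros H. apply (vanishing_order_eq u 1 1); [lra|..];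
    apply near_all; intros t _; rewrite H, Rabs_right; try lra;
    apply Rle_ge, pow_le, Cmod_ge_0.
Qed.

(** The bound is attained on a coordinate axis, where one of [h_1], [h_2] vanishes and r equals
    [|t|^(2M)] or [|t|^(2N)]. *)
Lemma hypersurface_type_r_def (K M N : nat) :
  (2 <= M)%nat -> (3 <= N)%nat -> (N <= K)%nat ->
  hypersurface_type (r_def K M N) origin = Finite (INR (2 * max M N)).
Proof.
  intros HM HN HK. apply Rbar_is_lub_unique. split.
  - intros x [zeta [Hz ->]]. now apply curve_ratio_le.
  - intros b Hb. apply Hb.
    assert (Hnc : ~ exists rho, 0 < rho /\ forall t : C, Cmod t < rho -> t = RtoC 0).
    { intros [rho [Hr H]].
      assert (E := H (RtoC (rho / 2)) ltac:(rewrite Cmod_R, Rabs_right; lra)).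
      apply RtoC_inj in E. lra. }
    assert (Hdiv : Finite (INR (2 * max M N))
      = Rbar_div (Finite (INR (2 * max M N))) (Finite (INR 1))).
    { simpl. f_equal. field. }
    destruct (Nat.le_gt_cases N M) as [L|L].
    + exists (fun t => (t, RtoC 0, RtoC 0)). split.
      * split; [apply holomorphic1_id|]. split; [apply holomorphic1_zero|].
        split; [apply holomorphic1_zero|]. split; [reflexivity|].
        intros [rho [Hr H]]. apply Hnc. exists rho. split; [exact Hr|]. intros t Ht.
        specialize (H t Ht). unfold origin in H. congruence.
      * rewrite (vanishing_order_pow _ (2 * max M N)), (vanishing_order_pow _ 1); [exact Hdiv|..].
        -- intros t. rewrite dist3_origin. unfold c1, c2, c3. simpl fst. simpl snd.
           rewrite !Cmod_0. replace (Cmod t ^ 2 + 0 ^ 2 + 0 ^ 2) with (Cmod t ^ 2) by ring.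
           rewrite sqrt_pow2 by apply Cmod_ge_0. ring.
        -- intros t. unfold r_def, h1, h2, c1, c2, c3. simpl fst. simpl snd.
           replace (0 ^ N + 0 * t ^ K)%C with (RtoC 0)
             by (destruct N; [lia|]; simpl; ring).
           rewrite Cmod_0, Cmod_pow, <- pow_mult. replace (max M N) with M by lia.
           rewrite (Nat.mul_comm M). unfold Re. simpl fst. simpl (0 ^ 2). ring.
    + exists (fun t => (RtoC 0, t, RtoC 0)). split.
      * split; [apply holomorphic1_zero|]. split; [apply holomorphic1_id|].
        split; [apply holomorphic1_zero|]. split; [reflexivity|].
        intros [rho [Hr H]]. apply Hnc. exists rho. split; [exact Hr|]. intros t Ht.
        specialize (H t Ht). unfold origin in H. congruence.
      * rewrite (vanishing_order_pow _ (2 * max M N)), (vanishing_order_pow _ 1); [exact Hdiv|..].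
        -- intros t. rewrite dist3_origin. unfold c1, c2, c3. simpl fst. simpl snd.
           rewrite !Cmod_0. replace (0 ^ 2 + Cmod t ^ 2 + 0 ^ 2) with (Cmod t ^ 2) by ring.
           rewrite sqrt_pow2 by apply Cmod_ge_0. ring.
        -- intros t. unfold r_def, h1, h2, c1, c2, c3. simpl fst. simpl snd.
           replace (t ^ N + t * 0 ^ K)%C with (t ^ N)%C
             by (destruct K; [lia|]; simpl; ring).
           replace (0 ^ M)%C with (RtoC 0) by (destruct M; [lia|]; simpl; ring).
           rewrite Cmod_0, Cmod_pow, <- pow_mult. replace (max M N) with N by lia.
           rewrite (Nat.mul_comm N). unfold Re. simpl fst. simpl (0 ^ 2). ring.
Qed.

(** * The model domain *)

Definition ispoly (f : C -> C) : Prop := exists l, forall t, f t = peval l t.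

Lemma ispoly_ext (f g : C -> C) : (forall t, f t = g t) -> ispoly f -> ispoly g.
Proof. intros H [l Hl]. exists l. intros t. now rewrite <- H. Qed.

Lemma ispoly_const (u : C) : ispoly (fun _ => u).
Proof. exists (u :: nil). intros t. simpl. ring. Qed.

Lemma ispoly_mul_id (f : C -> C) : ispoly f -> ispoly (fun t => (t * f t)%C).
Proof. intros [l Hl]. exists (RtoC 0 :: l). intros t. simpl. rewrite Hl. ring. Qed.

Lemma ispoly_plus (f g : C -> C) : ispoly f -> ispoly g -> ispoly (fun t => (f t + g t)%C).
Proof.
  intros [l Hl] [m Hm].
  assert (H : forall l m, ispoly (fun t => (peval l t + peval m t)%C)).
  { clear. induction l as [|a l IH]; intros m.
    - exists m. intros t. simpl. ring.
    - destruct m as [|b m].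
      + exists (a :: l). intros t. simpl. ring.
      + destruct (IH m) as [n Hn]. exists ((a + b)%C :: n). intros t. simpl.
        rewrite <- Hn. ring. }
  generalize (H l m). apply ispoly_ext. intros t. now rewrite Hl, Hm.
Qed.

Lemma ispoly_mult (f g : C -> C) : ispoly f -> ispoly g -> ispoly (fun t => (f t * g t)%C).
Proof.
  intros [l Hl] [m Hm].
  assert (S : forall a m, ispoly (fun t => (a * peval m t)%C)).
  { clear. intros a m. induction m as [|b m IH].
    - exists nil. intros t. simpl. ring.
    - destruct IH as [n Hn]. exists ((a * b)%C :: n). intros t. simpl. rewrite <- Hn. ring. }
  assert (H : forall l m, ispoly (fun t => (peval l t * peval m t)%C)).
  { clear -S. intros l m. induction l as [|a l IH].
    - exists nil. intros t. simpl. ring.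
    - generalize (ispoly_plus _ _ (S a m) (ispoly_mul_id _ IH)). apply ispoly_ext.
      intros t. simpl. ring. }
  generalize (H l m). apply ispoly_ext. intros t. now rewrite Hl, Hm.
Qed.

Lemma ispoly_pow (f : C -> C) (n : nat) : ispoly f -> ispoly (fun t => (f t ^ n)%C).
Proof.
  intros H. induction n as [|n IH]; [apply (ispoly_const 1)|].
  exact (ispoly_mult _ _ H IH).
Qed.

Lemma expi_2PI_pow (k : nat) : expi (INR k * (2 * PI)) = RtoC 1.
Proof.
  rewrite <- expi_pow. unfold expi at 1. rewrite cos_2PI, sin_2PI. apply (Cpow_1_l k).
Qed.

Lemma circle_mean_monomial (a : C) (k : nat) : (0 < k)%nat ->
  is_RInt (fun theta => Re (a * expi theta ^ k)%C) 0 (2 * PI) 0.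
Proof.
  intros Hk. assert (HK : INR k <> 0) by (apply not_0_INR; lia).
  destruct a as [x y].
  assert (H : is_RInt (fun theta => x * cos (INR k * theta) - y * sin (INR k * theta))
    0 (2 * PI) (minus ((x * sin (INR k * (2 * PI)) + y * cos (INR k * (2 * PI))) / INR k)
                      ((x * sin (INR k * 0) + y * cos (INR k * 0)) / INR k))).
  { apply (is_RInt_derive (fun theta =>
      (x * sin (INR k * theta) + y * cos (INR k * theta)) / INR k)).
    - intros t _. auto_derive; [exact Logic.I|]. field. exact HK.
    - intros t _. apply (ex_derive_continuous
        (fun theta => x * cos (INR k * theta) - y * sin (INR k * theta))).
      auto_derive. exact Logic.I. }
  pose proof (expi_2PI_pow k) as E. injection E as E1 E2.
  rewrite E1, E2, (Rmult_0_r (INR k)), sin_0, cos_0 in H.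
  rewrite minus_eq_zero in H.
  revert H. apply is_RInt_ext. intros t _. rewrite expi_pow.
  unfold Re, Cmult, expi. simpl. ring.
Qed.

(** A factor [expi theta ^ k] with [k > 0] is carried through the induction on the coefficients, so
    that every monomial met has positive exponent and mean 0. *)
Lemma circle_mean_poly (Q : C -> C) : ispoly Q -> Q (RtoC 0) = RtoC 0 ->
  is_RInt (fun theta => Re (Q (expi theta))) 0 (2 * PI) 0.
Proof.
  intros [l Hl] H0.
  assert (H : forall l k, (0 < k)%nat ->
    is_RInt (fun theta => Re (peval l (expi theta) * expi theta ^ k)%C) 0 (2 * PI) 0).
  { clear. induction l as [|a l IH]; intros k Hk.
    - generalize (circle_mean_monomial 0 k Hk). apply is_RInt_ext. intros t _. reflexivity.
    - generalize (is_RInt_plus _ _ _ _ _ _ (circle_mean_monomial a k Hk)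
        (IH (S k) ltac:(lia))). change (@plus R_NormedModule) with Rplus.
      rewrite Rplus_0_r. apply is_RInt_ext. intros t _. simpl peval. rewrite Cpow_S.
      generalize (expi t ^ k)%C (peval l (expi t)) (expi t). intros u v w.
      unfold Re, Cmult, Cplus. simpl. ring. }
  destruct l as [|a l].
  - generalize (H nil 1%nat ltac:(lia)). apply is_RInt_ext. intros t _. rewrite Hl. simpl.
    unfold Re, Cmult. simpl. ring.
  - assert (Ha : a = RtoC 0).
    { rewrite Hl in H0. simpl in H0. rewrite Cmult_0_l, Cplus_0_r in H0. exact H0. }
    generalize (H l 1%nat ltac:(lia)). apply is_RInt_ext. intros t _. rewrite Hl, Ha.
    apply (f_equal Re). simpl. ring.
Qed.

(** * Continuity through real and imaginary parts *)

Definition ccont {T : UniformSpace} (f : T -> C) (x : T) : Prop :=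
  continuous (fun t => Re (f t)) x /\ continuous (fun t => Im (f t)) x.

Lemma Rcont_plus {T : UniformSpace} (f g : T -> R) (x : T) :
  continuous f x -> continuous g x -> continuous (fun t => f t + g t) x.
Proof. intros H K. exact (continuous_plus (V := R_NormedModule) f g x H K). Qed.

Lemma Rcont_mult {T : UniformSpace} (f g : T -> R) (x : T) :
  continuous f x -> continuous g x -> continuous (fun t => f t * g t) x.
Proof. intros H K. exact (continuous_mult (K := R_AbsRing) f g x H K). Qed.

Lemma Rcont_opp {T : UniformSpace} (f : T -> R) (x : T) :
  continuous f x -> continuous (fun t => - f t) x.
Proof. intros H. exact (continuous_opp (V := R_NormedModule) f x H). Qed.

Lemma Rcont_pow {T : UniformSpace} (f : T -> R) (n : nat) (x : T) :
  continuous f x -> continuous (fun t => f t ^ n) x.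
Proof.
  intros H. induction n as [|n IH]; [apply continuous_const|].
  exact (Rcont_mult f _ x H IH).
Qed.

Section ComplexContinuity.

Context {T : UniformSpace}.
Implicit Types (f g : T -> C) (x : T).

Lemma ccont_const (u : C) x : ccont (fun _ => u) x.
Proof. split; apply continuous_const. Qed.

Lemma ccont_RtoC (h : T -> R) x : continuous h x -> ccont (fun t => RtoC (h t)) x.
Proof. intros H. split; [exact H|apply (continuous_const 0)]. Qed.

Lemma ccont_plus f g x : ccont f x -> ccont g x -> ccont (fun t => (f t + g t)%C) x.
Proof. intros [F1 F2] [G1 G2]. split; apply Rcont_plus; assumption. Qed.

Lemma ccont_mult f g x : ccont f x -> ccont g x -> ccont (fun t => (f t * g t)%C) x.
Proof.
  intros [F1 F2] [G1 G2]. split.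
  - apply (Rcont_plus (fun t => Re (f t) * Re (g t)) (fun t => - (Im (f t) * Im (g t)))).
    + now apply Rcont_mult.
    + now apply Rcont_opp, Rcont_mult.
  - apply (Rcont_plus (fun t => Re (f t) * Im (g t)) (fun t => Im (f t) * Re (g t)));
      now apply Rcont_mult.
Qed.

Lemma ccont_pow f n x : ccont f x -> ccont (fun t => (f t ^ n)%C) x.
Proof.
  intros H. induction n as [|n IH]; [apply (ccont_const 1)|].
  exact (ccont_mult f _ x H IH).
Qed.

Lemma cont_Cmod_sqr f x : ccont f x -> continuous (fun t => Cmod (f t) ^ 2) x.
Proof.
  intros [F1 F2].
  apply (continuous_ext (fun t => Re (f t) ^ 2 + Im (f t) ^ 2));
    [intros t; symmetry; apply Cmod2_alt|].
  apply Rcont_plus; now apply Rcont_pow.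
Qed.

Lemma continuous_pair {U V : UniformSpace} (f : T -> U) (g : T -> V) x :
  continuous f x -> continuous g x -> continuous (fun t => (f t, g t)) x.
Proof.
  intros F G P [eps HP].
  assert (F' : locally x (fun t => ball (f x) eps (f t))) by (apply F; now exists eps).
  assert (G' : locally x (fun t => ball (g x) eps (g t))) by (apply G; now exists eps).
  change (locally x (fun t => P (f t, g t))).
  generalize (filter_and _ _ F' G'). apply filter_imp. intros t [Ft Gt].
  apply HP. now split.
Qed.

Lemma ccont_continuous f x : ccont f x -> continuous (f : T -> C_UniformSpace) x.
Proof.
  intros [H1 H2]. apply (continuous_ext (fun t => (Re (f t), Im (f t)))).
  - intros t. now destruct (f t).
  - exact (continuous_pair (fun t => Re (f t)) (fun t => Im (f t)) x H1 H2).
Qed.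

End ComplexContinuity.

Definition norm2 (x : C3) : R := Cmod (c1 x) ^ 2 + Cmod (c2 x) ^ 2 + Cmod (c3 x) ^ 2.

Definition ccont3 {T : UniformSpace} (f : T -> C3) (x : T) : Prop :=
  ccont (fun t => c1 (f t)) x /\ ccont (fun t => c2 (f t)) x /\ ccont (fun t => c3 (f t)) x.

Lemma ccont3_continuous {T : UniformSpace} (f : T -> C3) (x : T) :
  ccont3 f x -> continuous (f : T -> C * C * C) x.
Proof.
  intros [H1 [H2 H3]].
  apply ccont_continuous in H1. apply ccont_continuous in H2. apply ccont_continuous in H3.
  apply (continuous_ext (fun t => (c1 (f t), c2 (f t), c3 (f t)))).
  - intros t. now destruct (f t) as [[a b] c].
  - exact (continuous_pair _ _ x (continuous_pair _ _ x H1 H2) H3).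
Qed.

Lemma ccont_id (x : C) : ccont (fun t : C_UniformSpace => t) x.
Proof.
  destruct x as [a b].
  split; [apply (continuous_fst (U := R_UniformSpace) (V := R_UniformSpace) a b)
    |apply (continuous_snd (U := R_UniformSpace) (V := R_UniformSpace) a b)].
Qed.

Lemma ccont_comp {T : UniformSpace} (f : T -> C) (x : T) :
  continuous (f : T -> C_UniformSpace) x -> ccont f x.
Proof.
  intros H. destruct (ccont_id (f x)) as [H1 H2]. split.
  - apply (continuous_comp f (fun z : C_UniformSpace => Re z) x H H1).
  - apply (continuous_comp f (fun z : C_UniformSpace => Im z) x H H2).
Qed.

Lemma ccont3_id (x : C3) : ccont3 (fun t : C * C * C => t) (x : C * C * C).
Proof.
  destruct x as [[a b] c].
  assert (F : continuous (fun t : C * C * C => fst t) ((a, b, c) : C * C * C))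
    by apply (continuous_fst (U := prod_UniformSpace C_UniformSpace C_UniformSpace)
      (V := C_UniformSpace) (a, b) c).
  split; [|split]; apply ccont_comp.
  - apply (continuous_comp (fun t : C * C * C => fst t) (fun t : C * C => fst t) _ F).
    apply (continuous_fst (U := C_UniformSpace) (V := C_UniformSpace) a b).
  - apply (continuous_comp (fun t : C * C * C => fst t) (fun t : C * C => snd t) _ F).
    apply (continuous_snd (U := C_UniformSpace) (V := C_UniformSpace) a b).
  - apply (continuous_snd (U := prod_UniformSpace C_UniformSpace C_UniformSpace)
      (V := C_UniformSpace) (a, b) c).
Qed.

Lemma continuous_norm2 {T : UniformSpace} (f : T -> C3) (x : T) :
  ccont3 f x -> continuous (fun t => norm2 (f t)) x.
Proof.
  intros [H1 [H2 H3]]. unfold norm2.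
  apply Rcont_plus; [apply Rcont_plus|]; now apply cont_Cmod_sqr.
Qed.

Lemma continuous_r_def {T : UniformSpace} (K M N : nat) (f : T -> C3) (x : T) :
  ccont3 f x -> continuous (fun t => r_def K M N (f t)) x.
Proof.
  intros [H1 [H2 H3]]. unfold r_def, h1, h2.
  apply Rcont_plus; [apply Rcont_plus; [apply H3|]|]; apply cont_Cmod_sqr.
  - now apply ccont_pow.
  - apply ccont_plus; [now apply ccont_pow|]. apply ccont_mult; [assumption|].
    now apply ccont_pow.
Qed.

Lemma locally_lt {T : UniformSpace} (f : T -> R) (x : T) (b : R) :
  continuous f x -> f x < b -> locally x (fun t => f t < b).
Proof. intros H L. exact (H (fun y => y < b) (open_lt b (f x) L)). Qed.

(** If U and V separated b from x, the function equal to 1 where the path lies in U and to -1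
    elsewhere would be locally constant, against the intermediate value theorem. *)
Lemma connected_by_paths (A : C3 -> Prop) (b : C3) (gamma : C3 -> R -> C3) :
  A b ->
  (forall x tau, A x -> 0 <= tau <= 1 -> A (gamma x tau)) ->
  (forall x, gamma x 0 = b) -> (forall x, gamma x 1 = x) ->
  (forall x tau, continuous (gamma x : R -> C * C * C) tau) ->
  connected3 A.
Proof.
  intros Ab HA H0 H1 Hc.
  assert (Main : forall U V : C3 -> Prop, open3 U -> open3 V ->
    (forall x, A x -> U x \/ V x) -> (forall x, ~ (A x /\ U x /\ V x)) ->
    U b -> forall x, A x -> U x).
  { intros U V OU OV HUV Hd Ub x Ax. apply NNPP. intros Ux.
    (* The path stays in A for [0 <= tau <= 1] only, while [IVT_cor] asks for continuity on the
       whole line; clamping extends the path by constants. *)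
    set (clamp := fun tau => Rmax 0 (Rmin 1 tau)).
    assert (Hcl : forall tau, 0 <= clamp tau <= 1).
    { intros tau. unfold clamp. split; [apply Rmax_l|].
      apply Rmax_lub; [lra|apply Rmin_l]. }
    assert (Cc : forall tau, continuous clamp tau).
    { intros tau. apply (continuous_comp (fun t => Rmin 1 t) (Rmax 0)).
      - apply (continuous_ext (fun t => (1 + t - Rabs (t - 1)) / 2)).
        + intros t. unfold Rmin, Rabs. destruct (Rle_dec 1 t), (Rcase_abs (t - 1)); lra.
        + apply (Rcont_mult (fun t => 1 + t - Rabs (t - 1)) (fun _ => / 2));
            [|apply continuous_const].
          apply (Rcont_plus (fun t => 1 + t) (fun t => - Rabs (t - 1))).
          * apply Rcont_plus; [apply continuous_const|apply continuous_id].
          * apply Rcont_opp. apply (continuous_comp (fun t => t - 1) Rabs);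
              [|apply continuous_Rabs].
            apply (Rcont_plus (fun t => t) (fun _ => - (1)));
              [apply continuous_id|apply continuous_const].
      - apply (continuous_ext (fun t => (t + Rabs t) / 2)).
        + intros t. unfold Rmax, Rabs. destruct (Rle_dec 0 t), (Rcase_abs t); lra.
        + apply (Rcont_mult (fun t => t + Rabs t) (fun _ => / 2));
            [|apply continuous_const].
          apply Rcont_plus; [apply continuous_id|apply continuous_Rabs]. }
    set (g := fun tau => gamma x (clamp tau)).
    assert (Cg : forall tau, continuous (g : R -> C * C * C) tau).
    { intros tau. apply (continuous_comp clamp (gamma x : R -> C * C * C)); auto. }
    assert (Ag : forall tau, A (g tau)) by (intros; now apply HA).
    set (f := fun tau => if excluded_middle_informative (U (g tau)) then 1 else - (1)).
    assert (Cf : continuity f).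
    { intros tau. apply continuity_pt_filterlim.
      assert (L : locally tau (fun t => f t = f tau)).
      { destruct (classic (U (g tau))) as [Ut|Ut].
        - assert (W : locally tau (fun t => U (g t))) by exact (Cg tau U (OU _ Ut)).
          revert W. apply filter_imp. intros t Ht.
          unfold f. destruct (excluded_middle_informative (U (g t))); [|tauto].
          destruct (excluded_middle_informative (U (g tau))); [reflexivity|tauto].
        - assert (Vt : V (g tau)) by (destruct (HUV _ (Ag tau)); tauto).
          assert (W : locally tau (fun t => V (g t))) by exact (Cg tau V (OV _ Vt)).
          revert W. apply filter_imp. intros t Ht.
          unfold f. destruct (excluded_middle_informative (U (g t))) as [Q|Q].
          + exfalso. apply (Hd (g t)). auto.
          + destruct (excluded_middle_informative (U (g tau))); [tauto|reflexivity]. }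
      intros P HP. apply locally_singleton in HP.
      change (locally tau (fun t => P (f t))). generalize L. apply filter_imp.
      intros t ->. exact HP. }
    assert (F0 : f 0 = 1).
    { unfold f, g, clamp. rewrite Rmin_right, Rmax_left, H0 by lra.
      destruct (excluded_middle_informative (U b)); [reflexivity|tauto]. }
    assert (F1 : f 1 = - (1)).
    { unfold f, g, clamp. rewrite Rmin_left, Rmax_right, H1 by lra.
      destruct (excluded_middle_informative (U x)); [tauto|reflexivity]. }
    destruct (IVT_cor f 0 1 Cf ltac:(lra)) as [s [_ Hs]]; [rewrite F0, F1; lra|].
    unfold f in Hs. destruct (excluded_middle_informative (U (g s))); lra. }
  intros U V OU OV HUV Hd. destruct (HUV b Ab) as [Ub|Vb].
  - left. now apply (Main U V).
  - right. apply (Main V U); auto.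
    + intros x Ax. destruct (HUV x Ax); auto.
    + intros x [? [? ?]]. apply (Hd x). auto.
Qed.

(** * Connectedness of the model domain *)

Definition model_domain (K M N : nat) (x : C3) : Prop := r_def K M N x < 0.

(* (z, w) is scaled with the weights (N - 1, K), for which w^N + w z^K is
   homogeneous. *)
Definition scaling_path (K N : nat) (x : C3) (tau : R) : C3 :=
  ((RtoC (tau ^ pred N) * c1 x)%C, (RtoC (tau ^ K) * c2 x)%C,
   (RtoC tau * c3 x + RtoC (tau - 1))%C).

Lemma Cmod_sqr_scaling (tau : R) (e : nat) (v : C) : (0 < e)%nat -> 0 <= tau <= 1 ->
  Cmod (RtoC (tau ^ e) * v)%C ^ 2 <= tau * Cmod v ^ 2.
Proof.
  intros He Ht. rewrite Cmod_mult, Cmod_R, Rabs_right by (apply Rle_ge, pow_le; lra).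
  rewrite Rpow_mult_distr. apply Rmult_le_compat_r; [apply pow_le, Cmod_ge_0|].
  rewrite <- pow_mult. replace (e * 2)%nat with (S (e * 2 - 1)) by lia. simpl.
  assert (tau ^ (e * 2 - 1) <= 1) by (rewrite <- (pow1 (e * 2 - 1)); apply pow_incr; lra).
  nra.
Qed.

(** The weights turn [h_1] and [h_2] into [tau^((N-1) M) h_1] and [tau^(K N) h_2], whose squared
    moduli shrink at least by the factor tau, while the third coordinate moves linearly to -1. Hence
    [r < 0] persists along the path. *)
Lemma r_def_scaling (K M N : nat) (x : C3) (tau : R) :
  (0 < M)%nat -> (2 <= N)%nat -> (0 < K)%nat -> 0 <= tau <= 1 ->
  r_def K M N (scaling_path K N x tau) <= tau * r_def K M N x + (tau - 1).
Proof.
  intros HM HN HK Ht. unfold r_def, scaling_path.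
  destruct x as [[a b] s]. unfold c1, c2, c3. simpl fst. simpl snd.
  unfold h1, h2.
  rewrite !Cpow_mult_l, <- !RtoC_pow, <- !pow_mult.
  replace (RtoC (tau ^ (K * N)) * b ^ N + RtoC (tau ^ K) * b * (RtoC (tau ^ (pred N * K)) * a ^ K))%C
    with (RtoC (tau ^ (K * N)) * (b ^ N + b * a ^ K))%C.
  2: { replace (K * N)%nat with (K + pred N * K)%nat by nia.
       rewrite pow_add, RtoC_mult. ring. }
  pose proof (Cmod_sqr_scaling tau (pred N * M) (a ^ M) ltac:(nia) Ht).
  pose proof (Cmod_sqr_scaling tau (K * N) (b ^ N + b * a ^ K)%C ltac:(nia) Ht).
  replace (Re (RtoC tau * s + RtoC (tau - 1))%C) with (tau * Re s + (tau - 1))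
    by (unfold Re, Cplus, Cmult, RtoC; simpl; ring).
  lra.
Qed.

Lemma model_domain_connected (K M N : nat) :
  (0 < M)%nat -> (2 <= N)%nat -> (0 < K)%nat -> connected3 (model_domain K M N).
Proof.
  intros HM HN HK.
  assert (E0 : forall x, scaling_path K N x 0 = (RtoC 0, RtoC 0, RtoC (- (1)))).
  { intros x. unfold scaling_path. rewrite !pow_i by lia. f_equal; [f_equal|];
      rewrite Cmult_0_l; [reflexivity..|]. unfold RtoC, Cplus. simpl. f_equal; ring. }
  apply (connected_by_paths _ (RtoC 0, RtoC 0, RtoC (- (1))) (scaling_path K N)).
  - unfold model_domain. rewrite <- (E0 origin).
    pose proof (r_def_scaling K M N origin 0 HM HN HK ltac:(lra)). lra.
  - intros x tau Hx Ht. unfold model_domain in *.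
    pose proof (r_def_scaling K M N x tau HM HN HK Ht). nra.
  - exact E0.
  - intros [[a b] s]. unfold scaling_path, c1, c2, c3. simpl fst. simpl snd.
    rewrite !pow1. replace (1 - 1) with 0 by ring.
    f_equal; [f_equal|]; ring.
  - intros x tau. apply ccont3_continuous. unfold scaling_path.
    assert (Ct : forall e, continuous (fun t : R => t ^ e) tau)
      by (intros; apply Rcont_pow, continuous_id).
    split; [|split]; simpl.
    + apply ccont_mult; [apply (ccont_RtoC (fun t : R => t ^ pred N)), Ct|apply ccont_const].
    + apply ccont_mult; [apply (ccont_RtoC (fun t : R => t ^ K)), Ct|apply ccont_const].
    + apply ccont_plus.
      * apply ccont_mult; [apply (ccont_RtoC (fun t : R => t)), continuous_id|apply ccont_const].
      * apply (ccont_RtoC (fun t : R => t - 1)).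
        apply (Rcont_plus (fun t : R => t) (fun _ => - (1)));
          [apply continuous_id|apply continuous_const].
Qed.

Lemma model_domain_open (K M N : nat) : open3 (model_domain K M N).
Proof.
  intros x Hx.
  apply (locally_lt (fun t : C * C * C => r_def K M N t) (x : C * C * C) 0); [|exact Hx].
  apply continuous_r_def, ccont3_id.
Qed.

(** * Pseudoconvexity of the model domain *)

Definition exhaustion (K M N : nat) (x : C3) : R := norm2 x + / (- r_def K M N x).

Lemma continuous_exhaustion {T : UniformSpace} (K M N : nat) (f : T -> C3) (x : T) :
  ccont3 f x -> r_def K M N (f x) < 0 -> continuous (fun t => exhaustion K M N (f t)) x.
Proof.
  intros Hf Hr. apply Rcont_plus; [now apply continuous_norm2|].
  apply (continuous_comp (fun t => - r_def K M N (f t)) Rinv);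
    [now apply Rcont_opp, continuous_r_def|].
  apply continuous_Rinv. lra.
Qed.

(* The tangent plane at p(0) to |p|^2, a real-affine function of p. *)
Lemma Cmod_sqr_minorant (p p0 : C) :
  Cmod p0 ^ 2 + Re (2 * Cconj p0 * (p - p0))%C <= Cmod p ^ 2.
Proof.
  rewrite !Cmod2_alt. destruct p as [a b], p0 as [x y].
  unfold Re, Im, Cconj, Cmult, Cminus, Cplus, Copp, RtoC. simpl.
  pose proof (Rle_0_sqr (a - x)). pose proof (Rle_0_sqr (b - y)). unfold Rsqr in *. lra.
Qed.

(** The source of the sub-mean value inequality: on a complex line the function lies above its
    central value plus the real part of a polynomial without constant term, whose circle mean is 0.
    Tangent planes give such minorants for squared moduli of polynomials, and [-1/s] is convex and
    increasing for [s < 0], so a minorant of r yields one of [-1/r]. *)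
Lemma exhaustion_minorant (K M N : nat) (x v : C3) :
  exists Q : C -> C, ispoly Q /\ Q (RtoC 0) = RtoC 0 /\
    forall t, r_def K M N x < 0 -> r_def K M N (line_point x v t) < 0 ->
      exhaustion K M N x + Re (Q t) <= exhaustion K M N (line_point x v t).
Proof.
  set (l1 := fun t => (c1 x + t * c1 v)%C). set (l2 := fun t => (c2 x + t * c2 v)%C).
  set (l3 := fun t => (c3 x + t * c3 v)%C).
  set (q1 := fun t => h1 M (l1 t) (l2 t)). set (q2 := fun t => h2 K N (l1 t) (l2 t)).
  set (mn := fun (p : C -> C) t => (2 * Cconj (p (RtoC 0)) * (p t - p (RtoC 0)))%C).
  assert (A : forall a b : C, ispoly (fun t => (a + t * b)%C)).
  { intros a b. apply (ispoly_plus (fun _ => a)); [apply ispoly_const|].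
    apply (ispoly_mul_id (fun _ => b)), ispoly_const. }
  assert (P1 : ispoly l1) by apply A. assert (P2 : ispoly l2) by apply A.
  assert (P3 : ispoly l3) by apply A.
  assert (S1 : ispoly q1) by now apply ispoly_pow.
  assert (S2 : ispoly q2).
  { apply ispoly_plus; [now apply ispoly_pow|]. apply ispoly_mult; [exact P2|].
    now apply ispoly_pow. }
  assert (Pmn : forall p, ispoly p -> ispoly (mn p)).
  { intros p Hp. apply (ispoly_mult (fun _ => (2 * Cconj (p (RtoC 0)))%C)); [apply ispoly_const|].
    apply ispoly_plus; [exact Hp|apply (ispoly_const (- p (RtoC 0)))]. }
  assert (Zmn : forall p, mn p (RtoC 0) = RtoC 0) by (intros; unfold mn; ring).
  set (R0 := r_def K M N x).
  set (D := fun t => ((l3 t + - c3 x) + (mn q1 t + mn q2 t))%C).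
  set (E := fun t => (mn l1 t + (mn l2 t + mn l3 t))%C).
  (* [E] belongs to [|x|^2] and [D] to [r - R0]; the weight of [D] is the derivative [1/R0^2] of
     [-1/s] at [s = R0]. *)
  exists (fun t => (E t + RtoC (/ (R0 * R0)) * D t)%C).
  assert (Z1 : l1 (RtoC 0) = c1 x) by (unfold l1; ring).
  assert (Z2 : l2 (RtoC 0) = c2 x) by (unfold l2; ring).
  assert (Z3 : l3 (RtoC 0) = c3 x) by (unfold l3; ring).
  split; [|split].
  - apply ispoly_plus.
    + apply ispoly_plus; [now apply Pmn|]. apply ispoly_plus; now apply Pmn.
    + apply ispoly_mult; [apply ispoly_const|]. apply ispoly_plus.
      * apply ispoly_plus; [exact P3|apply (ispoly_const (- c3 x))].
      * apply ispoly_plus; now apply Pmn.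
  - unfold E, D. rewrite !Zmn, Z3. ring.
  - intros t Hx Ht. fold R0 in Hx.
    assert (Re_plus : forall a b : C, Re (a + b)%C = Re a + Re b) by reflexivity.
    assert (Lr : R0 + Re (D t) <= r_def K M N (line_point x v t)).
    { change (r_def K M N (line_point x v t))
        with (Re (l3 t) + Cmod (q1 t) ^ 2 + Cmod (q2 t) ^ 2).
      pose proof (Cmod_sqr_minorant (q1 t) (q1 (RtoC 0))).
      pose proof (Cmod_sqr_minorant (q2 t) (q2 (RtoC 0))).
      assert (ER : R0 = Re (c3 x) + Cmod (q1 (RtoC 0)) ^ 2 + Cmod (q2 (RtoC 0)) ^ 2)
        by (unfold q1, q2; now rewrite Z1, Z2).
      unfold D, mn. rewrite !Re_plus. change (Re (- c3 x)%C) with (- Re (c3 x)). lra. }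
    assert (Ln : norm2 x + Re (E t) <= norm2 (line_point x v t)).
    { change (norm2 (line_point x v t)) with (Cmod (l1 t) ^ 2 + Cmod (l2 t) ^ 2 + Cmod (l3 t) ^ 2).
      unfold norm2. rewrite <- Z1, <- Z2, <- Z3. unfold E, mn. rewrite !Re_plus.
      pose proof (Cmod_sqr_minorant (l1 t) (l1 (RtoC 0))).
      pose proof (Cmod_sqr_minorant (l2 t) (l2 (RtoC 0))).
      pose proof (Cmod_sqr_minorant (l3 t) (l3 (RtoC 0))). lra. }
    unfold exhaustion. fold R0. rewrite Re_plus.
    replace (Re (RtoC (/ (R0 * R0)) * D t)%C) with (/ (R0 * R0) * Re (D t))
      by (unfold Re, Cmult, RtoC; simpl; ring).
    set (s := r_def K M N (line_point x v t)) in *.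
    assert (PP : 0 < / (R0 * R0)) by (apply Rinv_0_lt_compat; nra).
    assert (I1 : / (R0 * R0) * Re (D t) <= / (R0 * R0) * (s - R0))
      by (apply Rmult_le_compat_l; lra).
    (* The tangent line of [-1/s] at [R0] lies below the graph on [s < 0]. *)
    assert (I2 : / (- R0) + / (R0 * R0) * (s - R0) <= / (- s)).
    { apply Rminus_le.
      replace (/ - R0 + / (R0 * R0) * (s - R0) - / - s)
        with ((s - R0) ^ 2 / (R0 * R0 * s)) by (field; lra).
      unfold Rdiv. rewrite <- (Rmult_0_r ((s - R0) ^ 2)).
      apply Rmult_le_compat_l; [apply pow2_ge_0|]. left. apply Rinv_lt_0_compat.
      assert (0 < R0 * R0) by nra. nra. }
    lra.
Qed.

Lemma model_domain_pseudoconvex (K M N : nat) : pseudoconvex (model_domain K M N).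
Proof.
  exists (exhaustion K M N). split; [|split].
  - intros x Hx.
    apply (continuous_exhaustion K M N (fun t : C * C * C => t) (x : C * C * C));
      [apply ccont3_id|exact Hx].
  - intros x v H. destruct (exhaustion_minorant K M N x v) as [Q [PQ [Q0 HQ]]].
    assert (Hx : r_def K M N x < 0).
    { specialize (H (RtoC 0) ltac:(rewrite Cmod_0; lra)). unfold model_domain in H.
      replace (line_point x v (RtoC 0)) with x in H; [exact H|].
      destruct x as [[a b] s]. unfold line_point, c1, c2, c3. simpl.
      f_equal; [f_equal|]; ring. }
    assert (Hc : forall theta, r_def K M N (line_point x v (expi theta)) < 0).
    { intros theta. apply H. rewrite Cmod_expi. lra. }
    pose proof PI_RGT_0.
    assert (I1 := is_RInt_plus _ _ _ _ _ _
      (is_RInt_const 0 (2 * PI) (exhaustion K M N x)) (circle_mean_poly Q PQ Q0)).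
    assert (Cu : forall theta, continuous
      (fun theta => exhaustion K M N (line_point x v (expi theta))) theta).
    { intros theta.
      apply (continuous_exhaustion K M N (fun theta => line_point x v (expi theta))); [|apply Hc].
      assert (Ce : ccont expi theta).
      { split; [apply continuous_cos|apply continuous_sin]. }
      split; [|split]; apply ccont_plus; try apply ccont_const;
        apply ccont_mult; try apply ccont_const; exact Ce. }
    assert (I2 : ex_RInt (fun theta => exhaustion K M N (line_point x v (expi theta)))
      0 (2 * PI)).
    { apply (ex_RInt_continuous (V := R_CompleteNormedModule)). intros; apply Cu. }
    apply (RInt_correct (V := R_CompleteNormedModule)) in I2.
    assert (L := is_RInt_le _ _ 0 (2 * PI) _ _ ltac:(lra) I1 I2).
    cbv beta in L.
    assert (L' : 2 * PI * exhaustion K M N x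
      <= RInt (fun theta => exhaustion K M N (line_point x v (expi theta))) 0 (2 * PI)).
    { eapply Rle_trans; [|apply L].
      - right. unfold scal, plus. simpl. unfold mult. simpl. ring.
      - intros theta _. apply HQ; [exact Hx|apply Hc]. }
    apply (Rmult_le_reg_l (2 * PI)); [lra|].
    rewrite <- Rmult_assoc, Rinv_r, Rmult_1_l by lra. exact L'.
  - intros b. split.
    + intros x Hx.
      set (r := r_def K M N).
      (* Multiplying by [-r] describes the sublevel set by two closed conditions on continuous
         functions. They make sense on all of [C3], also where [r = 0] and the exhaustion function
         blows up, and the second one excludes [r = 0]. *)
      assert (E : forall y : C3, (r y <= 0 /\ 1 <= r y * (norm2 y - b)) <->
        (model_domain K M N y /\ exhaustion K M N y <= b)).
      { intros y. unfold model_domain, exhaustion. fold r. split.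
        - intros [H1 H2]. assert (r y < 0) by (destruct H1 as [H1|H1]; [exact H1|rewrite H1 in H2; lra]).
          split; [assumption|]. apply (Rmult_le_reg_l (- r y)); [lra|].
          rewrite Rmult_plus_distr_l, Rinv_r by lra. lra.
        - intros [H1 H2]. split; [lra|].
          apply (Rmult_le_compat_l (- r y)) in H2; [|lra].
          rewrite Rmult_plus_distr_l, Rinv_r in H2 by lra. lra. }
      rewrite <- E in Hx.
      assert (Cr : continuous (fun y : C * C * C => r y) (x : C * C * C))
        by apply continuous_r_def, ccont3_id.
      destruct (Rlt_or_le 0 (r x)) as [L|L].
      * assert (Q : locally (x : C * C * C) (fun y : C * C * C => - r y < 0))
          by (apply locally_lt; [now apply Rcont_opp|lra]).
        revert Q. apply filter_imp. intros y Hy. rewrite <- E. lra.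
      * assert (Q : locally (x : C * C * C) (fun y : C * C * C => r y * (norm2 y + - b) < 1)).
        { apply locally_lt.
          - apply Rcont_mult; [exact Cr|]. apply Rcont_plus; [|apply continuous_const].
            apply continuous_norm2, ccont3_id.
          - apply Rnot_le_lt. intros Hc. apply Hx. split; [exact L|exact Hc]. }
        revert Q. apply filter_imp. intros y Hy. rewrite <- E. lra.
    + exists (sqrt b). intros x [Hx Hb]. rewrite dist3_origin. apply sqrt_le_1_alt.
      unfold exhaustion in Hb. unfold model_domain in Hx.
      assert (0 < / (- r_def K M N x)) by (apply Rinv_0_lt_compat; lra).
      fold (norm2 x). lra.
Qed.

Lemma r_def_axis (K M N : nat) (s : R) : (0 < M)%nat -> (0 < N)%nat ->
  r_def K M N (RtoC 0, RtoC 0, RtoC s) = s.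
Proof.
  intros HM HN. unfold r_def, h1, h2, c1, c2, c3. simpl fst. simpl snd.
  replace (0 ^ M)%C with (RtoC 0) by (destruct M; [lia|]; simpl; ring).
  replace (0 ^ N + 0 * 0 ^ K)%C with (RtoC 0) by (destruct N; [lia|]; simpl; ring).
  rewrite Cmod_0. unfold Re. simpl. ring.
Qed.

Lemma model_domain_is_domain (K M N : nat) :
  (0 < M)%nat -> (2 <= N)%nat -> (0 < K)%nat -> is_domain K M N (model_domain K M N).
Proof.
  intros HM HN HK. split; [apply model_domain_open|].
  split; [now apply model_domain_connected|]. split; [apply model_domain_pseudoconvex|].
  split.
  - intros P HP.
    (* On this axis r is the coordinate [s] itself, so points of both kinds lie arbitrarily close to
       the origin. *)
    set (ax := fun s : R => (RtoC 0, RtoC 0, RtoC s) : C3).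
    assert (Ca : continuous (ax : R -> C * C * C) 0).
    { apply ccont3_continuous. split; [|split]; simpl; try apply ccont_const.
      apply (ccont_RtoC (fun s : R => s)), continuous_id. }
    destruct (Ca P HP) as [eps He].
    assert (B : forall s, Rabs s < eps -> P (ax s)).
    { intros s Hs. apply He. change (Rabs (s - 0) < eps). now rewrite Rminus_0_r. }
    pose proof (cond_pos eps). split.
    + exists (ax (- (eps / 2))). split.
      * apply B. rewrite Rabs_Ropp, Rabs_right; lra.
      * unfold model_domain, ax. rewrite r_def_axis by lia. lra.
    + exists (ax (eps / 2)). split.
      * apply B. rewrite Rabs_right; lra.
      * unfold model_domain, ax. rewrite r_def_axis by lia. lra.
  - apply filter_forall. intros x. reflexivity.
Qed.

Theorem proposition4p4 :
  (* the order of the root in the second step is at least K *)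
  (forall (K M N : nat) (Omega : C3 -> Prop),
     (M < K)%nat -> (2 <= M)%nat -> (3 <= N)%nat -> is_domain K M N Omega ->
     forall s : nat, (0 < s)%nat ->
       (forall f : germ, kohn_I (h1 M) (h2 K N) 1 f ->
                         kohn_J (h1 M) (h2 K N) 1 (germ_pow f s)) ->
       (K <= s)%nat)
  /\
  (* it is not bounded in terms of the type: for all M and N it is unbounded
     over domains of the same type 2 max(M, N) *)
  (forall M N : nat, (2 <= M)%nat -> (3 <= N)%nat ->
     forall B : nat,
       exists (K : nat) (Omega : C3 -> Prop) (s : nat),
         (M < K)%nat /\ is_domain K M N Omega /\
         hypersurface_type (r_def K M N) origin = Finite (INR (2 * max M N)) /\
         root_order (kohn_J (h1 M) (h2 K N) 1) (kohn_I (h1 M) (h2 K N) 1) s /\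
         (B <= s)%nat)
  /\
  (* nor is the epsilon of the procedure bounded below in terms of the type *)
  (forall M N : nat, (2 <= M)%nat -> (3 <= N)%nat ->
     forall delta : R, 0 < delta ->
       exists (K : nat) (Omega : C3 -> Prop) (eps : R),
         (M < K)%nat /\ is_domain K M N Omega /\
         hypersurface_type (r_def K M N) origin = Finite (INR (2 * max M N)) /\
         kohn_epsilon (h1 M) (h2 K N) eps /\
         eps < delta).
Proof.
  split; [|split].
  - intros K M N Omega HK HM HN _ s Hs H.
    apply (root_exponent_1_ge K M N HM HN HK). now split.
  (* This K exceeds M, is at least N, so that the type is [2 max(M, N)], and is at least B. *)
  - intros M N HM HN B. set (K := (M + N + B)%nat).
    assert (HK : (M < K)%nat) by lia.
    destruct (root_order_exists _ _ _ (root_exponent_1 K M N HM HN HK)) as [s Hs].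
    exists K, (model_domain K M N), s. split; [exact HK|].
    split; [apply model_domain_is_domain; lia|].
    split; [apply hypersurface_type_r_def; lia|]. split; [exact Hs|].
    pose proof (root_exponent_1_ge K M N HM HN HK s (proj1 Hs)). lia.
  - intros M N HM HN delta Hdelta.
    (* Here [B + 1 > 1/delta], and K will be at least [B + 1], so [eps <= 1/K < delta]. *)
    destruct (nfloor_ex (/ delta)) as [B [_ HB]]; [left; now apply Rinv_0_lt_compat|].
    set (K := (M + N + B)%nat). assert (HK : (M < K)%nat) by lia.
    destruct (kohn_epsilon_exists K M N HM HN HK) as [eps [Heps L]].
    exists K, (model_domain K M N), eps. split; [exact HK|].
    split; [apply model_domain_is_domain; lia|].
    split; [apply hypersurface_type_r_def; lia|]. split; [exact Heps|].
    eapply Rle_lt_trans; [exact L|].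
    assert (P : 0 < / delta) by now apply Rinv_0_lt_compat.
    assert (LK : / delta < INR K).
    { eapply Rlt_le_trans; [exact HB|]. rewrite <- S_INR. apply le_INR. lia. }
    rewrite <- (Rinv_inv delta). apply Rinv_lt_contravar; [|exact LK].
    apply Rmult_lt_0_compat; lra.
Qed.
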